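(* Let $\alpha\in\mathbb{R}$. Suppose $f\in\mathcal{J}_\alpha$ and suppose that $\mathcal{R}(f)$ satisfies condition NZAC on the disk $(1/\sqrt2)\mathbb{D}$. Then $f$ is cyclic in $\mathcal{D}_\alpha$ precisely when $\alpha\le 3/2$, and, for those $\alpha$ for which $\varphi_{\alpha-1/2}$ is defined (that is, $1/2\le\alpha\le 3/2$), $$\mathrm{dist}^2_{\mathcal{D}_\alpha}(1,f\cdot\mathcal{P}_n)\asymp\frac{1}{\varphi_{\alpha-1/2}(n+1)}\qquad(n\to\infty).$$
   Context: Let $\mathbb{B}^2=\{(z_1,z_2)\in\mathbb{C}^2: |z_1|^2+|z_2|^2<1\}$ and $(1/\sqrt2)\mathbb{D}=\{z\in\mathbb{C}:|z|<1/\sqrt2\}$. For $\alpha\in\mathbb{R}$, the Dirichlet-type space $\mathcal{D}_\alpha$ consists of the analytic functions $F(z_1,z_2)=\sum_{k,l\ge 0}a_{k,l}z_1^kz_2^l$ on $\mathbb{B}^2$ with $$\|F\|_\alpha^2=\sum_{k=0}^\infty\sum_{l=0}^\infty(2+k+l)^\alpha\frac{k!\,l!}{(1+k+l)!}|a_{k,l}|^2<\infty.$$ $\mathcal{J}_\alpha$ is the closed subspace of $\mathcal{D}_\alpha$ consisting of the functions of the form $f(z_1,z_2)=\sum_{k\ge0}a_k(z_1z_2)^k$. For $f\in\mathcal{J}_\alpha$, $\mathcal{R}(f)$ is the analytic function on $(1/\sqrt2)\mathbb{D}$ given by $\mathcal{R}(f)(z)=f(z,1/\sqrt2)=\sum_{k\ge0}2^{-k/2}a_kz^k$.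 A function $F\in\mathcal{D}_\alpha$ is cyclic in $\mathcal{D}_\alpha$ if the closed linear span in $\mathcal{D}_\alpha$ of $\{z_1^kz_2^lF: k,l=0,1,2,\dots\}$ is all of $\mathcal{D}_\alpha$. Condition NZAC (on the disk $(1/\sqrt2)\mathbb{D}$) for a function $g$ analytic there: $g$ has no zeros in $(1/\sqrt2)\mathbb{D}$, $g$ admits an analytic continuation to a strictly bigger concentric disk, and $g$ has at least one zero on the circle $|z|=1/\sqrt2$. $\mathcal{P}_n$ denotes the space of polynomials in two complex variables of degree at most $2n$, and $\mathrm{dist}_{\mathcal{D}_\alpha}(1,F\cdot\mathcal{P}_n)=\inf_{p\in\mathcal{P}_n}\|p\cdot F-1\|_\alpha$. For $\beta\in[0,1)$ set $\varphi_\beta(n)=n^{1-\beta}$ ($n=1,2,\dots$), and set $\varphi_1(n)=\sum_{j=1}^n j^{-1}$. The notation $A_n\asymp B_n$ means that the two quantities are bounded by constant multiples of each other, with positive constants independent of $n$ (they may depend on $f$ and $\alpha$). *)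

(* Defs.v *)
From Stdlib Require Export Reals Factorial.
From Coquelicot Require Export Coquelicot.

(* Functions on B^2, or on a disk centred at 0, are represented by total
   functions on C * C, or on C; every notion below only inspects the values
   inside the relevant domain. *)

Definition in_ball2 (z1 z2 : C) : Prop := (Cmod z1 ^ 2 + Cmod z2 ^ 2 < 1)%R.

Definition is_double_series {K : AbsRing} {V : NormedModule K}
    (u : nat -> nat -> V) (s : V) : Prop :=
  exists b : nat -> V,
    (forall k, is_series (u k) (b k)) /\ is_series b s.

(* F is the analytic function on B^2 with Taylor coefficients a. On the complete
   Reinhardt domain B^2 a Taylor series converges absolutely, so the order of
   summation is immaterial. *)
Definition has_taylor2 (F : C -> C -> C) (a : nat -> nat -> C) : Prop :=
  forall z1 z2 : C, in_ball2 z1 z2 ->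
    (exists s : R,
       is_double_series (V := R_NormedModule)
         (fun k l => Cmod (a k l * (z1 ^ k * z2 ^ l))%C) s) /\
    is_double_series (V := C_NormedModule)
      (fun k l => (a k l * (z1 ^ k * z2 ^ l))%C) (F z1 z2).

Definition D_weight (alpha : R) (k l : nat) : R :=
  (Rpower (INR (2 + k + l)) alpha
   * (INR (fact k) * INR (fact l) / INR (fact (1 + k + l))))%R.

(* F belongs to D_alpha and its norm there is N. *)
Definition is_D_norm (alpha : R) (F : C -> C -> C) (N : R) : Prop :=
  (0 <= N)%R /\
  exists a : nat -> nat -> C,
    has_taylor2 F a /\
    is_double_series (V := R_NormedModule)
      (fun k l => (D_weight alpha k l * Cmod (a k l) ^ 2)%R) (N ^ 2)%R.

Definition in_D (alpha : R) (F : C -> C -> C) : Prop :=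
  exists N : R, is_D_norm alpha F N.

Definition in_J (alpha : R) (f : C -> C -> C) : Prop :=
  in_D alpha f /\
  exists a : nat -> C, forall z1 z2 : C, in_ball2 z1 z2 ->
    is_series (V := C_NormedModule) (fun k => (a k * (z1 * z2) ^ k)%C) (f z1 z2).

Definition restr (f : C -> C -> C) : C -> C :=
  fun z => f z (RtoC (1 / sqrt 2)).

(* Sum of u k l over all k, l with k + l <= d. *)
Definition sum_tri (d : nat) (u : nat -> nat -> C) : C :=
  sum_n (fun k => sum_n (fun l => u k l) (d - k)) d.

Definition poly2 (d : nat) (c : nat -> nat -> C) (z1 z2 : C) : C :=
  sum_tri d (fun k l => (c k l * (z1 ^ k * z2 ^ l))%C).

(* The linear span of { z1^k z2^l F }. *)
Definition in_shift_span (F G : C -> C -> C) : Prop :=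
  exists (d : nat) (c : nat -> nat -> C), forall z1 z2 : C,
    G z1 z2 = sum_tri d (fun k l => (c k l * (z1 ^ k * z2 ^ l * F z1 z2))%C).

Definition cyclic (alpha : R) (F : C -> C -> C) : Prop :=
  forall G : C -> C -> C, in_D alpha G ->
  forall eps : R, (0 < eps)%R ->
  exists (H : C -> C -> C) (N : R),
    in_shift_span F H /\
    is_D_norm alpha (fun z1 z2 => (H z1 z2 - G z1 z2)%C) N /\ (N < eps)%R.

(* dist(1, F . P_n), where P_n is the space of polynomials of total degree at
   most 2n. For F in D_alpha the set below is nonempty and bounded below by 0,
   so its infimum in Rbar is finite. *)
Definition dist1 (alpha : R) (F : C -> C -> C) (n : nat) : R :=
  real (Glb_Rbar (fun N => exists c : nat -> nat -> C,
    is_D_norm alpha (fun z1 z2 => (poly2 (2 * n) c z1 z2 * F z1 z2 - 1)%C) N)).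

(* Analytic on |z| < r: locally the sum of a convergent power series. *)
Definition analytic_on_disk (r : R) (g : C -> C) : Prop :=
  forall w : C, (Cmod w < r)%R ->
  exists (b : nat -> C) (rho : R), (0 < rho)%R /\
    forall z : C, (Cmod (z - w) < rho)%R ->
      is_pseries (K := C_AbsRing) (V := C_NormedModule) b (z - w)%C (g z).

Definition NZAC (s : R) (g : C -> C) : Prop :=
  analytic_on_disk s g /\
  (forall z : C, (Cmod z < s)%R -> g z <> RtoC 0) /\
  exists (r : R) (G : C -> C),
    (s < r)%R /\ analytic_on_disk r G /\
    (forall z : C, (Cmod z < s)%R -> G z = g z) /\
    exists z : C, Cmod z = s /\ G z = RtoC 0.

(* Only meaningful for 0 <= beta <= 1 and 1 <= n. *)
Definition phi (beta : R) (n : nat) : R :=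
  if Req_EM_T beta 1 then sum_n_m (fun j => / INR j)%R 1 n
  else Rpower (INR n) (1 - beta).

Definition asymp (A B : nat -> R) : Prop :=
  exists c1 c2 : R, (0 < c1)%R /\ (0 < c2)%R /\
    forall n : nat, (c1 * B n <= A n <= c2 * B n)%R.

(* Main.v *)
Require Import Defs.
From Stdlib Require Import Lra Lia Psatz Classical ClassicalEpsilon List Arith.

(** Writing [f(z1, z2) = g(2 z1 z2)], orthogonal projection onto diagonal monomials
    turns the distance problem for [f] into the one for [g] in a weighted Hardy space of
    the unit disk with weights of size [(k + 1)^beta], [beta = alpha - 1/2]; here [g]
    extends past the unit circle, has no zeros inside and at least one on the circle.

    Upper bound: [g] is a product of finitely many factors [1 - s z], [|s| = 1], times a
    unit [kappa] of a larger disk. With [u] the polynomial whose coefficients are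
    proportional to [(k + 1)^(- beta)], [k <= n], and sum to [1], each factor [1 - s z]
    divides [1 - u (s z)], and the product of these polynomials differs from [1] by
    coefficients of the size of those of [u], whose squared norm is of order
    [1 / Phi beta n]; [1 / kappa] is replaced by a Taylor polynomial.

    Lower bound: [e = q g - 1] takes the value [-1] at a zero of [g]; since [1 / g] has
    subexponential coefficients, the coefficients of [e] of index above [2 n] are
    negligible, and Cauchy-Schwarz applies to the remaining ones.

    The decay of Taylor coefficients comes from Cauchy's estimate, obtained by comparing
    Riemann sums over roots of unity on circles of different radii. *)

Local Open Scope R_scope.

(** * Series and convolution *)

(** The exponent shift by [1/2] comes from [4^k (k!)^2 / (2k+1)!], which is of size [(k+1)^(-1/2)].
    Multiplication by [f] preserves the difference of the exponents of [z1] and [z2], so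
    off-diagonal terms of [p] can only enlarge the norm of [p f - 1]. The two bounds match because
    both come from one Cauchy-Schwarz inequality: among polynomials of degree at most [n] with value
    [1] at a given point of the circle, the least squared norm for the weights [(k+1)^beta] is
    [1 / Phi beta (S n)], and the minimiser at the point [1] is the [u] of the upper bound. As [u]
    has value [1] there, [1 - u (s z)] vanishes at the zero of [1 - s z]. The threshold
    [alpha <= 3/2] is [beta <= 1], the range where [Phi beta] is unbounded. The obstacle in the
    lower bound is that [g] is no polynomial: [q g - 1] has infinitely many coefficients, the high
    ones depend on the size of [q], and [q] is controlled only through [q = (1 + e) / g]. That the
    zeros on the circle are finitely many is also proved quantitatively, by Jensen's inequality,
    with no theory of isolated zeros. *)

Fixpoint rsum (u : nat -> R) (n : nat) : R :=
  match n with 0%nat => 0 | S m => rsum u m + u m end.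

(** Both sums run over [k < n], whereas [sum_n] includes [n]: the empty sum exists and ranges split
    without corrections. *)
Fixpoint csum (u : nat -> C) (n : nat) : C :=
  match n with 0%nat => RtoC 0 | S m => (csum u m + u m)%C end.

Lemma rsum_ext (u v : nat -> R) (n : nat) :
  (forall k, (k < n)%nat -> u k = v k) -> rsum u n = rsum v n.
Proof. induction n; simpl; intros h; auto. rewrite IHn, (h n); auto. Qed.

Lemma rsum_le (u v : nat -> R) (n : nat) :
  (forall k, (k < n)%nat -> u k <= v k) -> rsum u n <= rsum v n.
Proof.
  induction n; simpl; intros h; [lra|].
  apply Rplus_le_compat; [apply IHn; auto | apply h; lia].
Qed.

Lemma rsum_const0 (n : nat) : rsum (fun _ => 0) n = 0.
Proof. induction n; simpl; lra. Qed.

Lemma rsum_nonneg (u : nat -> R) (n : nat) :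
  (forall k, (k < n)%nat -> 0 <= u k) -> 0 <= rsum u n.
Proof. intros h. rewrite <- (rsum_const0 n). now apply rsum_le. Qed.

Lemma rsum_add (u v : nat -> R) (n : nat) :
  rsum (fun k => u k + v k) n = rsum u n + rsum v n.
Proof. induction n; simpl; lra. Qed.

Lemma rsum_scal (c : R) (u : nat -> R) (n : nat) :
  rsum (fun k => c * u k) n = c * rsum u n.
Proof. induction n; simpl; [ring|]. rewrite IHn. ring. Qed.

Lemma rsum_const (c : R) (n : nat) : rsum (fun _ => c) n = INR n * c.
Proof. induction n; [simpl; ring|]. rewrite S_INR. simpl. rewrite IHn. ring. Qed.

Lemma rsum_app (u : nat -> R) (n m : nat) :
  rsum u (n + m) = rsum u n + rsum (fun k => u (n + k)%nat) m.
Proof.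
  induction m; simpl; [rewrite Nat.add_0_r; ring|].
  rewrite Nat.add_succ_r. simpl. rewrite IHm. ring.
Qed.

Lemma rsum_mono (u : nat -> R) (n m : nat) :
  (forall k, 0 <= u k) -> (n <= m)%nat -> rsum u n <= rsum u m.
Proof.
  intros h hnm. replace m with (n + (m - n))%nat by lia. rewrite rsum_app.
  pose proof (rsum_nonneg (fun k => u (n + k)%nat) (m - n) (fun k _ => h _)). lra.
Qed.

Lemma rsum_term_le (u : nat -> R) (n k : nat) :
  (forall j, 0 <= u j) -> (k < n)%nat -> u k <= rsum u n.
Proof.
  intros h hk. apply Rle_trans with (rsum u (S k)); [|apply rsum_mono; auto; lia].
  simpl. pose proof (rsum_nonneg u k (fun j _ => h j)). lra.
Qed.

Lemma rsum_head (u : nat -> R) (n : nat) :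
  rsum u (S n) = u 0%nat + rsum (fun k => u (S k)) n.
Proof. induction n; [simpl; ring|]. change (rsum u (S (S n))) with (rsum u (S n) + u (S n)).
  rewrite IHn. simpl. ring. Qed.

Lemma rsum_rev (u : nat -> R) (n : nat) :
  rsum (fun k => u (n - S k)%nat) n = rsum u n.
Proof.
  induction n; [reflexivity|]. rewrite rsum_head. simpl.
  rewrite Nat.sub_0_r, IHn. ring.
Qed.

Lemma rsum_cauchy_schwarz (u v : nat -> R) (n : nat) :
  rsum (fun k => u k * v k) n ^ 2 <= rsum (fun k => u k ^ 2) n * rsum (fun k => v k ^ 2) n.
Proof.
  set (A := rsum (fun k => u k ^ 2) n). set (B := rsum (fun k => v k ^ 2) n).
  set (D := rsum (fun k => u k * v k) n).
  assert (h : forall x y, 0 <= x ^ 2 * A + 2 * x * y * D + y ^ 2 * B).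
  { intros x y. unfold A, B, D. rewrite <- !rsum_scal, <- !rsum_add.
    apply rsum_nonneg. intros k _.
    replace (_ + _) with ((x * u k + y * v k) ^ 2) by ring. apply pow2_ge_0. }
  assert (hB : 0 <= B) by (apply rsum_nonneg; intros; apply pow2_ge_0).
  destruct (Rle_lt_or_eq_dec 0 B hB) as [hB'|hB'].
  (* At this point the quadratic form equals [B * (A * B - D ^ 2)]. *)
  - pose proof (h B (- D)). nra.
  - rewrite <- hB' in *. rewrite Rmult_0_r.
    destruct (Req_dec D 0) as [->|hD]; [lra|]. exfalso.
    (* With [B = 0] the form is affine in [y]; this [y] gives it the value [-1]. *)
    pose proof (h 1 (- (A + 1) / (2 * D))) as hc.
    replace (2 * 1 * (- (A + 1) / (2 * D)) * D) with (- (A + 1)) in hc by (field; auto). lra.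
Qed.

Lemma csum_ext (u v : nat -> C) (n : nat) :
  (forall k, (k < n)%nat -> u k = v k) -> csum u n = csum v n.
Proof. induction n; simpl; intros h; auto. rewrite IHn, (h n); auto. Qed.

Lemma csum_zero (u : nat -> C) (n : nat) :
  (forall k, (k < n)%nat -> u k = RtoC 0) -> csum u n = RtoC 0.
Proof.
  induction n; simpl; intros h; auto. rewrite IHn, h; auto. ring.
Qed.

Lemma csum_add (u v : nat -> C) (n : nat) :
  csum (fun k => u k + v k)%C n = (csum u n + csum v n)%C.
Proof. induction n; simpl; [ring|]. rewrite IHn. ring. Qed.

Lemma csum_scal (c : C) (u : nat -> C) (n : nat) :
  csum (fun k => c * u k)%C n = (c * csum u n)%C.
Proof. induction n; simpl; [ring|]. rewrite IHn. ring. Qed.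

Lemma csum_sub (u v : nat -> C) (n : nat) :
  csum (fun k => u k - v k)%C n = (csum u n - csum v n)%C.
Proof. induction n; simpl; [ring|]. rewrite IHn. ring. Qed.

Lemma csum_const (c : C) (n : nat) : csum (fun _ => c) n = (RtoC (INR n) * c)%C.
Proof.
  induction n; [simpl; ring|]. rewrite S_INR, RtoC_plus. simpl. rewrite IHn. ring.
Qed.

Lemma csum_app (u : nat -> C) (n m : nat) :
  csum u (n + m) = (csum u n + csum (fun k => u (n + k)%nat) m)%C.
Proof.
  induction m; simpl; [rewrite Nat.add_0_r; ring|].
  rewrite Nat.add_succ_r. simpl. rewrite IHm. ring.
Qed.

Lemma csum_head (u : nat -> C) (n : nat) :
  csum u (S n) = (u 0%nat + csum (fun k => u (S k)) n)%C.
Proof. change (S n) with (1 + n)%nat. rewrite csum_app. simpl. ring. Qed.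

Lemma csum_swap (u : nat -> nat -> C) (n m : nat) :
  csum (fun i => csum (u i) m) n = csum (fun j => csum (fun i => u i j) n) m.
Proof.
  induction n; simpl.
  - symmetry. now apply csum_zero.
  - rewrite IHn, <- csum_add. reflexivity.
Qed.

Lemma csum_single (u : nat -> C) (n k : nat) :
  (k < n)%nat -> (forall j, (j < n)%nat -> j <> k -> u j = RtoC 0) -> csum u n = u k.
Proof.
  intros hk h. replace n with (k + S (n - S k))%nat by lia.
  rewrite csum_app, csum_head, Nat.add_0_r.
  rewrite !csum_zero; [ring| |]; intros; apply h; lia.
Qed.

Lemma Cmod_csum_le (u : nat -> C) (v : nat -> R) (n : nat) :
  (forall k, (k < n)%nat -> Cmod (u k) <= v k) -> Cmod (csum u n) <= rsum v n.
Proof.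
  induction n; simpl; intros h; [rewrite Cmod_0; lra|].
  eapply Rle_trans; [apply Cmod_triangle|].
  apply Rplus_le_compat; [apply IHn; auto | apply h; lia].
Qed.

Lemma sum_n_csum (u : nat -> C) (n : nat) :
  @sum_n C_AbelianMonoid u n = csum u (S n).
Proof.
  induction n.
  - rewrite sum_O. simpl. ring.
  - rewrite sum_Sn, IHn. reflexivity.
Qed.

Lemma sum_n_rsum (u : nat -> R) (n : nat) :
  @sum_n R_AbelianMonoid u n = rsum u (S n).
Proof.
  induction n.
  - rewrite sum_O. simpl. ring.
  - rewrite sum_Sn, IHn. reflexivity.
Qed.

(** * Convergence of series through partial sums *)

Definition is_cseries (u : nat -> C) (l : C) : Prop :=
  is_series (K := C_AbsRing) (V := C_NormedModule) u l.

Lemma is_cseries_iff (u : nat -> C) (l : C) :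
  is_cseries u l <->
  forall eps, 0 < eps ->
    exists N, forall n, (N <= n)%nat -> Cmod (csum u n - l) < eps.
Proof.
  unfold is_cseries, is_series.
  rewrite (filterlim_locally_ball_norm (K := C_AbsRing) (U := C_NormedModule)).
  split.
  - intros h eps heps. destruct (h (mkposreal eps heps)) as [N hN].
    exists (S N). intros [|n] hn; [lia|]. specialize (hN n ltac:(lia)).
    rewrite <- sum_n_csum. exact hN.
  - intros h eps. destruct (h eps (cond_pos eps)) as [N hN].
    exists N. intros n hn. unfold ball_norm.
    change (Cmod (sum_n u n - l)%C < eps).
    rewrite sum_n_csum. apply hN. lia.
Qed.

Lemma is_rseries_iff (u : nat -> R) (l : R) :
  is_series u l <->
  forall eps, 0 < eps ->
    exists N, forall n, (N <= n)%nat -> Rabs (rsum u n - l) < eps.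
Proof.
  unfold is_series.
  rewrite (filterlim_locally_ball_norm (K := R_AbsRing) (U := R_NormedModule)).
  split.
  - intros h eps heps. destruct (h (mkposreal eps heps)) as [N hN].
    exists (S N). intros [|n] hn; [lia|]. specialize (hN n ltac:(lia)).
    rewrite <- sum_n_rsum. exact hN.
  - intros h eps. destruct (h eps (cond_pos eps)) as [N hN].
    exists N. intros n hn. unfold ball_norm.
    change (Rabs (sum_n u n - l) < eps).
    rewrite sum_n_rsum. apply hN. lia.
Qed.

Lemma Cmod_sub_le (x y : C) : Cmod (x - y) <= Cmod x + Cmod y.
Proof. unfold Cminus. eapply Rle_trans; [apply Cmod_triangle|]. rewrite Cmod_opp. lra. Qed.

Lemma Cmod_sub_ge (x y : C) : Cmod x - Cmod y <= Cmod (x - y).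
Proof.
  pose proof (Cmod_triangle (x - y) y) as h.
  replace (x - y + y)%C with x in h by ring. lra.
Qed.

Lemma Cmod_sub_sym (x y : C) : Cmod (x - y) = Cmod (y - x).
Proof. rewrite <- Cmod_opp. f_equal. ring. Qed.

Lemma Cmod_small_eq_0 (x : C) : (forall eps, 0 < eps -> Cmod x < eps) -> x = RtoC 0.
Proof.
  intros h. apply Cmod_eq_0. pose proof (Cmod_ge_0 x).
  destruct (Rle_lt_or_eq_dec _ _ H) as [h'|h']; [|auto].
  specialize (h _ h'). lra.
Qed.

Lemma is_cseries_unique (u : nat -> C) (l l' : C) :
  is_cseries u l -> is_cseries u l' -> l = l'.
Proof.
  rewrite !is_cseries_iff. intros h h'.
  assert (hz : (l - l')%C = RtoC 0).
  { apply Cmod_small_eq_0. intros eps heps.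
    destruct (h (eps / 2) ltac:(lra)) as [N hN].
    destruct (h' (eps / 2) ltac:(lra)) as [N' hN'].
    specialize (hN (N + N')%nat ltac:(lia)). specialize (hN' (N + N')%nat ltac:(lia)).
    rewrite Cmod_sub_sym in hN.
    pose proof (Cmod_triangle (l - csum u (N + N')) (csum u (N + N') - l')) as ht.
    replace (l - csum u (N + N') + (csum u (N + N') - l'))%C with (l - l')%C in ht by ring.
    lra. }
  replace l with (l - l' + l')%C by ring. rewrite hz. ring.
Qed.

Lemma is_cseries_ext (u v : nat -> C) (l : C) :
  (forall k, u k = v k) -> is_cseries u l -> is_cseries v l.
Proof. apply is_series_ext. Qed.

Lemma is_cseries_add (u v : nat -> C) (l m : C) :
  is_cseries u l -> is_cseries v m -> is_cseries (fun k => u k + v k)%C (l + m)%C.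
Proof. exact (is_series_plus (K := C_AbsRing) (V := C_NormedModule) u v l m). Qed.

Lemma is_cseries_scal (c : C) (u : nat -> C) (l : C) :
  is_cseries u l -> is_cseries (fun k => c * u k)%C (c * l)%C.
Proof. exact (is_series_scal (K := C_AbsRing) (V := C_NormedModule) c u l). Qed.

Lemma is_cseries_finite (u : nat -> C) (n : nat) :
  (forall k, (n <= k)%nat -> u k = RtoC 0) -> is_cseries u (csum u n).
Proof.
  intros h. apply is_cseries_iff. intros eps heps. exists n. intros m hm.
  replace m with (n + (m - n))%nat by lia. rewrite csum_app.
  rewrite (csum_zero (fun k => u (n + k)%nat)) by (intros; apply h; lia).
  replace (csum u n + 0 - csum u n)%C with (RtoC 0) by ring. rewrite Cmod_0. lra.
Qed.

Lemma is_cseries_term_bounded (u : nat -> C) (l : C) :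
  is_cseries u l -> exists M, 0 < M /\ forall k, Cmod (u k) <= M.
Proof.
  rewrite is_cseries_iff. intros h. destruct (h 1 Rlt_0_1) as [N hN].
  exists (rsum (fun k => Cmod (u k)) N + 2).
  assert (h0 : 0 <= rsum (fun k => Cmod (u k)) N)
    by (apply rsum_nonneg; intros; apply Cmod_ge_0).
  split; [lra|]. intros k. destruct (Nat.lt_ge_cases k N) as [hk|hk].
  - pose proof (rsum_term_le (fun k => Cmod (u k)) N k (fun _ => Cmod_ge_0 _) hk).
    simpl in H. lra.
  - pose proof (hN k hk) as h1. pose proof (hN (S k) ltac:(lia)) as h2. simpl in h2.
    pose proof (Cmod_sub_le (csum u k + u k - l) (csum u k - l)) as h3.
    replace (csum u k + u k - l - (csum u k - l))%C with (u k) in h3 by ring. lra.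
Qed.

Lemma Cmod_le_of_csum_le (u : nat -> C) (l c : C) (M : R) (N : nat) :
  is_cseries u l -> (forall n, (N <= n)%nat -> Cmod (c - csum u n) <= M) -> Cmod (c - l) <= M.
Proof.
  rewrite is_cseries_iff. intros h hM. apply Rnot_lt_le. intros hlt.
  destruct (h (Cmod (c - l) - M) ltac:(lra)) as [N' hN'].
  specialize (hN' (N + N')%nat ltac:(lia)). specialize (hM (N + N')%nat ltac:(lia)).
  pose proof (Cmod_triangle (c - csum u (N + N')) (csum u (N + N') - l)) as ht.
  replace (c - csum u (N + N') + (csum u (N + N') - l))%C with (c - l)%C in ht by ring.
  lra.
Qed.

Lemma rsum_geom (x : R) (n : nat) : x <> 1 -> rsum (fun k => x ^ k) n = (1 - x ^ n) / (1 - x).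
Proof.
  intros hx. induction n; simpl; [field; lra|]. rewrite IHn. field. lra.
Qed.

Lemma rsum_geom_le (x : R) (n : nat) : 0 <= x < 1 -> rsum (fun k => x ^ k) n <= / (1 - x).
Proof.
  intros hx. rewrite rsum_geom by lra. unfold Rdiv.
  rewrite <- (Rmult_1_l (/ (1 - x))) at 2. apply Rmult_le_compat_r.
  - left. apply Rinv_0_lt_compat. lra.
  - pose proof (pow_le x n (proj1 hx)). lra.
Qed.

Lemma csum_geom_tail (u : nat -> C) (K x : R) (n m : nat) :
  0 <= x < 1 -> 0 <= K -> (forall k, (n <= k)%nat -> Cmod (u k) <= K * x ^ k) ->
  (n <= m)%nat -> Cmod (csum u m - csum u n) <= K * x ^ n / (1 - x).
Proof.
  intros hx hK h hnm. replace m with (n + (m - n))%nat by lia. rewrite csum_app.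
  replace (csum u n + csum (fun k => u (n + k)%nat) (m - n) - csum u n)%C
    with (csum (fun k => u (n + k)%nat) (m - n)) by ring.
  eapply Rle_trans; [apply (Cmod_csum_le _ (fun k => (K * x ^ n) * x ^ k))|].
  - intros k _. rewrite Rmult_assoc, <- pow_add. apply h. lia.
  - rewrite rsum_scal. apply Rmult_le_compat_l; [|now apply rsum_geom_le].
    apply Rmult_le_pos; auto. now apply pow_le.
Qed.

Lemma is_cseries_geom (u : nat -> C) (K x : R) :
  0 <= x < 1 -> (forall k, Cmod (u k) <= K * x ^ k) -> exists l, is_cseries u l.
Proof.
  intros hx h.
  apply (ex_series_le (K := C_AbsRing) (V := C_CompleteNormedModule) u (fun k => K * x ^ k)).
  - exact h.
  - apply (ex_series_scal (K := R_AbsRing) (V := R_NormedModule) K).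
    exists (/ (1 - x)). apply is_series_geom. rewrite Rabs_pos_eq; lra.
Qed.

Lemma is_cseries_geom_tail (u : nat -> C) (l : C) (K x : R) (n : nat) :
  0 <= x < 1 -> 0 <= K -> (forall k, (n <= k)%nat -> Cmod (u k) <= K * x ^ k) ->
  is_cseries u l -> Cmod (l - csum u n) <= K * x ^ n / (1 - x).
Proof.
  intros hx hK h hl. rewrite Cmod_sub_sym. apply (Cmod_le_of_csum_le u l _ _ n hl).
  intros m hm. rewrite Cmod_sub_sym. now apply csum_geom_tail.
Qed.

(** With [t = x / y < 1], each of the [k + 1] terms of the geometric sum up to [t ^ k] is at least
    [t ^ k]. Used to absorb the linear factor that every Cauchy product produces into a slightly
    larger ratio. *)
Lemma lin_mul_geom_le (x y : R) :
  0 <= x < y -> exists M, 0 < M /\ forall k : nat, (INR k + 1) * x ^ k <= M * y ^ k.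
Proof.
  intros hxy. set (t := x / y).
  assert (ht : 0 <= t < 1).
  { unfold t. split; [apply Rdiv_le_0_compat; lra|].
    apply (Rmult_lt_reg_r y); [lra|]. unfold Rdiv. rewrite Rmult_assoc, Rinv_l; lra. }
  exists (/ (1 - t)). split; [apply Rinv_0_lt_compat; lra|]. intros k.
  assert (h : (INR k + 1) * t ^ k <= / (1 - t)).
  { apply Rle_trans with (rsum (fun j => t ^ j) (S k)); [|now apply rsum_geom_le].
    rewrite <- S_INR, <- rsum_const. apply rsum_le. intros j hj.
    replace k with (j + (k - j))%nat by lia. rewrite pow_add.
    rewrite <- (Rmult_1_r (t ^ j)) at 2. apply Rmult_le_compat_l; [apply pow_le; lra|].
    rewrite <- (pow1 (k - j)). apply pow_incr. lra. }
  replace x with (t * y) by (unfold t; field; lra). rewrite Rpow_mult_distr, <- Rmult_assoc.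
  apply Rmult_le_compat_r; auto. apply pow_le. lra.
Qed.

Lemma quad_mul_geom_le (x y : R) :
  0 <= x < y -> exists M, 0 < M /\ forall k : nat, (INR k + 1) ^ 2 * x ^ k <= M * y ^ k.
Proof.
  intros hxy. set (z := (x + y) / 2).
  destruct (lin_mul_geom_le x z ltac:(unfold z; lra)) as [M1 [hM1 h1]].
  destruct (lin_mul_geom_le z y ltac:(unfold z; lra)) as [M2 [hM2 h2]].
  exists (M1 * M2). split; [now apply Rmult_lt_0_compat|]. intros k.
  specialize (h1 k). specialize (h2 k). pose proof (pos_INR k). nra.
Qed.

(** [r] is the growth ratio of the coefficients, so the power series converges for [|z| < 1 / r]: a
    smaller [r] means a larger disk. *)
Definition geo (r : R) (b : nat -> C) : Prop :=
  exists K, 0 < K /\ forall k, Cmod (b k) <= K * r ^ k.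

Lemma geo_weaken (r r' : R) (b : nat -> C) : 0 <= r <= r' -> geo r b -> geo r' b.
Proof.
  intros hr [K [hK h]]. exists K. split; auto. intros k. eapply Rle_trans; [apply h|].
  apply Rmult_le_compat_l; [lra|]. apply pow_incr. lra.
Qed.

(* The value is only meaningful at points where the series converges. *)
Definition psum (b : nat -> C) (z : C) : C :=
  epsilon (inhabits (RtoC 0)) (fun l => is_cseries (fun k => b k * z ^ k)%C l).

Lemma geo_term_le (r K : R) (b : nat -> C) (z : C) :
  (forall k, Cmod (b k) <= K * r ^ k) ->
  forall k, Cmod (b k * z ^ k) <= K * (r * Cmod z) ^ k.
Proof.
  intros h k. rewrite Cmod_mult, Cmod_pow, Rpow_mult_distr, <- Rmult_assoc.
  apply Rmult_le_compat_r; auto. apply pow_le, Cmod_ge_0.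
Qed.

Lemma psum_unique (b : nat -> C) (z l : C) :
  is_cseries (fun k => b k * z ^ k)%C l -> psum b z = l.
Proof.
  intros h. apply (is_cseries_unique (fun k => b k * z ^ k)%C); auto.
  unfold psum. apply epsilon_spec. now exists l.
Qed.

Lemma psum_correct (r : R) (b : nat -> C) (z : C) :
  0 <= r -> geo r b -> r * Cmod z < 1 -> is_cseries (fun k => b k * z ^ k)%C (psum b z).
Proof.
  intros hr [K [hK h]] hz. unfold psum. apply epsilon_spec.
  apply (is_cseries_geom _ K (r * Cmod z)).
  - split; auto. apply Rmult_le_pos; auto. apply Cmod_ge_0.
  - now apply geo_term_le.
Qed.

Lemma is_cseries_geo (b : nat -> C) (z l : C) :
  is_cseries (fun k => b k * z ^ k)%C l -> z <> RtoC 0 -> geo (/ Cmod z) b.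
Proof.
  intros h hz. destruct (is_cseries_term_bounded _ _ h) as [M [hM hb]].
  exists M. split; auto. intros k. specialize (hb k).
  rewrite Cmod_mult, Cmod_pow in hb. apply Cmod_gt_0 in hz.
  rewrite pow_inv. apply (Rmult_le_reg_r (Cmod z ^ k)); [now apply pow_lt|].
  rewrite Rmult_assoc, Rinv_l; [lra|]. apply pow_nonzero. lra.
Qed.

(** The Cauchy product, peeling off the first coefficient of [a]: without the subtraction [n - i],
    associativity is a plain induction. *)
Fixpoint conv (a b : nat -> C) (n : nat) : C :=
  match n with
  | 0%nat => (a 0%nat * b 0%nat)%C
  | S m => (a 0%nat * b (S m) + conv (fun k => a (S k)) b m)%C
  end.

Definition one_seq (k : nat) : C := match k with 0%nat => RtoC 1 | _ => RtoC 0 end.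

Lemma conv_ext (a a' b b' : nat -> C) (n : nat) :
  (forall k, (k <= n)%nat -> a k = a' k) -> (forall k, (k <= n)%nat -> b k = b' k) ->
  conv a b n = conv a' b' n.
Proof.
  revert a a' b b'. induction n; intros a a' b b' ha hb; simpl.
  - rewrite ha, hb; auto.
  - rewrite ha, hb by lia. f_equal. apply IHn; intros; [apply ha|apply hb]; lia.
Qed.

Lemma conv_add_l (a a' b : nat -> C) (n : nat) :
  conv (fun k => a k + a' k)%C b n = (conv a b n + conv a' b n)%C.
Proof.
  revert a a'. induction n; intros; simpl; [ring|].
  rewrite (IHn (fun k => a (S k)) (fun k => a' (S k))). ring.
Qed.

Lemma conv_scal_l (c : C) (a b : nat -> C) (n : nat) :
  conv (fun k => c * a k)%C b n = (c * conv a b n)%C.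
Proof.
  revert a. induction n; intros; simpl; [ring|]. rewrite (IHn (fun k => a (S k))). ring.
Qed.

Lemma conv_zero_l (a b : nat -> C) (n : nat) :
  (forall k, (k <= n)%nat -> a k = RtoC 0) -> conv a b n = RtoC 0.
Proof.
  revert a. induction n; intros a h; simpl; rewrite h by lia; [ring|].
  rewrite IHn; [ring|]. intros. apply h. lia.
Qed.

(** The recursion seen from the other argument; this asymmetry is all that commutativity has to
    overcome. *)
Lemma conv_last (a b : nat -> C) (n : nat) :
  conv a b (S n) = (conv a (fun k => b (S k)) n + a (S n) * b 0%nat)%C.
Proof.
  revert a. induction n; intros; [simpl; ring|].
  change (conv a b (S (S n)))
    with (a 0%nat * b (S (S n)) + conv (fun k => a (S k)) b (S n))%C.
  rewrite IHn. simpl. ring.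
Qed.

Lemma conv_comm (a b : nat -> C) (n : nat) : conv a b n = conv b a n.
Proof.
  revert a b. induction n; intros; [simpl; ring|].
  rewrite conv_last. simpl. rewrite (IHn a). ring.
Qed.

Lemma conv_assoc (a b c : nat -> C) (n : nat) :
  conv (conv a b) c n = conv a (conv b c) n.
Proof.
  revert a b c. induction n; intros; [simpl; ring|].
  simpl.
  rewrite (conv_add_l (fun k => a 0%nat * b (S k))%C (conv (fun k => a (S k)) b)).
  rewrite (conv_scal_l (a 0%nat) (fun k => b (S k))), IHn. ring.
Qed.

Lemma conv_one_l (a : nat -> C) (n : nat) : conv one_seq a n = a n.
Proof.
  destruct n; simpl; [ring|]. rewrite conv_zero_l by auto. ring.
Qed.

Lemma conv_add_r (a b b' : nat -> C) (n : nat) :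
  conv a (fun k => b k + b' k)%C n = (conv a b n + conv a b' n)%C.
Proof. rewrite conv_comm, conv_add_l, (conv_comm b), (conv_comm b'). reflexivity. Qed.

Lemma conv_one_r (a : nat -> C) (n : nat) : conv a one_seq n = a n.
Proof. rewrite conv_comm. apply conv_one_l. Qed.

Lemma conv_csum (a b : nat -> C) (n : nat) :
  conv a b n = csum (fun i => a i * b (n - i)%nat)%C (S n).
Proof.
  revert a. induction n; intros; [simpl; ring|].
  rewrite csum_head. simpl conv. rewrite IHn. reflexivity.
Qed.

Lemma Cmod_conv_le (a b : nat -> C) (f g : nat -> R) (n : nat) :
  (forall k, (k <= n)%nat -> Cmod (a k) <= f k) ->
  (forall k, (k <= n)%nat -> Cmod (b k) <= g k) ->
  Cmod (conv a b n) <= rsum (fun i => f i * g (n - i)%nat) (S n).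
Proof.
  intros ha hb. rewrite conv_csum. apply Cmod_csum_le. intros k hk.
  rewrite Cmod_mult. apply Rmult_le_compat; try apply Cmod_ge_0; [apply ha|apply hb]; lia.
Qed.

Lemma conv_pow (a b : nat -> C) (z : C) (n : nat) :
  conv (fun k => a k * z ^ k)%C (fun k => b k * z ^ k)%C n = (conv a b n * z ^ n)%C.
Proof.
  rewrite !conv_csum, Cmult_comm, <- csum_scal. apply csum_ext. intros k hk.
  replace n with (k + (n - k))%nat at 3 by lia. rewrite Cpow_add_r. ring.
Qed.

Lemma conv_geo_le (a b : nat -> C) (A B r : R) (n : nat) :
  0 <= r -> (forall k, Cmod (a k) <= A * r ^ k) -> (forall k, Cmod (b k) <= B * r ^ k) ->
  Cmod (conv a b n) <= A * B * ((INR n + 1) * r ^ n).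
Proof.
  intros hr ha hb.
  eapply Rle_trans; [apply (Cmod_conv_le a b _ _ n (fun k _ => ha k) (fun k _ => hb k))|].
  rewrite (rsum_ext _ (fun _ => A * B * r ^ n)).
  - rewrite rsum_const, S_INR. lra.
  - intros k hk. replace n with (k + (n - k))%nat at 2 by lia. rewrite pow_add. ring.
Qed.

Lemma geo_conv (a b : nat -> C) (r r' : R) :
  0 <= r < r' -> geo r a -> geo r b -> geo r' (conv a b).
Proof.
  intros hr [A [hA ha]] [B [hB hb]]. destruct (lin_mul_geom_le r r' hr) as [M [hM h]].
  exists (A * B * M). split; [repeat apply Rmult_lt_0_compat; auto|]. intros k.
  eapply Rle_trans; [apply (conv_geo_le a b A B r k); auto; lra|].
  rewrite (Rmult_assoc (A * B)). apply Rmult_le_compat_l; [|apply h].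
  left. now apply Rmult_lt_0_compat.
Qed.

(** Taking partial sums is convolution with the constant sequence [1], so this is associativity. *)
Lemma csum_conv (a b : nat -> C) (n : nat) :
  csum (conv a b) (S n) = conv a (fun k => csum b (S k)) n.
Proof.
  assert (h : forall c m, csum c (S m) = conv c (fun _ => RtoC 1) m).
  { intros c m. rewrite conv_csum. apply csum_ext. intros. ring. }
  rewrite h, conv_assoc. apply conv_ext; auto.
Qed.

Lemma is_cseries_conv (a b : nat -> C) (A B r : R) (la lb : C) :
  0 <= r < 1 -> (forall k, Cmod (a k) <= A * r ^ k) -> (forall k, Cmod (b k) <= B * r ^ k) ->
  is_cseries a la -> is_cseries b lb -> is_cseries (conv a b) (la * lb)%C.
Proof.
  intros hr ha hb hla hlb.
  assert (hA : 0 <= A) by (pose proof (ha 0%nat); pose proof (Cmod_ge_0 (a 0%nat)); simpl in *; lra).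
  assert (hB : 0 <= B) by (pose proof (hb 0%nat); pose proof (Cmod_ge_0 (b 0%nat)); simpl in *; lra).
  (* The difference is the convolution of [a] with the tails of [b], both of ratio [r]; hence the
     size [(n + 1) r^n]. *)
  assert (hd : forall n, Cmod (csum (conv a b) (S n) - csum a (S n) * lb)
      <= A * (B / (1 - r)) * ((INR n + 1) * r ^ n)).
  { intros n. rewrite csum_conv.
    replace (conv a (fun k => csum b (S k)) n - csum a (S n) * lb)%C
      with (conv a (fun k => csum b (S k) - lb)%C n).
    - apply conv_geo_le; [lra|auto|]. intros k. rewrite Cmod_sub_sym.
      eapply Rle_trans; [apply (is_cseries_geom_tail b lb B r (S k)); auto|].
      unfold Rdiv. rewrite !Rmult_assoc. apply Rmult_le_compat_l; auto.
      rewrite Rmult_comm. apply Rmult_le_compat_l.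
      + left. apply Rinv_0_lt_compat. lra.
      + simpl. pose proof (pow_le r k (proj1 hr)). nra.
    - rewrite !conv_csum, (Cmult_comm _ lb), <- csum_scal, <- csum_sub.
      apply csum_ext. intros. ring. }
  destruct (lin_mul_geom_le r ((1 + r) / 2) ltac:(lra)) as [M [hM h]].
  assert (hK : 0 <= A * (B / (1 - r)) * M).
  { apply Rmult_le_pos; [|lra]. apply Rmult_le_pos; auto. apply Rdiv_le_0_compat; lra. }
  set (K := A * (B / (1 - r)) * M) in *.
  rewrite is_cseries_iff in hla |- *. intros eps heps.
  assert (hl : 0 < Cmod lb + 1) by (pose proof (Cmod_ge_0 lb); lra).
  destruct (hla (eps / 2 / (Cmod lb + 1))) as [N hN]; [apply Rdiv_lt_0_compat; lra|].
  destruct (pow_lt_1_zero ((1 + r) / 2) ltac:(rewrite Rabs_pos_eq; lra) (eps / 2 / (K + 1)))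
    as [N' hN']; [apply Rdiv_lt_0_compat; lra|].
  exists (S (N + N')). intros [|n] hn; [lia|].
  specialize (hN (S n) ltac:(lia)). specialize (hN' n ltac:(lia)).
  rewrite Rabs_pos_eq in hN' by (apply pow_le; lra).
  replace (csum (conv a b) (S n) - la * lb)%C with
    ((csum (conv a b) (S n) - csum a (S n) * lb) + (csum a (S n) - la) * lb)%C by ring.
  eapply Rle_lt_trans; [apply Cmod_triangle|]. rewrite Cmod_mult.
  assert (h1 : Cmod (csum a (S n) - la) * Cmod lb < eps / 2).
  { apply Rle_lt_trans with (Cmod (csum a (S n) - la) * (Cmod lb + 1)).
    - apply Rmult_le_compat_l; [apply Cmod_ge_0|lra].
    - apply (Rmult_lt_compat_r (Cmod lb + 1)) in hN; auto.
      replace (eps / 2 / (Cmod lb + 1) * (Cmod lb + 1)) with (eps / 2) in hN by (field; lra).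
      exact hN. }
  assert (h2 : Cmod (csum (conv a b) (S n) - csum a (S n) * lb) <= eps / 2).
  { eapply Rle_trans; [apply hd|].
    apply Rle_trans with (K * ((1 + r) / 2) ^ n).
    - unfold K. rewrite (Rmult_assoc _ M). apply Rmult_le_compat_l; [|apply h].
      apply Rmult_le_pos; auto. apply Rdiv_le_0_compat; lra.
    - apply Rle_trans with ((K + 1) * (eps / 2 / (K + 1))).
      + apply Rmult_le_compat; try lra. apply pow_le. lra.
      + right. field. lra. }
  lra.
Qed.

Lemma psum_conv (a b : nat -> C) (r : R) (z : C) :
  0 <= r -> geo r a -> geo r b -> r * Cmod z < 1 ->
  is_cseries (fun k => conv a b k * z ^ k)%C (psum a z * psum b z)%C.
Proof.
  intros hr ha hb hz.
  pose proof (psum_correct r a z hr ha hz) as sa. pose proof (psum_correct r b z hr hb hz) as sb.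
  destruct ha as [A [hA ha]], hb as [B [hB hb]].
  apply (is_cseries_ext (conv (fun k => a k * z ^ k)%C (fun k => b k * z ^ k)%C)).
  - intros. apply conv_pow.
  - apply (is_cseries_conv _ _ A B (r * Cmod z)); auto.
    + split; auto. apply Rmult_le_pos; auto. apply Cmod_ge_0.
    + now apply geo_term_le.
    + now apply geo_term_le.
Qed.

Lemma is_cseries_one_seq (z : C) : is_cseries (fun k => one_seq k * z ^ k)%C (RtoC 1).
Proof.
  assert (h := is_cseries_finite (fun k => one_seq k * z ^ k)%C 1).
  replace (csum (fun k => one_seq k * z ^ k)%C 1) with (RtoC 1) in h by (simpl; ring).
  apply h. intros [|k] hk; [lia|]. simpl. ring.
Qed.

Lemma psum_at_0 (c : nat -> C) : psum c (RtoC 0) = c 0%nat.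
Proof.
  apply psum_unique. replace (c 0%nat) with (csum (fun k => c k * RtoC 0 ^ k)%C 1) by (simpl; ring).
  apply is_cseries_finite. intros [|k] hk; [lia|]. simpl. ring.
Qed.

Lemma Rinv_gt_1 (x : R) : 0 < x < 1 -> 1 < / x.
Proof. intros hx. rewrite <- Rinv_1. apply Rinv_lt_contravar; lra. Qed.

Lemma Rinv_lt_1 (x : R) : 1 < x -> 0 < / x < 1.
Proof.
  intros hx. split; [apply Rinv_0_lt_compat; lra|]. rewrite <- Rinv_1.
  apply Rinv_lt_contravar; lra.
Qed.

(** * First-order expansions *)

(* Locally around [w], [F] has first-order expansions whose remainder is
   uniformly quadratic. This consequence of analyticity is stable under products
   and inverses, and is all that the Cauchy estimate needs. *)
Definition lq (F : C -> C) (w : C) : Prop :=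
  exists d M, 0 < d /\ 0 < M /\ forall z, Cmod (z - w) < d ->
    Cmod (F z) <= M /\ exists l, Cmod l <= M /\
      forall h, Cmod h < d -> Cmod (F (z + h) - F z - h * l)%C <= M * Cmod h ^ 2.

(** Lets two functions share one radius and one bound: the radius can be taken below any [e], and
    every larger [M'] serves. *)
Lemma lq_shrink (F : C -> C) (w : C) (e : R) : 0 < e -> lq F w ->
  exists d M, 0 < d <= e /\ 1 <= M /\ forall M', M <= M' ->
   forall z, Cmod (z - w) < d ->
    Cmod (F z) <= M' /\ exists l, Cmod l <= M' /\
      forall h, Cmod h < d -> Cmod (F (z + h) - F z - h * l)%C <= M' * Cmod h ^ 2.
Proof.
  intros he [d [M [hd [hM h]]]]. exists (Rmin d e), (M + 1).
  assert (h1 := Rmin_l d e). assert (h2 := Rmin_r d e).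
  split; [split; [now apply Rmin_glb_lt | lra]|]. split; [lra|].
  intros M' hM' z hz. destruct (h z ltac:(lra)) as [hF [l [hl hq]]].
  split; [lra|]. exists l. split; [lra|]. intros k hk.
  eapply Rle_trans; [apply hq; lra|]. apply Rmult_le_compat_r; [apply pow2_ge_0|lra].
Qed.

Lemma lq_const (c w : C) : lq (fun _ => c) w.
Proof.
  exists 1, (Cmod c + 1). pose proof (Cmod_ge_0 c). repeat split; try lra.
  exists (RtoC 0). rewrite Cmod_0. split; [lra|]. intros h _.
  replace (c - c - h * 0)%C with (RtoC 0) by ring. rewrite Cmod_0.
  apply Rmult_le_pos; [lra|apply pow2_ge_0].
Qed.

Lemma lq_id (w : C) : lq (fun z => z) w.
Proof.
  exists 1, (Cmod w + 1). pose proof (Cmod_ge_0 w). split; [lra|]. split; [lra|].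
  intros z hz. split.
  - pose proof (Cmod_sub_ge z w). lra.
  - exists (RtoC 1). rewrite Cmod_1. split; [lra|]. intros h _.
    replace (z + h - z - h * 1)%C with (RtoC 0) by ring. rewrite Cmod_0.
    apply Rmult_le_pos; [lra|apply pow2_ge_0].
Qed.

Lemma quad_incr_le (F : C -> C) (z l h : C) (M : R) : Cmod h <= 1 -> 0 <= M ->
  Cmod l <= M -> Cmod (F (z + h) - F z - h * l)%C <= M * Cmod h ^ 2 ->
  Cmod (F (z + h) - F z)%C <= 2 * M * Cmod h.
Proof.
  intros hh hM hl hq. replace (F (z + h) - F z)%C
    with ((F (z + h) - F z - h * l) + h * l)%C by ring.
  eapply Rle_trans; [apply Cmod_triangle|]. rewrite Cmod_mult.
  pose proof (Cmod_ge_0 h).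
  assert (Cmod h * Cmod l <= Cmod h * M) by (apply Rmult_le_compat_l; auto).
  assert (M * Cmod h ^ 2 <= M * Cmod h) by (apply Rmult_le_compat_l; nra). lra.
Qed.

Lemma lq_mul (F G : C -> C) (w : C) : lq F w -> lq G w -> lq (fun z => F z * G z)%C w.
Proof.
  intros hF hG.
  destruct (lq_shrink F w 1 ltac:(lra) hF) as [d [M1 [hd [hM1 h1]]]].
  destruct (lq_shrink G w d ltac:(lra) hG) as [e [M2 [he [hM2 h2]]]].
  (* The three error terms below contribute [3 * M ^ 2], [2 * M ^ 2] and [M ^ 2]. *)
  set (M := M1 + M2). exists e, (6 * M ^ 2). unfold M.
  split; [lra|]. split; [nra|]. fold M. intros z hz.
  destruct (h1 M ltac:(unfold M; lra) z ltac:(lra)) as [hFz [l [hl hlq]]].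
  destruct (h2 M ltac:(unfold M; lra) z ltac:(lra)) as [hGz [m [hm hmq]]].
  assert (hM : 2 <= M) by (unfold M; lra).
  assert (hprod : forall x y, Cmod x <= M -> Cmod y <= M -> Cmod (x * y) <= M ^ 2).
  { intros x y hx hy. rewrite Cmod_mult. simpl. rewrite Rmult_1_r.
    apply Rmult_le_compat; auto; apply Cmod_ge_0. }
  split; [eapply Rle_trans; [now apply hprod|nra]|].
  exists (l * G z + F z * m)%C. split.
  - eapply Rle_trans; [apply Cmod_triangle|].
    pose proof (hprod _ _ hl hGz). pose proof (hprod _ _ hFz hm). nra.
  - intros h hh. specialize (hlq h ltac:(lra)). specialize (hmq h ltac:(lra)).
    pose proof (quad_incr_le G z m h M ltac:(lra) ltac:(lra) hm hmq) as hG2.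
    set (e1 := (F (z + h) - F z - h * l)%C) in *.
    set (e2 := (G (z + h) - G z - h * m)%C) in *.
    replace (F (z + h) * G (z + h) - F z * G z - h * (l * G z + F z * m))%C with
      (e1 * G (z + h) + ((F z + h * l) * e2 + h * h * (l * m)))%C by (unfold e1, e2; ring).
    assert (hGp : Cmod (G (z + h)%C) <= 3 * M).
    { replace (G (z + h)%C) with (G (z + h) - G z + G z)%C by ring.
      eapply Rle_trans; [apply Cmod_triangle|]. nra. }
    assert (hFp : Cmod (F z + h * l) <= 2 * M).
    { eapply Rle_trans; [apply Cmod_triangle|]. rewrite Cmod_mult.
      assert (Cmod h * Cmod l <= 1 * M) by (apply Rmult_le_compat; auto; try apply Cmod_ge_0; lra).
      lra. }
    eapply Rle_trans; [apply Cmod_triangle|].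
    assert (k1 : Cmod (e1 * G (z + h))%C <= (M * Cmod h ^ 2) * (3 * M)).
    { rewrite Cmod_mult. apply Rmult_le_compat; auto; apply Cmod_ge_0. }
    assert (k2 : Cmod ((F z + h * l) * e2 + h * h * (l * m))
                 <= (2 * M) * (M * Cmod h ^ 2) + Cmod h ^ 2 * M ^ 2).
    { eapply Rle_trans; [apply Cmod_triangle|]. apply Rplus_le_compat.
      - rewrite Cmod_mult. apply Rmult_le_compat; auto; apply Cmod_ge_0.
      - rewrite Cmod_mult, (Cmod_mult h h).
        replace (Cmod h ^ 2) with (Cmod h * Cmod h) by ring.
        apply Rmult_le_compat_l; [nra|]. now apply hprod. }
    lra.
Qed.

Lemma lq_pow (F : C -> C) (w : C) (k : nat) : lq F w -> lq (fun z => F z ^ k)%C w.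
Proof.
  intros hF. induction k; simpl; [apply lq_const|].
  apply (lq_mul F (fun z => F z ^ k)%C); auto.
Qed.

Lemma lq_lipschitz (F : C -> C) (w : C) : lq F w ->
  exists d M, 0 < d /\ 0 < M /\ forall z, Cmod (z - w) < d -> Cmod (F z - F w) <= M * Cmod (z - w).
Proof.
  intros hF. destruct (lq_shrink F w 1 ltac:(lra) hF) as [d [M [hd [hM h]]]].
  exists d, (2 * M). split; [lra|]. split; [lra|]. intros z hz.
  destruct (h M ltac:(lra) w) as [_ [l [hl hq]]].
  { replace (w - w)%C with (RtoC 0) by ring. rewrite Cmod_0. lra. }
  specialize (hq (z - w)%C hz). replace z with (w + (z - w))%C at 1 by ring.
  apply (quad_incr_le F w l); auto; lra.
Qed.

Lemma lq_inv (F : C -> C) (w : C) : F w <> RtoC 0 -> lq F w -> lq (fun z => / F z)%C w.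
Proof.
  intros hw hF. apply Cmod_gt_0 in hw.
  destruct (lq_lipschitz F w hF) as [d0 [L [hd0 [hL hlip]]]].
  (* Near [w] the modulus of [F] stays above [a], so all inverses are bounded by [/ a]. *)
  set (a := Cmod (F w) / 2).
  assert (ha : 0 < a) by (unfold a; lra).
  assert (hnear : forall z, Cmod (z - w) < Rmin d0 (a / L) -> a <= Cmod (F z)).
  { intros z hz. assert (h1 := Rmin_l d0 (a / L)). assert (h2 := Rmin_r d0 (a / L)).
    specialize (hlip z ltac:(lra)). rewrite Cmod_sub_sym in hlip.
    pose proof (Cmod_sub_ge (F w) (F z)).
    assert (L * Cmod (z - w) <= L * (a / L)) by (apply Rmult_le_compat_l; lra).
    replace (L * (a / L)) with a in * by (field; lra). unfold a in *. lra. }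
  assert (hd1 : 0 < Rmin d0 (a / L)) by (apply Rmin_glb_lt; auto; now apply Rdiv_lt_0_compat).
  set (d1 := Rmin d0 (a / L)) in *.
  (* Half of [d1], so that [z] and [z + k] both stay in the region where [F] is bounded below. *)
  destruct (lq_shrink F w (Rmin 1 (d1 / 2)) ltac:(apply Rmin_glb_lt; lra) hF)
    as [d [M [hd [hM h]]]].
  assert (hm1 := Rmin_l 1 (d1 / 2)). assert (hm2 := Rmin_r 1 (d1 / 2)).
  assert (p1 : 0 < / a) by now apply Rinv_0_lt_compat.
  assert (p2 : 0 < / a ^ 2) by (apply Rinv_0_lt_compat; now apply pow_lt).
  assert (p3 : 0 < / a ^ 3) by (apply Rinv_0_lt_compat; now apply pow_lt).
  assert (q2 : 0 < M * / a ^ 2) by (apply Rmult_lt_0_compat; lra).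
  assert (q3 : 0 < 3 * M ^ 2 * / a ^ 3)
    by (apply Rmult_lt_0_compat; auto; pose proof (pow_lt M 2 ltac:(lra)); lra).
  exists d, (3 * M ^ 2 * / a ^ 3 + / a + M * / a ^ 2).
  split; [lra|]. split; [lra|]. intros z hz.
  destruct (h M ltac:(lra) z hz) as [hFz [l [hl hq]]].
  assert (hza : a <= Cmod (F z)) by (apply hnear; lra).
  assert (nz : F z <> RtoC 0) by (apply Cmod_gt_0; lra).
  assert (hinv : / Cmod (F z) <= / a) by (apply Rinv_le_contravar; lra).
  split; [rewrite Cmod_inv by auto; lra|].
  exists (- (l / (F z * F z)))%C. split.
  - rewrite Cmod_opp, Cmod_div, Cmod_mult by now apply Cmult_neq_0.
    apply Rle_trans with (M * / a ^ 2); [|lra]. apply Rmult_le_compat; auto.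
    + apply Cmod_ge_0.
    + left. apply Rinv_0_lt_compat. nra.
    + apply Rinv_le_contravar; nra.
  - intros k hk. specialize (hq k hk). pose proof (Cmod_ge_0 k) as hk0.
    pose proof (quad_incr_le F z l k M ltac:(lra) ltac:(lra) hl hq) as hF2.
    assert (hza2 : a <= Cmod (F (z + k)%C)).
    { apply hnear. replace (z + k - w)%C with ((z - w) + k)%C by ring.
      eapply Rle_lt_trans; [apply Cmod_triangle|]. lra. }
    assert (nz2 : F (z + k)%C <> RtoC 0) by (apply Cmod_gt_0; lra).
    set (e := (F (z + k) - F z - k * l)%C) in *.
    (* Over the common denominator the first-order terms cancel: what is left is the error [e] and a
       product of two increments, each quadratic in [k]. *)
    replace (/ F (z + k) - / F z - k * - (l / (F z * F z)))%C with
      ((- (e * F z) + k * l * (F (z + k) - F z)) / (F z * F z * F (z + k)))%C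
      by (unfold e; field; auto).
    rewrite Cmod_div by (repeat apply Cmult_neq_0; auto). rewrite !Cmod_mult.
    apply Rle_trans with ((3 * M ^ 2 * Cmod k ^ 2) * / a ^ 3); [|nra].
    apply Rmult_le_compat.
    + apply Cmod_ge_0.
    + left. apply Rinv_0_lt_compat. repeat apply Rmult_lt_0_compat; lra.
    + eapply Rle_trans; [apply Cmod_triangle|]. rewrite Cmod_opp, !Cmod_mult.
      assert (Cmod e * Cmod (F z) <= (M * Cmod k ^ 2) * M)
        by (apply Rmult_le_compat; auto; apply Cmod_ge_0).
      assert (Cmod k * Cmod l * Cmod (F (z + k) - F z)%C <= (Cmod k * M) * (2 * M * Cmod k)).
      { apply Rmult_le_compat; auto; try apply Cmod_ge_0.
        - apply Rmult_le_pos; apply Cmod_ge_0.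
        - apply Rmult_le_compat_l; auto. }
      nra.
    + apply Rinv_le_contravar; [now apply pow_lt|]. simpl. rewrite Rmult_1_r, <- Rmult_assoc.
      repeat apply Rmult_le_compat; try lra; nra.
Qed.

(** The bound is [k^2 |h|^2 s^(k-2)], multiplied by [s ^ 2] so that no negative exponent appears for
    [k < 2]. Induction: the new remainder is [u + h] times the old one, plus [h^2] times the
    derivative of [u^k]. *)
Lemma Cmod_pow_remainder_le (u h : C) (s : R) (k : nat) :
  Cmod u <= s -> Cmod (u + h) <= s ->
  Cmod ((u + h) ^ k - u ^ k - h * (RtoC (INR k) * u ^ pred k)) * s ^ 2
    <= INR k ^ 2 * Cmod h ^ 2 * s ^ k.
Proof.
  intros hu huh. pose proof (Cmod_ge_0 u) as hu0.
  induction k as [|k IH].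
  - simpl. replace (1 - 1 - h * (0 * 1))%C with (RtoC 0) by ring. rewrite Cmod_0. lra.
  - replace ((u + h) ^ S k - u ^ S k - h * (RtoC (INR (S k)) * u ^ pred (S k)))%C with
      ((u + h) * ((u + h) ^ k - u ^ k - h * (RtoC (INR k) * u ^ pred k))
       + h * h * (RtoC (INR k) * u ^ pred k))%C.
    + assert (hs : 0 <= s) by lra.
      assert (hd : Cmod (RtoC (INR k) * u ^ pred k) * s ^ 2 <= INR k * s ^ S k).
      { destruct k as [|k]; [simpl INR; rewrite Cmult_0_l, Cmod_0; lra|].
        rewrite Cmod_mult, Cmod_R, Cmod_pow, Rabs_pos_eq by apply pos_INR.
        rewrite Rmult_assoc. apply Rmult_le_compat_l; [apply pos_INR|]. simpl pred.
        replace (s ^ S (S k)) with (s ^ k * s ^ 2) by (simpl; ring).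
        apply Rmult_le_compat_r; [apply pow2_ge_0|]. apply pow_incr. auto. }
      set (X := Cmod ((u + h) ^ k - u ^ k - h * (RtoC (INR k) * u ^ pred k))) in *.
      set (D := Cmod (RtoC (INR k) * u ^ pred k)) in *.
      apply Rle_trans with ((s * X + Cmod h ^ 2 * D) * s ^ 2).
      * apply Rmult_le_compat_r; [apply pow2_ge_0|].
        eapply Rle_trans; [apply Cmod_triangle|]. rewrite !(Cmod_mult _ (_ - _)), !(Cmod_mult (h * h)), Cmod_mult.
        fold X D. apply Rplus_le_compat; [|right; ring].
        apply Rmult_le_compat_r; auto. apply Cmod_ge_0.
      * rewrite S_INR. assert (0 <= s ^ k) by now apply pow_le.
        assert (0 <= Cmod h ^ 2) by apply pow2_ge_0. pose proof (pos_INR k).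
        apply Rle_trans with (s * (INR k ^ 2 * Cmod h ^ 2 * s ^ k) + Cmod h ^ 2 * (INR k * s ^ S k)).
        -- assert (s * (X * s ^ 2) <= s * (INR k ^ 2 * Cmod h ^ 2 * s ^ k)) by (apply Rmult_le_compat_l; auto).
           assert (Cmod h ^ 2 * (D * s ^ 2) <= Cmod h ^ 2 * (INR k * s ^ S k)) by (apply Rmult_le_compat_l; auto).
           lra.
        -- simpl (s ^ S k). replace (_ + _) with ((INR k ^ 2 + INR k) * (Cmod h ^ 2 * (s * s ^ k))) by ring.
           rewrite (Rmult_assoc ((INR k + 1) ^ 2)). apply Rmult_le_compat_r; [|nra].
           apply Rmult_le_pos; auto. now apply Rmult_le_pos.
    + rewrite S_INR, RtoC_plus. destruct k; simpl; ring.
Qed.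

Lemma lq_power_series (b : nat -> C) (F : C -> C) (c w : C) (rho : R) :
  (forall z, Cmod (z - c) < rho -> is_cseries (fun k => b k * (z - c) ^ k)%C (F z)) ->
  Cmod (w - c) < rho -> lq F w.
Proof.
  intros hF hw. set (u := Cmod (w - c)) in *. pose proof (Cmod_ge_0 (w - c)) as hu. fold u in hu.
  (* [s] and [t] cut the interval from [u] to [rho] into thirds: coefficients are bounded at radius
     [t] and used at radius [s], which leaves the ratio [s / t < 1] to absorb powers of [k]. *)
  set (s := (2 * u + rho) / 3). set (t := (u + 2 * rho) / 3).
  assert (hst : 0 < s /\ u < s < t /\ t < rho) by (unfold s, t; lra).
  assert (hgeo : geo (/ t) b).
  { replace t with (Cmod t) by (rewrite Cmod_R, Rabs_pos_eq; lra).
    apply (is_cseries_geo b t (F (c + t)%C)).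
    - apply (is_cseries_ext (fun k => b k * (c + t - c) ^ k)%C).
      + intros k. f_equal. f_equal. ring.
      + apply hF. replace (c + t - c)%C with (RtoC t) by ring.
        rewrite Cmod_R, Rabs_pos_eq; lra.
    - intros e. apply RtoC_inj in e. lra. }
  destruct hgeo as [K [hK hb]].
  set (x := s / t).
  assert (hx : 0 < x < 1).
  { unfold x. split; [apply Rdiv_lt_0_compat; lra|]. apply (Rmult_lt_reg_r t); [lra|].
    unfold Rdiv. rewrite Rmult_assoc, Rinv_l; lra. }
  set (v := (x + 1) / 2). assert (hv : x < v < 1) by (unfold v; lra).
  destruct (quad_mul_geom_le x v ltac:(lra)) as [M [hM g]].
  assert (hk : forall k c, 0 <= c <= (INR k + 1) ^ 2 ->
    c * (Cmod (b k) * s ^ k) <= K * M * v ^ k).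
  { intros k c0 hc. assert (hbk : Cmod (b k) * s ^ k <= K * x ^ k).
    { unfold x, Rdiv. rewrite Rpow_mult_distr, (Rmult_comm (s ^ k)), <- Rmult_assoc.
      apply Rmult_le_compat_r; auto. apply pow_le. lra. }
    apply Rle_trans with ((INR k + 1) ^ 2 * (K * x ^ k)).
    - apply Rmult_le_compat; try lra. apply Rmult_le_pos; [apply Cmod_ge_0|apply pow_le; lra].
    - specialize (g k). nra. }
  (* [B c] bounds the sum of a series whose terms times [c] are at most [K * M * v ^ k]. It is used
     with [c = 1], [s], [s ^ 2] for the value, the derivative and the remainder. *)
  set (B := fun c => K * M * / c * / (1 - v)).
  assert (hB : forall c, 0 < c -> 0 < B c).
  { intros c0 hc. unfold B. repeat apply Rmult_lt_0_compat; auto; apply Rinv_0_lt_compat; lra. }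
  assert (hsum : forall g0 c A l, 0 < c -> 0 <= A ->
    (forall k, Cmod (g0 k) * c <= A * (K * M * v ^ k)) -> is_cseries g0 l -> Cmod l <= A * B c).
  { intros g0 c0 A l hc hA hg hl.
    assert (hg' : forall k, (0 <= k)%nat -> Cmod (g0 k) <= A * (K * M * / c0) * v ^ k).
    { intros k _. apply (Rmult_le_reg_r c0); auto. eapply Rle_trans; [apply hg|].
      right. field. lra. }
    assert (hKM : 0 <= A * (K * M * / c0)).
    { apply Rmult_le_pos; auto. left. repeat apply Rmult_lt_0_compat; auto.
      now apply Rinv_0_lt_compat. }
    pose proof (is_cseries_geom_tail g0 l _ v 0 ltac:(lra) hKM hg' hl) as h. simpl in h.
    replace (l - 0)%C with l in h by ring. eapply Rle_trans; [apply h|]. unfold B.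
    right. field. lra. }
  assert (h1 := hB 1 ltac:(lra)). assert (h2 := hB s ltac:(lra)).
  assert (hs2 : 0 < s ^ 2) by (apply pow_lt; lra). assert (h3 := hB (s ^ 2) hs2).
  exists ((s - u) / 2), (B 1 + B s + B (s ^ 2)). split; [lra|]. split; [lra|]. intros z hz.
  assert (hzs : Cmod (z - c) <= s).
  { replace (z - c)%C with ((z - w) + (w - c))%C by ring.
    eapply Rle_trans; [apply Cmod_triangle|]. fold u. lra. }
  assert (hpow : forall k, Cmod ((z - c) ^ k) <= s ^ k).
  { intros k. rewrite Cmod_pow. apply pow_incr. split; auto. apply Cmod_ge_0. }
  split.
  - apply Rle_trans with (1 * B 1); [|lra].
    apply (hsum (fun k => b k * (z - c) ^ k)%C); try lra; [|apply hF; lra].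
    intros k. rewrite Cmod_mult.
    apply Rle_trans with (1 * (Cmod (b k) * s ^ k)).
    + rewrite Rmult_comm. apply Rmult_le_compat_l; [lra|].
      apply Rmult_le_compat_l; [apply Cmod_ge_0|auto].
    + rewrite (Rmult_1_l (K * M * v ^ k)). apply hk. pose proof (pos_INR k). nra.
  - set (g1 := fun k => (b k * (RtoC (INR k) * (z - c) ^ pred k))%C).
    assert (hg1 : forall k, Cmod (g1 k) * s <= 1 * (K * M * v ^ k)).
    { intros k. rewrite Rmult_1_l. eapply Rle_trans; [|apply (hk k (INR k))].
      - unfold g1. destruct k as [|k].
        + simpl INR. rewrite Cmult_0_l, Cmult_0_r, Cmod_0. lra.
        + rewrite !Cmod_mult, Cmod_R, Rabs_pos_eq by apply pos_INR. simpl pred.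
          replace (_ * s) with (INR (S k) * (Cmod (b (S k)) * (s * Cmod ((z - c) ^ k)))) by ring.
          apply Rmult_le_compat_l; [apply pos_INR|]. apply Rmult_le_compat_l; [apply Cmod_ge_0|].
          apply Rmult_le_compat_l; [lra|auto].
      - pose proof (pos_INR k). nra. }
    destruct (is_cseries_geom g1 (K * M * / s) v ltac:(lra)) as [l hl].
    { intros k. apply (Rmult_le_reg_r s); [lra|]. eapply Rle_trans; [apply hg1|].
      right. field. lra. }
    exists l. split.
    + apply Rle_trans with (1 * B s); [|lra]. apply (hsum g1); auto; lra.
    + intros h hh. apply Rle_trans with (Cmod h ^ 2 * B (s ^ 2)).
      2:{ rewrite Rmult_comm. apply Rmult_le_compat_r; [apply pow2_ge_0|lra]. }
      assert (hzh : Cmod (z - c + h) <= s).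
      { replace (z - c + h)%C with ((z - w) + (h + (w - c)))%C by ring.
        eapply Rle_trans; [apply Cmod_triangle|].
        eapply Rle_trans; [apply Rplus_le_compat_l, Cmod_triangle|]. fold u. lra. }
      apply (hsum (fun k => b k * ((z - c + h) ^ k - (z - c) ^ k - h * (RtoC (INR k) * (z - c) ^ pred k)))%C).
      * exact hs2.
      * apply pow2_ge_0.
      * intros k. rewrite Cmod_mult.
        pose proof (Cmod_pow_remainder_le (z - c)%C h s k hzs hzh) as hr.
        apply Rle_trans with (Cmod h ^ 2 * (INR k ^ 2 * (Cmod (b k) * s ^ k))).
        -- apply Rle_trans with (Cmod (b k) * (INR k ^ 2 * Cmod h ^ 2 * s ^ k)); [|right; ring].
           rewrite Rmult_assoc. apply Rmult_le_compat_l; [apply Cmod_ge_0|exact hr].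
        -- apply Rmult_le_compat_l; [apply pow2_ge_0|]. apply hk. pose proof (pos_INR k). nra.
      * apply (is_cseries_ext (fun k => (b k * (z + h - c) ^ k + (- (1)) * (b k * (z - c) ^ k)) + (- h) * g1 k)%C).
        -- intros k. unfold g1. replace (z + h - c)%C with (z - c + h)%C by ring. ring.
        -- replace (F (z + h) - F z - h * l)%C with ((F (z + h) + (- (1)) * F z) + (- h) * l)%C by ring.
           apply is_cseries_add; [|now apply is_cseries_scal].
           apply is_cseries_add; [|apply is_cseries_scal]; apply hF; [|lra].
           replace (z + h - c)%C with (z - c + h)%C by ring. lra.
Qed.

(** Compactness in gauge form: if every centre has some admissible radius, then every point lies
    close to a centre whose radius exceeds a uniform [d]. The case [r0 = r1] is a circle, and
    [r0 = 0] a disk. *)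
Lemma compact_annulus (r0 r1 : R) (Q : C -> R -> Prop) :
  (forall w, r0 <= Cmod w <= r1 -> exists d, 0 < d /\ Q w d) ->
  exists d, 0 < d /\ forall z, r0 <= Cmod z <= r1 ->
    exists w e, d <= e /\ Cmod (z - w) < 2 * e /\ Q w e.
Proof.
  intros hQ.
  (* [compactness_value_2d] works on a square, so centres off the annulus also need a radius; theirs
     is too small to reach the annulus. *)
  assert (hdelta : forall w, exists d : posreal,
    (r0 <= Cmod w <= r1 -> Q w d) /\
    (~ (r0 <= Cmod w <= r1) -> forall z, r0 <= Cmod z <= r1 -> 2 * d <= Cmod (z - w))).
  { intros w. destruct (classic (r0 <= Cmod w <= r1)) as [h|h].
    - destruct (hQ w h) as [d [hd hq]]. exists (mkposreal d hd). tauto.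
    - destruct (Rlt_dec (Cmod w) r0) as [h0|h0].
      + assert (hp : 0 < (r0 - Cmod w) / 2) by lra. exists (mkposreal _ hp).
        split; [tauto|]. intros _ z hz. simpl. pose proof (Cmod_sub_ge z w). lra.
      + assert (hp : 0 < (Cmod w - r1) / 2) by (apply Rnot_lt_le in h0; lra).
        exists (mkposreal _ hp). split; [tauto|]. intros _ z hz. simpl.
        rewrite Cmod_sub_sym. pose proof (Cmod_sub_ge w z). lra. }
  set (delta := fun u v => proj1_sig (constructive_indefinite_description _ (hdelta (u, v)))).
  destruct (compactness_value_2d (- r1) r1 (- r1) r1 delta) as [d hd].
  exists d. split; [apply cond_pos|]. intros z hz.
  pose proof (Rmax_Cmod z) as hm.
  pose proof (Rmax_l (Rabs (fst z)) (Rabs (snd z))) as hml.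
  pose proof (Rmax_r (Rabs (fst z)) (Rabs (snd z))) as hmr.
  assert (hx : - r1 <= fst z <= r1) by (apply Rabs_le_between; lra).
  assert (hy : - r1 <= snd z <= r1) by (apply Rabs_le_between; lra).
  (* [compactness_value_2d] gives its centre under a double negation. *)
  destruct (NNPP _ (hd (fst z) (snd z) hx hy)) as [u [v [_ [_ [hu [hv hdl]]]]]].
  set (e := delta u v) in *.
  destruct (proj2_sig (constructive_indefinite_description _ (hdelta (u, v)))) as [hin hout].
  change (proj1_sig (constructive_indefinite_description _ (hdelta (u, v)))) with e in hin, hout.
  (* The factor [2] covers the [sqrt 2] between the maximum norm and [Cmod]. *)
  assert (hdist : Cmod (z - (u, v)) < 2 * e).
  { eapply Rle_lt_trans; [apply Cmod_2Rmax|]. simpl.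
    change (fst z + - u) with (fst z - u). change (snd z + - v) with (snd z - v).
    assert (hmax : Rmax (Rabs (fst z - u)) (Rabs (snd z - v)) < e) by now apply Rmax_lub_lt.
    assert (hs : sqrt 2 <= 2).
    { rewrite <- (sqrt_square 2) at 2 by lra. apply sqrt_le_1; lra. }
    pose proof (Rmax_l (Rabs (fst z - u)) (Rabs (snd z - v))).
    pose proof (Rabs_pos (fst z - u)).  nra. }
  exists (u, v), e. split; [lra|]. split; auto.
  apply hin. apply NNPP. intros hn. specialize (hout hn z hz). lra.
Qed.

Lemma lq_uniform (F : C -> C) (r0 r1 : R) :
  (forall w, r0 <= Cmod w <= r1 -> lq F w) ->
  exists d M, 0 < d /\ 0 < M /\ forall z, r0 <= Cmod z <= r1 ->
    Cmod (F z) <= M /\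
    exists l, forall h, Cmod h < d -> Cmod (F (z + h) - F z - h * l)%C <= M * Cmod h ^ 2.
Proof.
  intros hF.
  (* Compactness yields a single number, so [d] serves as the radius and [/ d] as the bound. *)
  destruct (compact_annulus r0 r1 (fun w d => forall z, Cmod (z - w) < 2 * d ->
     Cmod (F z) <= / d /\
     exists l, forall h, Cmod h < d -> Cmod (F (z + h) - F z - h * l)%C <= / d * Cmod h ^ 2))
    as [d [hd h]].
  - intros w hw. destruct (hF w hw) as [d [M [hd [hM h]]]].
    assert (hp : 0 < / M) by now apply Rinv_0_lt_compat.
    exists (Rmin (d / 2) (/ M)). split; [apply Rmin_glb_lt; lra|]. intros z hz.
    assert (h1 := Rmin_l (d / 2) (/ M)). assert (h2 := Rmin_r (d / 2) (/ M)).
    assert (hmin : M <= / Rmin (d / 2) (/ M)).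
    { rewrite <- (Rinv_inv M) at 1. apply Rinv_le_contravar; auto. apply Rmin_glb_lt; lra. }
    destruct (h z ltac:(lra)) as [hz' [l [_ hl]]]. split; [lra|]. exists l. intros k hk.
    eapply Rle_trans; [apply hl; lra|]. apply Rmult_le_compat_r; [apply pow2_ge_0|auto].
  - exists d, (/ d). split; auto. split; [now apply Rinv_0_lt_compat|]. intros z hz.
    destruct (h z hz) as [w [e [hde [hzw hq]]]]. destruct (hq z hzw) as [h1 [l hl]].
    assert (hed : / e <= / d) by now apply Rinv_le_contravar.
    split; [lra|]. exists l. intros k hk. eapply Rle_trans; [apply hl; lra|].
    apply Rmult_le_compat_r; [apply pow2_ge_0|auto].
Qed.

(** * Cauchy's estimate *)

Lemma INR_double (n : nat) : INR (2 * n) = 2 * INR n.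
Proof. rewrite mult_INR. simpl. ring. Qed.

Lemma Cpow_inv_l (z : C) (k : nat) : z <> RtoC 0 -> ((/ z) ^ k)%C = (/ z ^ k)%C.
Proof.
  intros hz. induction k; simpl; [field; apply C1_nz|]. rewrite IHk. field.
  split; auto. now apply Cpow_nz.
Qed.

(** The angle is half a turn over [n], so the order is [2 * n]. *)
Definition unit_root (n : nat) : C := (cos (PI / INR n), sin (PI / INR n)).

Lemma unit_root_pow (n k : nat) :
  (unit_root n ^ k)%C = (cos (INR k * (PI / INR n)), sin (INR k * (PI / INR n))).
Proof.
  induction k.
  - simpl. rewrite Rmult_0_l, cos_0, sin_0. reflexivity.
  - rewrite S_INR, Rmult_plus_distr_r, Rmult_1_l, cos_plus, sin_plus.
    rewrite Cpow_S, IHk. unfold unit_root, Cmult. simpl. f_equal; ring.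
Qed.

Lemma Cmod_cos_sin (x : R) : Cmod (cos x, sin x) = 1.
Proof.
  unfold Cmod. simpl. rewrite !Rmult_1_r. rewrite <- sqrt_1. f_equal.
  pose proof (sin2_cos2 x) as h. unfold Rsqr in h. lra.
Qed.

Lemma Cmod_unit_root_pow (n k : nat) : Cmod (unit_root n ^ k) = 1.
Proof. rewrite unit_root_pow. apply Cmod_cos_sin. Qed.

Lemma unit_root_full (n : nat) : (0 < n)%nat -> (unit_root n ^ (2 * n))%C = RtoC 1.
Proof.
  intros hn. rewrite unit_root_pow. replace (INR (2 * n) * (PI / INR n)) with (2 * PI).
  - rewrite cos_2PI, sin_2PI. reflexivity.
  - rewrite INR_double. field. apply not_0_INR. lia.
Qed.

Lemma unit_root_pow_neq_1 (n k : nat) : (0 < k < 2 * n)%nat -> (unit_root n ^ k)%C <> RtoC 1.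
Proof.
  intros hk e. rewrite unit_root_pow in e. apply (f_equal fst) in e. simpl in e.
  assert (hn : 0 < INR n) by (apply lt_0_INR; lia).
  set (x := INR k * (PI / INR n) / 2).
  replace (INR k * (PI / INR n)) with (2 * x) in e by (unfold x; field; lra).
  rewrite cos_2a_sin in e.
  assert (hx : 0 < sin x).
  { assert (hPI := PI_RGT_0). apply sin_gt_0; unfold x.
    - assert (0 < INR k) by (apply lt_0_INR; lia).
      apply Rdiv_lt_0_compat; [|lra]. apply Rmult_lt_0_compat; auto. now apply Rdiv_lt_0_compat.
    - assert (hk2 : INR k < INR (2 * n)) by (apply lt_INR; lia).
      rewrite INR_double in hk2.
      apply (Rmult_lt_reg_r (2 * INR n / PI)); [apply Rdiv_lt_0_compat; lra|].
      replace (INR k * (PI / INR n) / 2 * (2 * INR n / PI)) with (INR k) by (field; lra).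
      replace (PI * (2 * INR n / PI)) with (2 * INR n) by (field; lra). lra. }
  nra.
Qed.

(** The chord is at most the arc [PI / INR n], and [PI <= 4]. *)
Lemma Cmod_unit_root_sub_1_le (n : nat) : (0 < n)%nat -> Cmod (unit_root n - 1) <= 4 / INR n.
Proof.
  intros hn. assert (hn' : 0 < INR n) by (apply lt_0_INR; lia).
  assert (hPI := PI_RGT_0). assert (hPI4 := PI_4).
  set (x := PI / INR n / 2).
  assert (hx : 0 < x) by (unfold x; apply Rdiv_lt_0_compat; [now apply Rdiv_lt_0_compat|lra]).
  assert (hle : 2 * x <= 4 / INR n).
  { unfold x. replace (2 * (PI / INR n / 2)) with (PI * / INR n) by (field; lra).
    apply Rmult_le_compat_r; [left; now apply Rinv_0_lt_compat|lra]. }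
  apply Rle_trans with (2 * x); auto.
  unfold Cmod. rewrite <- (sqrt_square (2 * x)) by lra. apply sqrt_le_1_alt.
  simpl. replace (PI / INR n) with (2 * x) by (unfold x; field; lra).
  rewrite cos_2a_sin, sin_2a.
  assert (hs : sin x * sin x <= x * x).
  { assert (h1 := sin_lt_x x hx).
    assert (h3 : - x < sin x).
    { destruct (Rle_dec x PI) as [hp|hp].
      - pose proof (sin_ge_0 x ltac:(lra) hp). lra.
      - pose proof (SIN_bound x). assert (3 <= PI) by (pose proof PI2_3_2; lra). lra. }
    nra. }
  pose proof (sin2_cos2 x) as h. unfold Rsqr in h.
  assert (hc : cos x * cos x = 1 - sin x * sin x) by lra.
  replace (2 * sin x * cos x + - 0) with (2 * sin x * cos x) by ring.
  replace (2 * sin x * cos x * (2 * sin x * cos x * 1)) with (4 * (sin x * sin x) * (cos x * cos x)) by ring.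
  rewrite hc. set (y := sin x) in *. apply Rle_trans with (4 * (y * y)); [right; ring|lra].
Qed.

Lemma csum_telescope (u : nat -> C) (n : nat) :
  csum (fun j => u (S j) - u j)%C n = (u n - u 0%nat)%C.
Proof. induction n; simpl; [ring|]. rewrite IHn. ring. Qed.

Lemma csum_geom_root (q : C) (n : nat) : q <> RtoC 1 -> (q ^ n)%C = RtoC 1 ->
  csum (fun j => q ^ j)%C n = RtoC 0.
Proof.
  intros hq hn.
  assert (h : ((q - 1) * csum (fun j => q ^ j) n)%C = RtoC 0).
  { rewrite <- csum_scal. rewrite (csum_ext _ (fun j => q ^ S j - q ^ j)%C).
    - rewrite (csum_telescope (fun j => q ^ j)%C), hn. simpl. ring.
    - intros. simpl. ring. }
  apply NNPP. intros hne. apply (Cmult_neq_0 (q - 1)%C (csum (fun j => q ^ j)%C n)); auto.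
  now apply Cminus_eq_contra.
Qed.

(** [2 * n] times the mean of [H] over the sample points: an unnormalised Riemann sum of the
    integral of [H(z) / z]. *)
Definition circle_sum (H : C -> C) (n : nat) (r : R) : C :=
  csum (fun j => H (r * unit_root n ^ j)%C) (2 * n).

Lemma Cmod_circle (r : R) (n j : nat) : 0 <= r -> Cmod (RtoC r * unit_root n ^ j) = r.
Proof. intros h. rewrite Cmod_mult, Cmod_unit_root_pow, Cmod_R, Rabs_pos_eq; lra. Qed.

(* Rotating the sample points permutes them, while to first order it changes the
   sum by a multiple of [csum (z * L z)], which must therefore be small. *)
Lemma circle_sum_deriv_le (H L : C -> C) (d M r : R) (n : nat) :
  0 < r -> 0 < M -> (1 < n)%nat -> 4 * r < d * INR n ->
  (forall z h, Cmod z = r -> Cmod h < d -> Cmod (H (z + h) - H z - h * L z)%C <= M * Cmod h ^ 2) ->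
  Cmod (csum (fun j => let z := (r * unit_root n ^ j)%C in z * L z)%C (2 * n)) <= 8 * M * r ^ 2.
Proof.
  intros hr hM hn hd hq. cbv zeta. set (w := unit_root n).
  assert (hn' : 0 < INR n) by (apply lt_0_INR; lia).
  assert (hw : 0 < Cmod (w - 1)).
  { apply Cmod_gt_0, Cminus_eq_contra. unfold w. rewrite <- (Cpow_1_r (unit_root n)).
    apply unit_root_pow_neq_1. lia. }
  assert (hw4 := Cmod_unit_root_sub_1_le n ltac:(lia)). fold w in hw4.
  set (S := csum (fun j => r * w ^ j * L (r * w ^ j))%C (2 * n)).
  assert (hz : csum (fun j => H (r * w ^ Datatypes.S j) - H (r * w ^ j))%C (2 * n) = RtoC 0).
  { rewrite (csum_telescope (fun j => H (r * w ^ j)%C)). unfold w. rewrite unit_root_full by lia.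
    simpl. ring. }
  assert (hS : Cmod ((w - 1) * S) <= INR (2 * n) * (M * (Cmod (w - 1) * r) ^ 2)).
  { replace ((w - 1) * S)%C with (- (csum (fun j => H (r * w ^ Datatypes.S j) - H (r * w ^ j))%C (2 * n)
       - (w - 1) * S))%C by (rewrite hz; ring).
    unfold S. rewrite Cmod_opp, <- csum_scal, <- csum_sub, <- rsum_const.
    apply Cmod_csum_le. intros j _.
    pose proof (Cmod_circle r n j ltac:(lra)) as hmod. fold w in hmod.
    assert (hh : Cmod ((w - 1) * (r * w ^ j)) = Cmod (w - 1) * r) by (rewrite Cmod_mult, hmod; auto).
    rewrite <- hh.
    replace (r * w ^ Datatypes.S j)%C with (r * w ^ j + (w - 1) * (r * w ^ j))%C by (simpl; ring).
    replace ((w - 1) * (r * w ^ j * L (r * w ^ j)))%C with ((w - 1) * (r * w ^ j) * L (r * w ^ j))%C by ring.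
    apply hq; auto. rewrite hh.
    apply Rle_lt_trans with (4 / INR n * r); [apply Rmult_le_compat_r; lra|].
    apply (Rmult_lt_reg_r (INR n)); auto.
    replace (4 / INR n * r * INR n) with (4 * r) by (field; lra). lra. }
  rewrite Cmod_mult, INR_double in hS.
  apply (Rmult_le_reg_l (Cmod (w - 1))); auto.
  eapply Rle_trans; [apply hS|].
  replace (2 * INR n * (M * (Cmod (w - 1) * r) ^ 2))
    with (Cmod (w - 1) * (2 * M * r ^ 2 * (Cmod (w - 1) * INR n))) by ring.
  apply Rmult_le_compat_l; [lra|].
  assert (Cmod (w - 1) * INR n <= 4).
  { apply (Rmult_le_compat_r (INR n)) in hw4; [|lra].
    replace (4 / INR n * INR n) with 4 in hw4 by (field; lra). exact hw4. }
  assert (0 < 2 * M * r ^ 2) by (pose proof (pow_lt r 2 hr); nra). nra.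
Qed.

(** A radial displacement of the sample [z] is [(e / r) z], so the first-order change is [e / r]
    times the sum bounded in [circle_sum_deriv_le]. *)
Lemma circle_sum_step_le (H L : C -> C) (d M r e : R) (n : nat) :
  0 < r -> 0 <= e < d -> 0 < M -> (1 < n)%nat -> 4 * r < d * INR n ->
  (forall z h, Cmod z = r -> Cmod h < d -> Cmod (H (z + h) - H z - h * L z)%C <= M * Cmod h ^ 2) ->
  Cmod (circle_sum H n (r + e) - circle_sum H n r) <= 8 * M * r * e + 2 * INR n * M * e ^ 2.
Proof.
  intros hr he hM hn hd hq.
  pose proof (circle_sum_deriv_le H L d M r n hr hM hn hd hq) as hS. cbv zeta in hS.
  set (w := unit_root n) in *.
  set (S := csum (fun j => r * w ^ j * L (r * w ^ j))%C (2 * n)) in *.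
  assert (h1 : Cmod (circle_sum H n (r + e) - circle_sum H n r - RtoC (e / r) * S)
     <= INR (2 * n) * (M * e ^ 2)).
  { unfold circle_sum, S. rewrite <- csum_sub, <- csum_scal, <- csum_sub, <- rsum_const.
    apply Cmod_csum_le. intros j _. fold w.
    pose proof (Cmod_circle r n j ltac:(lra)) as hmod.
    pose proof (Cmod_circle e n j ltac:(lra)) as hmod'. fold w in hmod, hmod'.
    replace (RtoC (r + e) * w ^ j)%C with (r * w ^ j + e * w ^ j)%C by (rewrite RtoC_plus; ring).
    replace (RtoC (e / r) * (r * w ^ j * L (r * w ^ j)))%C with (e * w ^ j * L (r * w ^ j))%C.
    - replace (e ^ 2) with (Cmod (e * w ^ j) ^ 2) by now rewrite hmod'. apply hq; auto. lra.
    - rewrite RtoC_div by lra. field. intros e0. apply RtoC_inj in e0. lra. }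
  replace (circle_sum H n (r + e) - circle_sum H n r)%C with
    ((circle_sum H n (r + e) - circle_sum H n r - RtoC (e / r) * S) + RtoC (e / r) * S)%C by ring.
  eapply Rle_trans; [apply Cmod_triangle|].
  rewrite Cmod_mult, Cmod_R, (Rabs_pos_eq (e / r)) by (apply Rdiv_le_0_compat; lra).
  assert (h2 : e / r * Cmod S <= e / r * (8 * M * r ^ 2))
    by (apply Rmult_le_compat_l; auto; apply Rdiv_le_0_compat; lra).
  replace (e / r * (8 * M * r ^ 2)) with (8 * M * r * e) in h2 by (field; lra).
  rewrite INR_double in h1. lra.
Qed.

(** Discrete form of the independence of the contour. Going from [r0] to [r1] in [n] steps of size
    [(r1 - r0) / n] costs [O(1/n)] per step, so the total stays bounded while the sums themselves
    are of order [n]. *)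
Lemma circle_sum_radii (H : C -> C) (r0 r1 : R) :
  0 < r0 < r1 -> (forall w, r0 <= Cmod w <= r1 -> lq H w) ->
  exists K n0, forall n, (n0 <= n)%nat -> Cmod (circle_sum H n r1 - circle_sum H n r0) <= K.
Proof.
  intros hr hH. destruct (lq_uniform H r0 r1 hH) as [d [M [hd [hM hu]]]].
  set (L := fun z => epsilon (inhabits (RtoC 0)) (fun l => forall h, Cmod h < d ->
     Cmod (H (z + h) - H z - h * l)%C <= M * Cmod h ^ 2)).
  assert (hL : forall z h, r0 <= Cmod z <= r1 -> Cmod h < d ->
     Cmod (H (z + h) - H z - h * L z)%C <= M * Cmod h ^ 2).
  { intros z h hz. unfold L. revert h. apply (epsilon_spec (inhabits (RtoC 0)) (fun l => forall h, Cmod h < d ->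
     Cmod (H (z + h) - H z - h * l)%C <= M * Cmod h ^ 2)). now apply hu. }
  destruct (INR_unbounded (4 * r1 / d + 2)) as [n0 hn0].
  exists (8 * M * r1 * (r1 - r0) + 2 * M * (r1 - r0) ^ 2), n0. intros n hn.
  assert (hnI : 4 * r1 / d + 2 < INR n) by (apply le_INR in hn; lra).
  assert (hpos : 0 < 4 * r1 / d) by (apply Rdiv_lt_0_compat; lra).
  assert (hn1 : (1 < n)%nat) by (apply INR_lt; simpl; lra).
  assert (hdn : 4 * r1 < d * INR n).
  { replace (4 * r1) with (d * (4 * r1 / d)) by (field; lra). apply Rmult_lt_compat_l; lra. }
  set (e := (r1 - r0) / INR n).
  assert (he : e * INR n = r1 - r0) by (unfold e; field; lra).
  assert (he0 : 0 < e) by (unfold e; apply Rdiv_lt_0_compat; lra).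
  assert (hk : forall k, (k <= n)%nat ->
    Cmod (circle_sum H n (r0 + INR k * e) - circle_sum H n r0)
      <= INR k * (8 * M * r1 * e + 2 * INR n * M * e ^ 2)).
  { induction k; intros hk.
    - simpl. rewrite !Rmult_0_l, Rplus_0_r.
      replace (circle_sum H n r0 - circle_sum H n r0)%C with (RtoC 0) by ring. rewrite Cmod_0. lra.
    - specialize (IHk ltac:(lia)). rewrite S_INR, !(Rmult_plus_distr_r (INR k)), !Rmult_1_l, <- Rplus_assoc.
      set (r := r0 + INR k * e) in *.
      assert (hke : INR k * e + e <= r1 - r0).
      { rewrite <- he. apply le_INR in hk. rewrite S_INR in hk. nra. }
      assert (hke0 : 0 <= INR k * e) by (apply Rmult_le_pos; [apply pos_INR|lra]).
      assert (hrr : r0 <= r <= r1) by (unfold r; lra).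
      assert (hstep : Cmod (circle_sum H n (r + e) - circle_sum H n r)
          <= 8 * M * r * e + 2 * INR n * M * e ^ 2).
      { apply (circle_sum_step_le H L d); try lra; try lia.
        - split; [lra|]. apply (Rmult_lt_reg_r (INR n)); lra.
        - intros z h hz. apply hL. lra. }
      replace (circle_sum H n (r + e) - circle_sum H n r0)%C with
        ((circle_sum H n r - circle_sum H n r0) + (circle_sum H n (r + e) - circle_sum H n r))%C by ring.
      eapply Rle_trans; [apply Cmod_triangle|].
      assert (8 * M * r * e <= 8 * M * r1 * e) by (apply Rmult_le_compat_r; [lra|]; nra).
      lra. }
  specialize (hk n ltac:(lia)). rewrite (Rmult_comm (INR n) e), he in hk.
  replace (r0 + (r1 - r0)) with r1 in hk by ring.
  eapply Rle_trans; [apply hk|]. right.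
  replace (r1 - r0) with (e * INR n) by auto. ring.
Qed.

Lemma unit_root_pow_inj (n k m : nat) : (k < 2 * n)%nat -> (m < 2 * n)%nat ->
  (unit_root n ^ k)%C = (unit_root n ^ m)%C -> k = m.
Proof.
  assert (hlt : forall i j, (i < j < 2 * n)%nat -> (unit_root n ^ i)%C <> (unit_root n ^ j)%C).
  { intros i j hij e. apply (unit_root_pow_neq_1 n (j - i)); [lia|].
    assert (hi : (unit_root n ^ i)%C <> RtoC 0) by (apply Cmod_gt_0; rewrite Cmod_unit_root_pow; lra).
    replace (unit_root n ^ (j - i))%C with (unit_root n ^ i * unit_root n ^ (j - i) / unit_root n ^ i)%C
      by (field; auto).
    rewrite <- Cpow_add_r. replace (i + (j - i))%nat with j by lia. rewrite <- e. now apply Cinv_r. }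
  intros hk hm e. destruct (lt_eq_lt_dec k m) as [[h|h]|h]; auto; exfalso.
  - now apply (hlt k m).
  - now apply (hlt m k).
Qed.

(** Orthogonality of characters; both exponents stay below [2 * n], so no aliasing occurs. *)
Lemma circle_sum_monomial (n k m : nat) (r : R) :
  0 < r -> (k < 2 * n)%nat -> (m < 2 * n)%nat ->
  circle_sum (fun z => z ^ m * / z ^ k)%C n r = if Nat.eq_dec m k then RtoC (INR (2 * n)) else RtoC 0.
Proof.
  intros hr hk hm. unfold circle_sum. set (w := unit_root n).
  assert (hw : forall i, (w ^ i)%C <> RtoC 0).
  { intros i. apply Cmod_gt_0. unfold w. rewrite Cmod_unit_root_pow. lra. }
  assert (hr0 : RtoC r <> RtoC 0) by (intros e; apply RtoC_inj in e; lra).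
  destruct (Nat.eq_dec m k) as [->|hne].
  - rewrite (csum_ext _ (fun _ => RtoC 1)); [rewrite csum_const; ring|].
    intros j _. apply Cinv_r, Cpow_nz. now apply Cmult_neq_0.
  - set (q := (w ^ m * / w ^ k)%C).
    assert (hq : forall j, (q ^ j)%C = ((w ^ j) ^ m * / (w ^ j) ^ k)%C).
    { intros j. unfold q. rewrite Cpow_mult_l, Cpow_inv_l by auto.
      now rewrite <- !Cpow_mult_r, (Nat.mul_comm m), (Nat.mul_comm k). }
    rewrite (csum_ext _ (fun j => (r ^ m * / r ^ k) * q ^ j)%C).
    + rewrite csum_scal, csum_geom_root; [ring| |].
      * intros e. apply hne. apply (unit_root_pow_inj n); auto. fold w.
        replace (w ^ m)%C with (q * w ^ k)%C by (unfold q; field; auto). rewrite e. ring.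
      * rewrite hq. unfold w. rewrite unit_root_full, !Cpow_1_l by lia. apply Cinv_r, C1_nz.
    + intros j _. rewrite hq, !Cpow_mult_l. field. repeat split; try now apply Cpow_nz.
Qed.

Lemma le_epsilon_geom (a b K x : R) (n0 : nat) : 0 <= x < 1 ->
  (forall n, (n0 <= n)%nat -> a <= b + K * / INR n + K * x ^ n) -> a <= b.
Proof.
  intros hx h. apply Rnot_lt_le. intros hlt.
  set (e := (a - b) / 3). assert (he : 0 < e) by (unfold e; lra).
  set (K' := Rabs K + 1). assert (hK : 0 < K') by (unfold K'; pose proof (Rabs_pos K); lra).
  assert (hKK : forall t, 0 <= t -> K * t <= K' * t).
  { intros t ht. apply Rmult_le_compat_r; auto. unfold K'. pose proof (Rle_abs K). lra. }
  destruct (pow_lt_1_zero x ltac:(rewrite Rabs_pos_eq; lra) (e / K')) as [n1 h1];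
    [now apply Rdiv_lt_0_compat|].
  destruct (INR_unbounded (K' / e)) as [n2 h2].
  set (n := S (n0 + n1 + n2)).
  specialize (h n ltac:(unfold n; lia)). specialize (h1 n ltac:(unfold n; lia)).
  assert (hn : K' / e < INR n) by (apply Rlt_trans with (INR n2); auto; apply lt_INR; unfold n; lia).
  assert (hKe : 0 < K' / e) by now apply Rdiv_lt_0_compat.
  rewrite Rabs_pos_eq in h1 by (apply pow_le; lra).
  pose proof (hKK (x ^ n) ltac:(apply pow_le; lra)) as k1.
  assert (hi : 0 < / INR n) by (apply Rinv_0_lt_compat; lra).
  pose proof (hKK (/ INR n) ltac:(lra)) as k2.
  assert (k3 : K' * x ^ n < e).
  { apply (Rmult_lt_compat_l K') in h1; auto. replace (K' * (e / K')) with e in h1 by (field; lra). auto. }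
  assert (k4 : K' * / INR n < e).
  { apply (Rmult_lt_reg_r (INR n)); [lra|]. rewrite Rmult_assoc, Rinv_l by lra.
    apply (Rmult_lt_compat_l e) in hn; auto. replace (e * (K' / e)) with K' in hn by (field; lra). lra. }
  unfold e in *. lra.
Qed.

(** Near [0] the series converges and [2 n c_k] is the circle sum of [F(z) / z^k] up to a geometric
    error. Moving to the circle [|z| = r1] costs a bounded amount, and dividing by [2 n] removes
    both. Convergence of the series up to [r1] is not assumed, which is what makes the estimate
    detect analytic continuation. *)
Theorem cauchy_estimate (F : C -> C) (c : nat -> C) (rho R0 r1 N : R) :
  0 < rho -> 0 < r1 < R0 ->
  (forall w, Cmod w < R0 -> lq F w) ->
  (forall z, Cmod z < rho -> is_cseries (fun k => c k * z ^ k)%C (F z)) ->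
  (forall z, Cmod z = r1 -> Cmod (F z) <= N) -> forall k, Cmod (c k) <= N * / r1 ^ k.
Proof.
  intros hrho hr1 hF hc hN k.
  (* Coefficients are bounded at radius [s], so on the circle of radius [r0 = s / 2] the terms decay
     like [2^(-m)]. *)
  set (s := Rmin rho r1 / 2). set (r0 := s / 2).
  assert (hm1 := Rmin_l rho r1). assert (hm2 := Rmin_r rho r1).
  assert (hmp : 0 < Rmin rho r1) by (apply Rmin_glb_lt; lra).
  assert (hs : 0 < s /\ s < rho /\ s < r1) by (unfold s; lra).
  assert (hr0 : 0 < r0 /\ r0 < s) by (unfold r0; lra).
  set (H := fun z => (F z * / z ^ k)%C).
  destruct (circle_sum_radii H r0 r1 ltac:(lra)) as [K [n0 hK]].
  { intros w hw. apply (lq_mul F (fun z => / z ^ k)%C); [apply hF; lra|].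
    apply (lq_inv (fun z => z ^ k)%C).
    - apply Cpow_nz, Cmod_gt_0. lra.
    - apply (lq_pow (fun z => z)), lq_id. }
  assert (hgeo : geo (/ s) c).
  { replace s with (Cmod s) by (rewrite Cmod_R, Rabs_pos_eq; lra).
    apply (is_cseries_geo c s (F s)).
    - apply hc. rewrite Cmod_R, Rabs_pos_eq; lra.
    - intros e. apply RtoC_inj in e. lra. }
  destruct hgeo as [A [hA hcA]].
  assert (hx : / s * r0 = / 2) by (unfold r0; field; lra).
  assert (hr0k : 0 < / r0 ^ k) by (apply Rinv_0_lt_compat, pow_lt; lra).
  (* The summand [k + 1] makes [k < 2 * n], as orthogonality requires. *)
  apply (le_epsilon_geom _ _ (Rabs K + 2 * A * / r0 ^ k) (/ 2) (n0 + k + 1)); [lra|].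
  intros n hn. specialize (hK n ltac:(lia)).
  assert (hnp : 0 < INR n) by (apply lt_0_INR; lia).
  assert (h1 : Cmod (circle_sum H n r1) <= INR (2 * n) * (N * / r1 ^ k)).
  { unfold circle_sum. rewrite <- rsum_const. apply Cmod_csum_le. intros j _. unfold H.
    pose proof (Cmod_circle r1 n j ltac:(lra)) as hmod.
    rewrite Cmod_mult, Cmod_inv, Cmod_pow, hmod by (apply Cpow_nz, Cmod_gt_0; lra).
    apply Rmult_le_compat_r; [left; apply Rinv_0_lt_compat, pow_lt; lra|]. now apply hN. }
  assert (h0 : Cmod (circle_sum H n r0 - RtoC (INR (2 * n)) * c k)
     <= INR (2 * n) * (2 * A * (/ 2) ^ (2 * n) * / r0 ^ k)).
  (* Cutting the series after [2 * n] terms leaves exactly the monomials on which orthogonality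
     holds. *)
  { replace (RtoC (INR (2 * n)) * c k)%C with
      (circle_sum (fun z => csum (fun m => c m * z ^ m) (2 * n) * / z ^ k)%C n r0).
    - unfold circle_sum. rewrite <- csum_sub, <- rsum_const.
      apply Cmod_csum_le. intros j _. unfold H.
      pose proof (Cmod_circle r0 n j ltac:(lra)) as hmod.
      set (z := (r0 * unit_root n ^ j)%C) in *.
      replace (F z * / z ^ k - csum (fun m => c m * z ^ m) (2 * n) * / z ^ k)%C with
        ((F z - csum (fun m => c m * z ^ m)%C (2 * n)) * / z ^ k)%C by ring.
      rewrite Cmod_mult, Cmod_inv, Cmod_pow, hmod by (apply Cpow_nz, Cmod_gt_0; lra).
      apply Rmult_le_compat_r; [lra|].
      eapply Rle_trans.
      + apply (is_cseries_geom_tail (fun m => c m * z ^ m)%C (F z) A (/ 2) (2 * n)); try lra.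
        * intros m _. rewrite <- hx, <- hmod. now apply geo_term_le.
        * apply hc. lra.
      + right. field.
    - unfold circle_sum.
      rewrite (csum_ext _ (fun j => csum (fun m => c m * ((r0 * unit_root n ^ j) ^ m * / (r0 * unit_root n ^ j) ^ k))%C (2 * n))).
      + rewrite csum_swap.
        assert (hmono : forall m, (m < 2 * n)%nat ->
          csum (fun j => c m * ((r0 * unit_root n ^ j) ^ m * / (r0 * unit_root n ^ j) ^ k))%C (2 * n)
          = (c m * if Nat.eq_dec m k then RtoC (INR (2 * n)) else RtoC 0)%C).
        { intros m hm. rewrite csum_scal. f_equal. apply circle_sum_monomial; lra || lia. }
        rewrite (csum_single _ (2 * n) k).
        * rewrite hmono by lia. destruct (Nat.eq_dec k k); [ring|lia].
        * lia.
        * intros m hm hmk. rewrite hmono by lia. destruct (Nat.eq_dec m k); [lia|ring].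
      + intros j _. rewrite Cmult_comm, <- csum_scal. apply csum_ext. intros. ring. }
  assert (h2 : Cmod (RtoC (INR (2 * n)) * c k) <=
      INR (2 * n) * (N * / r1 ^ k) + K + INR (2 * n) * (2 * A * (/ 2) ^ (2 * n) * / r0 ^ k)).
  { replace (RtoC (INR (2 * n)) * c k)%C with
      (circle_sum H n r1 - (circle_sum H n r1 - circle_sum H n r0)
        - (circle_sum H n r0 - RtoC (INR (2 * n)) * c k))%C by ring.
    eapply Rle_trans; [apply Cmod_sub_le|]. apply Rplus_le_compat; auto.
    eapply Rle_trans; [apply Cmod_sub_le|]. lra. }
  rewrite Cmod_mult, Cmod_R, Rabs_pos_eq in h2 by apply pos_INR.
  rewrite INR_double in h2.
  apply (Rmult_le_reg_l (2 * INR n)); [lra|]. eapply Rle_trans; [apply h2|].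
  assert (p1 : (/ 2) ^ (2 * n) <= (/ 2) ^ n).
  { replace (2 * n)%nat with (n + n)%nat by lia. rewrite pow_add.
    pose proof (pow_lt (/ 2) n ltac:(lra)). pose proof (pow_incr (/ 2) 1 n ltac:(lra)) as h3.
    rewrite pow1 in h3. nra. }
  assert (p3 : 0 < 2 * A * / r0 ^ k) by (apply Rmult_lt_0_compat; lra).
  pose proof (Rle_abs K). pose proof (Rabs_pos K).
  set (P := 2 * A * / r0 ^ k) in *.
  replace (2 * A * (/ 2) ^ (2 * n) * / r0 ^ k) with (P * (/ 2) ^ (2 * n)) by (unfold P; ring).
  assert (e1 : 2 * INR n * ((Rabs K + P) * / INR n) = 2 * (Rabs K + P)) by (field; lra).
  rewrite !Rmult_plus_distr_l, e1.
  assert (2 * INR n * (P * (/ 2) ^ (2 * n)) <= 2 * INR n * ((Rabs K + P) * (/ 2) ^ n)).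
  { apply Rmult_le_compat_l; [lra|]. apply Rmult_le_compat; try lra. apply pow_le. lra. }
  lra.
Qed.

Lemma geo_of_lq (F : C -> C) (c : nat -> C) (rho R0 r1 : R) :
  0 < rho -> 0 < r1 < R0 ->
  (forall w, Cmod w < R0 -> lq F w) ->
  (forall z, Cmod z < rho -> is_cseries (fun k => c k * z ^ k)%C (F z)) ->
  geo (/ r1) c.
Proof.
  intros hrho hr1 hF hc.
  (* A degenerate annulus: only the bound of [F] on the circle is wanted. *)
  destruct (lq_uniform F r1 r1 ltac:(intros; apply hF; lra)) as [d [M [_ [hM h]]]].
  exists M. split; auto. intros k. rewrite pow_inv.
  apply (cauchy_estimate F c rho R0 r1); auto. intros z hz. apply h. lra.
Qed.

(** * Zeros on the unit circle *)

(** The formal reciprocal cut to indices below [n]. Carrying the whole truncated sequence turns a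
    recursion over all earlier coefficients into a structural one. *)
Fixpoint inv_trunc (a : nat -> C) (n : nat) : nat -> C :=
  match n with
  | 0%nat => fun _ => RtoC 0
  | S m => fun k => if Nat.eq_dec k m then ((one_seq m - conv (inv_trunc a m) a m) / a 0%nat)%C
                    else inv_trunc a m k
  end.

Lemma inv_trunc_zero (a : nat -> C) (n k : nat) : (n <= k)%nat -> inv_trunc a n k = RtoC 0.
Proof.
  induction n; simpl; intros h; auto. destruct (Nat.eq_dec k n); [lia|]. apply IHn. lia.
Qed.

Lemma inv_trunc_stable (a : nat -> C) (n k : nat) :
  (k < n)%nat -> inv_trunc a n k = inv_trunc a (S k) k.
Proof.
  induction n; intros h; [lia|]. destruct (Nat.eq_dec k n) as [->|hne]; auto.
  simpl inv_trunc at 1. destruct (Nat.eq_dec k n); [lia|]. apply IHn. lia.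
Qed.

Lemma formal_inverse (a : nat -> C) : a 0%nat <> RtoC 0 ->
  exists d, forall n, conv d a n = one_seq n.
Proof.
  intros ha. exists (fun k => inv_trunc a (S k) k). intros n.
  set (x := ((one_seq n - conv (inv_trunc a n) a n) / a 0%nat)%C).
  rewrite (conv_ext _ (fun k => inv_trunc a n k + x * (if Nat.eq_dec k n then RtoC 1 else RtoC 0))%C a a).
  - rewrite conv_add_l, conv_scal_l.
    replace (conv (fun k => if Nat.eq_dec k n then RtoC 1 else RtoC 0) a n) with (a 0%nat).
    + unfold x. field. auto.
    + rewrite conv_csum, (csum_single _ (S n) n); try lia.
      * rewrite Nat.sub_diag. destruct (Nat.eq_dec n n); [ring|lia].
      * intros j _ hj. destruct (Nat.eq_dec j n); [lia|ring].
  - intros k hk. destruct (Nat.eq_dec k n) as [->|hne].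
    + simpl. destruct (Nat.eq_dec n n); [|lia]. rewrite inv_trunc_zero by lia. fold x. ring.
    + rewrite <- (inv_trunc_stable a n) by lia. ring.
  - auto.
Qed.

(** Only some positive radius of convergence is wanted. The growth [1 + q] closes the induction
    because [q] times the sum of [(1 + q)^i] over [i < n] is [(1 + q)^n - 1]. *)
Lemma geo_formal_inverse (a d : nat -> C) (r : R) :
  0 < r -> geo r a -> a 0%nat <> RtoC 0 -> (forall n, conv d a n = one_seq n) ->
  exists r', r < r' /\ geo r' d.
Proof.
  intros hr [A [hA ha]] ha0 hd. apply Cmod_gt_0 in ha0. set (m := Cmod (a 0%nat)) in *.
  set (q := A / m). assert (hq : 0 < q) by now apply Rdiv_lt_0_compat.
  exists (r * (1 + q)). split; [nra|]. exists (/ m). split; [now apply Rinv_0_lt_compat|].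
  assert (hnz : a 0%nat <> RtoC 0) by now apply Cmod_gt_0.
  intros n. induction n as [n IH] using (well_founded_induction Nat.lt_wf_0).
  assert (hrec : (d n * a 0%nat)%C = (one_seq n - csum (fun i => d i * a (n - i)%nat) n)%C).
  { rewrite <- hd, conv_csum. simpl. rewrite Nat.sub_diag. ring. }
  destruct n as [|n].
  - simpl in hrec |- *. replace (d 0%nat) with (/ a 0%nat)%C.
    + rewrite Cmod_inv by auto. fold m. lra.
    + replace (d 0%nat) with (d 0%nat * a 0%nat / a 0%nat)%C by (field; auto).
      rewrite hrec. field. auto.
  - apply (Rmult_le_reg_r m); auto. unfold m at 1. rewrite <- Cmod_mult, hrec.
    change (one_seq (S n)) with (RtoC 0).
    replace (0 - csum (fun i => d i * a (S n - i)%nat)%C (S n))%C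
      with (- csum (fun i => d i * a (S n - i)%nat)%C (S n))%C by ring.
    rewrite Cmod_opp.
    eapply Rle_trans; [apply (Cmod_csum_le _ (fun i => (q * r ^ S n) * (1 + q) ^ i))|].
    + intros i hi. rewrite Cmod_mult.
      replace (q * r ^ S n * (1 + q) ^ i) with (/ m * (r * (1 + q)) ^ i * (A * r ^ (S n - i))).
      * apply Rmult_le_compat; try apply Cmod_ge_0; [apply IH; lia|apply ha].
      * rewrite Rpow_mult_distr. replace (S n) with (i + (S n - i))%nat at 2 by lia.
        rewrite pow_add. unfold q. field. lra.
    + rewrite rsum_scal, rsum_geom by lra. rewrite Rpow_mult_distr.
      apply Rle_trans with (r ^ S n * ((1 + q) ^ S n - 1)).
      * right. field. lra.
      * pose proof (pow_lt r (S n) hr).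
        replace (/ m * (r ^ S n * (1 + q) ^ S n) * m) with (r ^ S n * (1 + q) ^ S n) by (field; lra). lra.
Qed.

(** A bootstrap: the crude radius identifies the sum of [d] with [/ F] near [0], and Cauchy's
    estimate for [/ F] then improves it to any [r1 < R0]. *)
Lemma geo_inverse (F : C -> C) (a d : nat -> C) (rho R0 r1 : R) :
  0 < rho -> 0 < r1 < R0 ->
  (forall w, Cmod w < R0 -> lq F w /\ F w <> RtoC 0) ->
  (forall z, Cmod z < rho -> is_cseries (fun k => a k * z ^ k)%C (F z)) ->
  (forall n, conv d a n = one_seq n) -> geo (/ r1) d.
Proof.
  intros hrho hr1 hF hsum hd.
  assert (ha0 : a 0%nat <> RtoC 0).
  { intros h0. specialize (hd 0%nat). simpl in hd. rewrite h0 in hd.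
    apply C1_nz. rewrite <- hd. ring. }
  assert (hgeo : geo (/ (rho / 2)) a).
  { replace (rho / 2) with (Cmod (rho / 2)%R) by (rewrite Cmod_R, Rabs_pos_eq; lra).
    apply (is_cseries_geo a (rho / 2)%R (F (rho / 2)%R)).
    - apply hsum. rewrite Cmod_R, Rabs_pos_eq; lra.
    - intros e. apply RtoC_inj in e. lra. }
  assert (hrp : 0 < / (rho / 2)) by (apply Rinv_0_lt_compat; lra).
  destruct (geo_formal_inverse a d _ hrp hgeo ha0 hd) as [r' [hr' hgd]].
  assert (hga : geo r' a) by (apply (geo_weaken (/ (rho / 2))); auto; lra).
  assert (hir : 0 < / r') by (apply Rinv_0_lt_compat; lra).
  apply (geo_of_lq (fun z => / F z)%C d (Rmin rho (/ r')) R0); auto.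
  - now apply Rmin_glb_lt.
  - intros w hw. apply lq_inv; now apply hF.
  - intros z hz. assert (h1 := Rmin_l rho (/ r')). assert (h2 := Rmin_r rho (/ r')).
    assert (hz' : r' * Cmod z < 1).
    { apply (Rmult_lt_reg_l (/ r')); auto. rewrite <- Rmult_assoc, Rinv_l; lra. }
    pose proof (psum_conv d a r' z ltac:(lra) hgd hga hz') as hp.
    pose proof (psum_correct r' d z ltac:(lra) hgd hz') as hsd.
    rewrite (psum_unique a z (F z)) in hp by (apply hsum; lra).
    assert (h : (psum d z * F z)%C = RtoC 1).
    { apply (is_cseries_unique _ _ _ hp).
      apply (is_cseries_ext (fun k => one_seq k * z ^ k)%C); [intros; now rewrite hd|].
      apply is_cseries_one_seq. }
    assert (hFz : F z <> RtoC 0).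
    { intros e. apply C1_nz. rewrite <- h, e. ring. }
    replace (/ F z)%C with (psum d z); auto.
    replace (psum d z) with (psum d z * F z / F z)%C by (field; auto). rewrite h. field. auto.
Qed.

(** * Linear factors and the number of zeros on the circle *)

Definition lin (a b : C) (k : nat) : C :=
  match k with 0%nat => a | 1%nat => b | _ => RtoC 0 end.

Lemma conv_lin_S (a b : C) (c : nat -> C) (k : nat) :
  conv (lin a b) c (S k) = (a * c (S k) + b * c k)%C.
Proof.
  simpl. f_equal. destruct k; simpl; [ring|]. rewrite conv_zero_l by auto. ring.
Qed.

Definition lin_prod (L : list C) : nat -> C :=
  fold_right (fun s p => conv (lin (RtoC 1) (- s)%C) p) one_seq L.

(** Unlike in [geo_conv], the ratio is not enlarged, so it survives any number of factors. *)
Lemma geo_conv_lin (a b : C) (c : nat -> C) (x : R) : 0 < x -> geo x c -> geo x (conv (lin a b) c).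
Proof.
  intros hx [K [hK h]]. exists (K * (Cmod a + Cmod b / x + 1)).
  pose proof (Cmod_ge_0 a) as ha. pose proof (Cmod_ge_0 b) as hb.
  assert (hbx : 0 <= Cmod b / x) by (apply Rdiv_le_0_compat; lra).
  split; [apply Rmult_lt_0_compat; lra|]. intros [|k].
  - simpl. rewrite Cmod_mult. specialize (h 0%nat). simpl in h. rewrite Rmult_1_r in *.
     nra.
  - rewrite conv_lin_S. eapply Rle_trans; [apply Cmod_triangle|]. rewrite !Cmod_mult.
    assert (h1 : Cmod a * Cmod (c (S k)) <= Cmod a * (K * x ^ S k)) by (apply Rmult_le_compat_l; auto).
    assert (h2 : Cmod b * Cmod (c k) <= Cmod b * (K * x ^ k)) by (apply Rmult_le_compat_l; auto).
    replace (Cmod b * (K * x ^ k)) with (Cmod b / x * (K * x ^ S k)) in h2 by (simpl; field; lra).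
    assert (0 < K * x ^ S k) by (apply Rmult_lt_0_compat; auto; apply pow_lt; auto). lra.
Qed.

Lemma geo_one_seq (x : R) : 0 < x -> geo x one_seq.
Proof.
  intros hx. exists 1. split; [lra|]. intros [|k]; simpl; [rewrite Cmod_1; lra|].
  rewrite Cmod_0. pose proof (pow_lt x k hx). nra.
Qed.

Lemma geo_lin_prod (L : list C) (x : R) : 0 < x -> geo x (lin_prod L).
Proof.
  intros hx. induction L; simpl; [now apply geo_one_seq|]. now apply geo_conv_lin.
Qed.

Lemma geo_ext (x : R) (a b : nat -> C) : (forall k, a k = b k) -> geo x a -> geo x b.
Proof. intros e [K [hK h]]. exists K. split; auto. intros k. now rewrite <- e. Qed.

Lemma geo_conv_lin_prod (L : list C) (c : nat -> C) (x : R) :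
  0 < x -> geo x c -> geo x (conv (lin_prod L) c).
Proof.
  intros hx hc. induction L; simpl.
  - apply (geo_ext x c); auto. intros. now rewrite conv_one_l.
  - apply (geo_ext x (conv (lin (RtoC 1) (- a)%C) (conv (lin_prod L) c))).
    + intros. now rewrite conv_assoc.
    + now apply geo_conv_lin.
Qed.

Lemma Cmod_sqr (z : C) : Cmod z ^ 2 = fst z ^ 2 + snd z ^ 2.
Proof.
  unfold Cmod. rewrite pow2_sqrt; auto. apply Rplus_le_le_0_compat; apply pow2_ge_0.
Qed.

(** Both squares expand with the same cross term, since [r * / r = 1]; only the squared moduli
    differ. *)
Lemma Cmod_reflect_sqr (x t : C) (r : R) : r <> 0 ->
  Cmod (RtoC r * x - RtoC (/ r) * t) ^ 2
  = Cmod (x - t) ^ 2 + (r ^ 2 - 1) * (Cmod x ^ 2 - / r ^ 2 * Cmod t ^ 2).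
Proof.
  intros hr. rewrite !Cmod_sqr. destruct x as [x1 x2], t as [t1 t2]. simpl. field. auto.
Qed.

(** Comparison of the two factors on [|z| = r] in terms of coefficients, through the Parseval sums:
    the corrections from [Cmod_reflect_sqr] telescope and only the last one survives. *)
Lemma rsum_reflect (s : C) (c : nat -> C) (r : R) (N : nat) : Cmod s = 1 -> r <> 0 ->
  rsum (fun k => r ^ (2 * k) * Cmod (conv (lin (RtoC r) (- (RtoC (/ r) * s))%C) c k) ^ 2) (S N)
  = rsum (fun k => r ^ (2 * k) * Cmod (conv (lin (RtoC 1) (- s)%C) c k) ^ 2) (S N)
    + (r ^ 2 - 1) * (r ^ (2 * N) * Cmod (c N) ^ 2).
Proof.
  intros hs hr. induction N.
  - simpl. rewrite !Cmod_mult, Cmod_R, Cmod_1.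
    replace (Rabs r * Cmod (c 0%nat) * (Rabs r * Cmod (c 0%nat) * 1)) with
      ((Rabs r) ^ 2 * Cmod (c 0%nat) ^ 2) by ring.
    rewrite pow2_abs. ring.
  - change (rsum ?u (S (S N))) with (rsum u (S N) + u (S N)). rewrite IHN. cbv beta.
    rewrite !conv_lin_S.
    replace (RtoC r * c (S N) + - (RtoC (/ r) * s) * c N)%C
      with (RtoC r * c (S N) - RtoC (/ r) * (s * c N))%C by ring.
    replace (1 * c (S N) + - s * c N)%C with (c (S N) - s * c N)%C by ring.
    rewrite Cmod_reflect_sqr, (Cmod_mult s), hs by auto.
    replace (2 * S N)%nat with (2 * N + 2)%nat by lia. rewrite pow_add. field. auto.
Qed.

Lemma le_of_geom_error (a b K x : R) : 0 <= x < 1 -> (forall n, a <= b + K * x ^ n) -> a <= b.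
Proof.
  intros hx h. apply (le_epsilon_geom a b (Rabs K) x 1 hx). intros n hn. specialize (h n).
  pose proof (pow_le x n (proj1 hx)). pose proof (Rle_abs K). pose proof (Rabs_pos K).
  assert (0 < / INR n) by (apply Rinv_0_lt_compat, lt_0_INR; lia). nra.
Qed.

(* Jensen's inequality for zeros on the unit circle: on [|z| = r] the factors
   [1 - s z] and [r - s z / r] have the same modulus, and the latter is [r] at [0]. *)
Lemma lin_prod_length_bound (L : list C) (c : nat -> C) (x r M : R) :
  (forall s, In s L -> Cmod s = 1) -> 0 < x -> 1 < r -> r * x < 1 -> geo x c ->
  (forall N, rsum (fun k => r ^ (2 * k) * Cmod (conv (lin_prod L) c k) ^ 2) N <= M) ->
  r ^ (2 * length L) * Cmod (c 0%nat) ^ 2 <= M.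
Proof.
  intros hL hx hr hrx.
  assert (hrx0 : 0 < r * x) by (apply Rmult_lt_0_compat; lra).
  assert (hq : 0 <= (r * x) ^ 2 < 1) by nra.
  revert c. induction L as [|s L IH]; intros c hc hM.
  - specialize (hM 1%nat). simpl lin_prod in hM. simpl in hM. rewrite Cmult_1_l in hM. simpl. lra.
  - assert (hs : Cmod s = 1) by (apply hL; simpl; auto).
    (* The factor [1 - s z] is traded for [r - s z / r], which is absorbed into [c] and multiplies
       its constant coefficient by [r]. *)
    replace (r ^ (2 * length (s :: L)) * Cmod (c 0%nat) ^ 2)
      with (r ^ (2 * length L) * Cmod (conv (lin (RtoC r) (- (RtoC (/ r) * s))%C) c 0%nat) ^ 2).
    + apply IH.
      * intros t ht. apply hL. simpl. auto.
      * now apply geo_conv_lin.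
      * intros N. set (m := conv (lin_prod L) c).
        assert (hm : geo x m) by now apply geo_conv_lin_prod. destruct hm as [K [hK hm]].
        rewrite (rsum_ext _ (fun k => r ^ (2 * k) * Cmod (conv (lin (RtoC r) (- (RtoC (/ r) * s))%C) m k) ^ 2)).
        2:{ intros k _. unfold m. rewrite <- !conv_assoc. do 3 f_equal. apply conv_ext; auto.
            intros. apply conv_comm. }
        (* Enlarging the range to [N + n] makes the boundary term of [rsum_reflect] arbitrarily
           small, as [r * x < 1]. *)
        apply (le_of_geom_error _ _ ((r ^ 2 - 1) * K ^ 2) ((r * x) ^ 2)); auto. intros n.
        apply Rle_trans with (rsum (fun k => r ^ (2 * k) *
           Cmod (conv (lin (RtoC r) (- (RtoC (/ r) * s))%C) m k) ^ 2) (S (N + n))).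
        { apply rsum_mono; [|lia]. intros k. apply Rmult_le_pos; [apply pow_le; lra|apply pow2_ge_0]. }
        rewrite rsum_reflect by (auto; lra).
        apply Rplus_le_compat.
        { eapply Rle_trans; [|apply (hM (S (N + n)))]. right. apply rsum_ext. intros k _.
          simpl lin_prod. now rewrite conv_assoc. }
        rewrite Rmult_assoc. apply Rmult_le_compat_l; [nra|].
        apply Rle_trans with (r ^ (2 * (N + n)) * (K * x ^ (N + n)) ^ 2).
        { apply Rmult_le_compat_l; [apply pow_le; lra|]. apply pow_incr.
          split; [apply Cmod_ge_0|apply hm]. }
        rewrite Rpow_mult_distr, <- !pow_mult, (Nat.mul_comm _ 2), <- Rmult_assoc, (Rmult_comm _ (K ^ 2)), Rmult_assoc.
        apply Rmult_le_compat_l; [apply pow2_ge_0|].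
        rewrite <- Rpow_mult_distr, !pow_mult, pow_add.
        assert (h1 : 0 <= (r * x) ^ 2 <= 1) by lra.
        pose proof (pow_le _ n (proj1 h1)).
        pose proof (pow_incr ((r * x) ^ 2) 1 N ltac:(lra)) as h2. rewrite pow1 in h2. nra.
    + simpl length. replace (2 * S (length L))%nat with (2 * length L + 2)%nat by lia.
      rewrite pow_add. simpl conv. rewrite Cmod_mult, Cmod_R, Rabs_pos_eq by lra.
      simpl lin. ring.
Qed.

(** The quotient has the partial sums at [zeta], rescaled, as coefficients. The full sum vanishes,
    so each partial sum is minus a tail and the ratio [x] is kept. *)
Lemma divide_zero (c : nat -> C) (x : R) (zeta : C) :
  0 < x < 1 -> geo x c -> Cmod zeta = 1 -> psum c zeta = RtoC 0 ->
  exists c', geo x c' /\ forall k, c k = conv (lin (RtoC 1) (- / zeta)%C) c' k.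
Proof.
  intros hx hc hz h0.
  assert (hnz : zeta <> RtoC 0) by (apply Cmod_gt_0; lra).
  assert (hs := psum_correct x c zeta ltac:(lra) hc ltac:(rewrite hz; lra)). rewrite h0 in hs.
  destruct hc as [K [hK hc]].
  exists (fun k => (/ zeta) ^ k * csum (fun j => c j * zeta ^ j) (S k))%C. split.
  - exists (K / (1 - x)). split; [apply Rdiv_lt_0_compat; lra|]. intros k.
    rewrite Cmod_mult, Cmod_pow, Cmod_inv, hz, Rinv_1, pow1, Rmult_1_l by auto.
    assert (hterm : forall j, (S k <= j)%nat -> Cmod (c j * zeta ^ j) <= K * x ^ j).
    { intros j _. eapply Rle_trans; [now apply (geo_term_le x K)|]. rewrite hz, Rmult_1_r. lra. }
    assert (h := is_cseries_geom_tail _ _ K x (S k) ltac:(lra) ltac:(lra) hterm hs).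
    replace (0 - csum (fun j => c j * zeta ^ j)%C (S k))%C
      with (- csum (fun j => c j * zeta ^ j)%C (S k))%C in h by ring.
    rewrite Cmod_opp in h. eapply Rle_trans; [apply h|].
    simpl. unfold Rdiv. rewrite !(Rmult_assoc K). apply Rmult_le_compat_l; [lra|].
    rewrite (Rmult_comm (/ (1 - x))). apply Rmult_le_compat_r; [left; apply Rinv_0_lt_compat; lra|].
    pose proof (pow_lt x k (proj1 hx)). nra.
  - intros [|k]; [simpl; ring|]. rewrite conv_lin_S.
    change (csum ?u (S (S k))) with (csum u (S k) + u (S k))%C. cbv beta.
    set (T := csum (fun j => c j * zeta ^ j)%C (S k)).
    rewrite !Cpow_S, Cpow_inv_l by auto. field. split; auto. now apply Cpow_nz.
Qed.

(** If zeros could be divided out forever, there would be factorisations of every length [T] with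
    the same constant coefficient, against [lin_prod_length_bound], which caps [r^(2 T)]. *)
Theorem factor_circle_zeros (b : nat -> C) (x : R) :
  0 < x < 1 -> geo x b -> b 0%nat <> RtoC 0 ->
  exists L kap, (forall s, In s L -> Cmod s = 1) /\ geo x kap /\
    (forall k, b k = conv (lin_prod L) kap k) /\
    forall zeta, Cmod zeta = 1 -> psum kap zeta <> RtoC 0.
Proof.
  intros hx hb hb0. apply NNPP. intros hno.
  assert (hall : forall T, exists L kap, length L = T /\ (forall s, In s L -> Cmod s = 1) /\
     geo x kap /\ (forall k, b k = conv (lin_prod L) kap k) /\ kap 0%nat = b 0%nat).
  { induction T as [|T [L [kap [hT [hL [hk [hbk h0]]]]]]].
    - exists nil, b. split; auto. split; [intros s []|]. split; auto. split; auto.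
      intros k. simpl. now rewrite conv_one_l.
    - destruct (classic (exists zeta, Cmod zeta = 1 /\ psum kap zeta = RtoC 0)) as [[z [hz hzk]]|hn].
      + destruct (divide_zero kap x z hx hk hz hzk) as [c' [hc' he]].
        assert (hnz : z <> RtoC 0) by (apply Cmod_gt_0; lra).
        exists ((/ z)%C :: L), c'. split; [simpl; auto|]. split.
        * intros s [<-|hs]; auto. rewrite Cmod_inv, hz by auto. apply Rinv_1.
        * split; auto. split.
          -- intros k. rewrite hbk. simpl lin_prod.
             rewrite (conv_ext _ _ _ _ k (fun _ _ => eq_refl) (fun j _ => he j)), <- conv_assoc.
             apply conv_ext; auto. intros. apply conv_comm.
          -- rewrite <- h0, he. simpl. ring.
      + exfalso. apply hno. exists L, kap. repeat split; auto. intros z hz hzk.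
        apply hn. eauto. }
  (* Midway between [1] and [/ x], so that [r > 1] while [r * x < 1]. *)
  set (r := (1 + / x) / 2).
  assert (hix := Rinv_gt_1 x hx).
  assert (hr : 1 < r) by (unfold r; lra).
  assert (hrx : r * x < 1).
  { unfold r. replace ((1 + / x) / 2 * x) with ((x + 1) / 2) by (field; lra). lra. }
  pose proof hb as [K [hK hbK]].
  set (M := K ^ 2 * / (1 - (r * x) ^ 2)).
  assert (hrx0 : 0 < r * x) by (apply Rmult_lt_0_compat; lra).
  assert (hq : 0 <= (r * x) ^ 2 < 1) by nra.
  assert (hM : forall N, rsum (fun k => r ^ (2 * k) * Cmod (b k) ^ 2) N <= M).
  { intros N. apply Rle_trans with (rsum (fun k => K ^ 2 * ((r * x) ^ 2) ^ k) N).
    - apply rsum_le. intros k _. rewrite <- pow_mult, Rpow_mult_distr.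
      apply Rle_trans with (r ^ (2 * k) * (K * x ^ k) ^ 2).
      + apply Rmult_le_compat_l; [apply pow_le; lra|]. apply pow_incr. split; [apply Cmod_ge_0|auto].
      + right. rewrite Rpow_mult_distr, <- pow_mult, (Nat.mul_comm k 2). ring.
    - rewrite rsum_scal. apply Rmult_le_compat_l; [apply pow2_ge_0|]. now apply rsum_geom_le. }
  apply Cmod_gt_0 in hb0. set (m := Cmod (b 0%nat) ^ 2).
  assert (hm : 0 < m) by (now apply pow_lt).
  destruct (Pow_x_infinity r ltac:(rewrite Rabs_pos_eq; lra) (M / m + 1)) as [T hT].
  specialize (hT T (le_n T)).
  rewrite Rabs_pos_eq in hT by (apply pow_le; lra).
  destruct (hall T) as [L [kap [hlen [hL [hk [hbk h0]]]]]].
  pose proof (lin_prod_length_bound L kap x r M hL ltac:(lra) hr hrx hk) as hbound.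
  assert (hle : r ^ (2 * T) * m <= M).
  { unfold m. rewrite <- hlen, <- h0. apply hbound. intros N. eapply Rle_trans; [|apply (hM N)].
    right. apply rsum_ext. intros k _. now rewrite hbk. }
  assert (r ^ T <= r ^ (2 * T)) by (apply Rle_pow; [lra|lia]).
  assert (hMm : (M / m + 1) * m <= M) by (eapply Rle_trans; [|apply hle]; apply Rmult_le_compat_r; lra).
  replace ((M / m + 1) * m) with (M + m) in hMm by (field; lra). lra.
Qed.

Lemma lq_psum (c : nat -> C) (x : R) (w : C) : 0 < x -> geo x c -> x * Cmod w < 1 -> lq (psum c) w.
Proof.
  intros hx hc hw. apply (lq_power_series c (psum c) (RtoC 0) w (/ x)).
  - intros z hz. replace (z - 0)%C with z in * by ring. apply (psum_correct x); auto; [lra|].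
    apply (Rmult_lt_reg_l (/ x)); [now apply Rinv_0_lt_compat|].
    rewrite <- Rmult_assoc, Rinv_l; lra.
  - replace (w - 0)%C with w by ring. apply (Rmult_lt_reg_l x); auto. rewrite Rinv_r; lra.
Qed.

Lemma zero_free_neighbourhood (c : nat -> C) (x : R) :
  0 < x < 1 -> geo x c -> (forall z, Cmod z <= 1 -> psum c z <> RtoC 0) ->
  exists R0, 1 < R0 /\ x * R0 <= 1 /\ forall z, Cmod z < R0 -> psum c z <> RtoC 0.
Proof.
  intros hx hc hnz.
  (* [3 * e] rather than [2 * e]: a point outside the unit disk is first projected to the circle, at
     distance less than [d <= e]. *)
  destruct (compact_annulus 0 1 (fun w e => forall z, Cmod (z - w) < 3 * e -> psum c z <> RtoC 0))
    as [d [hd h]].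
  - intros w hw. specialize (hnz w ltac:(lra)). apply Cmod_gt_0 in hnz.
    destruct (lq_lipschitz (psum c) w) as [d [M [hd [hM hl]]]].
    { apply (lq_psum c x); auto; [lra|].  nra. }
    set (e := Rmin d (Cmod (psum c w) / M) / 3).
    assert (h1 := Rmin_l d (Cmod (psum c w) / M)). assert (h2 := Rmin_r d (Cmod (psum c w) / M)).
    assert (hp : 0 < Rmin d (Cmod (psum c w) / M)) by (apply Rmin_glb_lt; auto; now apply Rdiv_lt_0_compat).
    exists e. split; [unfold e; lra|]. intros z hz e0. unfold e in hz.
    specialize (hl z ltac:(lra)). rewrite e0 in hl.
    replace (0 - psum c w)%C with (- psum c w)%C in hl by ring. rewrite Cmod_opp in hl.
    assert (M * Cmod (z - w) < M * (Cmod (psum c w) / M)) by (apply Rmult_lt_compat_l; lra).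
    replace (M * (Cmod (psum c w) / M)) with (Cmod (psum c w)) in * by (field; lra). lra.
  - assert (hix := Rinv_gt_1 x hx).
    exists (Rmin (1 + d) (/ x)).
    split; [apply Rmin_glb_lt; lra|]. split.
    { apply (Rmult_le_reg_l (/ x)); [lra|]. rewrite <- Rmult_assoc, Rinv_l, Rmult_1_l, Rmult_1_r by lra.
      apply Rmin_r. }
    intros z hz. assert (h1 := Rmin_l (1 + d) (/ x)).
    destruct (Rle_dec (Cmod z) 1) as [hz1|hz1]; [now apply hnz|]. apply Rnot_le_lt in hz1.
    set (u := (z / RtoC (Cmod z))%C).
    assert (hznz : RtoC (Cmod z) <> RtoC 0) by (intros e; apply RtoC_inj in e; lra).
    assert (hu : Cmod u = 1).
    { unfold u. rewrite Cmod_div, Cmod_R, Rabs_pos_eq by (auto; apply Cmod_ge_0). field. lra. }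
    assert (hzu : Cmod (z - u) < d).
    { replace (z - u)%C with (u * RtoC (Cmod z - 1))%C.
      - rewrite Cmod_mult, hu, Cmod_R, Rabs_pos_eq; lra.
      - unfold u. rewrite RtoC_minus. field. auto. }
    destruct (h u ltac:(lra)) as [w [e [hde [hw hq]]]]. apply hq.
    replace (z - w)%C with ((z - u) + (u - w))%C by ring.
    eapply Rle_lt_trans; [apply Cmod_triangle|]. lra.
Qed.

Theorem zero_factorization (b : nat -> C) (x : R) :
  0 < x < 1 -> geo x b -> (forall z, Cmod z < 1 -> psum b z <> RtoC 0) ->
  exists L kap d y, (forall s, In s L -> Cmod s = 1) /\ 0 < y < 1 /\ geo y kap /\ geo y d /\
    (forall k, conv d kap k = one_seq k) /\ (forall k, b k = conv (lin_prod L) kap k).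
Proof.
  intros hx hb hnz.
  assert (hb0 : b 0%nat <> RtoC 0) by (rewrite <- psum_at_0; apply hnz; rewrite Cmod_0; lra).
  destruct (factor_circle_zeros b x hx hb hb0) as [L [kap [hL [hk [hbk hzk]]]]].
  assert (hkz : forall z, Cmod z <= 1 -> psum kap z <> RtoC 0).
  { intros z hz. destruct (Rle_lt_or_eq_dec _ _ hz) as [hlt|heq]; [|now apply hzk].
    intros e. apply (hnz z hlt). apply psum_unique.
    apply (is_cseries_ext (fun k => conv (lin_prod L) kap k * z ^ k)%C); [intros; now rewrite hbk|].
    replace (RtoC 0) with (psum (lin_prod L) z * psum kap z)%C by (rewrite e; ring).
    apply (psum_conv _ _ x); auto; [lra|apply geo_lin_prod; lra|].
     nra. }
  destruct (zero_free_neighbourhood kap x hx hk hkz) as [R0 [hR0 [hxR hfree]]].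
  destruct (formal_inverse kap) as [d hd].
  { rewrite <- psum_at_0. apply hkz. rewrite Cmod_0. lra. }
  set (r1 := (1 + R0) / 2). assert (hr1 : 1 < r1 < R0) by (unfold r1; lra).
  assert (hi := Rinv_lt_1 r1 ltac:(lra)).
  assert (hgd : geo (/ r1) d).
  { apply (geo_inverse (psum kap) kap d 1 R0); auto; try lra.
    - intros w hw. split; [|now apply hfree]. apply (lq_psum kap x); auto; [lra|].
       nra.
    - intros z hz. apply (psum_correct x); auto; [lra|].  nra. }
  exists L, kap, d, (Rmax x (/ r1)).
  assert (h1 := Rmax_l x (/ r1)). assert (h2 := Rmax_r x (/ r1)).
  assert (h3 : Rmax x (/ r1) < 1) by (apply Rmax_lub_lt; lra).
  repeat split; auto; try lra.
  - apply (geo_weaken x); auto; lra.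
  - apply (geo_weaken (/ r1)); auto; lra.
Qed.

(** The reciprocal is analytic only in the open unit disk, because of the zeros on the circle, so
    [sigma] can approach [1] and no decay is available. *)
Lemma inverse_subexponential (b d : nat -> C) (x sigma : R) :
  0 < x < 1 -> geo x b -> (forall z, Cmod z < 1 -> psum b z <> RtoC 0) ->
  (forall k, conv d b k = one_seq k) -> 1 < sigma -> geo sigma d.
Proof.
  intros hx hb hnz hd hs.
  rewrite <- (Rinv_inv sigma).
  assert (hi := Rinv_lt_1 sigma hs).
  apply (geo_inverse (psum b) b d 1 1); auto; try lra.
  - intros w hw. split; [|now apply hnz]. apply (lq_psum b x); auto; [lra|].
     nra.
  - intros z hz. apply (psum_correct x); auto; [lra|].  nra.
Qed.

(** * Distances in weighted Hardy spaces *)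

Definition wt (beta : R) (k : nat) : R := Rpower (INR (S k)) beta.

(** By Cauchy-Schwarz, [/ Phi beta m] is the least value of the sum of [wt beta k * |h_k|^2] over
    [k < m] when the [h_k] add up to [1]. *)
Definition Phi (beta : R) (m : nat) : R := rsum (fun j => / wt beta j) m.

Lemma INR_S_ge_1 (k : nat) : 1 <= INR (S k).
Proof. rewrite S_INR. pose proof (pos_INR k). lra. Qed.

Lemma wt_pos (beta : R) (k : nat) : 0 < wt beta k.
Proof. apply exp_pos. Qed.

Lemma wt_inv_pos (beta : R) (k : nat) : 0 < / wt beta k.
Proof. apply Rinv_0_lt_compat, wt_pos. Qed.

Lemma wt_0 (beta : R) : wt beta 0 = 1.
Proof. unfold wt, Rpower. simpl. rewrite ln_1, Rmult_0_r, exp_0. reflexivity. Qed.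

Lemma wt_mono (beta : R) (j k : nat) : 0 <= beta -> (j <= k)%nat -> wt beta j <= wt beta k.
Proof.
  intros hb hjk. apply Rle_Rpower_l; auto. split; [pose proof (INR_S_ge_1 j); lra|].
  apply le_INR. lia.
Qed.

Lemma wt_ge_1 (beta : R) (k : nat) : 0 <= beta -> 1 <= wt beta k.
Proof. intros hb. rewrite <- (wt_0 beta). apply wt_mono; auto. lia. Qed.

Lemma wt_le_S (beta : R) (k : nat) : beta <= 1 -> wt beta k <= INR k + 1.
Proof.
  intros hb. rewrite <- S_INR. pose proof (INR_S_ge_1 k).
  rewrite <- (Rpower_1 (INR (S k))) by lra. apply Rle_Rpower; auto.
Qed.

(** The doubling property that keeps bounds by [/ wt beta k] stable under convolution. *)
Lemma wt_half (beta : R) (j k : nat) : 0 <= beta <= 1 -> (k <= 2 * j)%nat -> wt beta k <= 2 * wt beta j.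
Proof.
  intros hb hk. apply Rle_trans with (Rpower (2 * INR (S j)) beta).
  - apply Rle_Rpower_l; [lra|]. split; [pose proof (INR_S_ge_1 k); lra|].
    rewrite <- INR_double. apply le_INR. lia.
  - rewrite <- Rpower_mult_distr by (try lra; pose proof (INR_S_ge_1 j); lra).
    apply Rmult_le_compat_r; [left; apply exp_pos|].
    apply Rle_trans with (Rpower 2 1); [apply Rle_Rpower; lra|rewrite Rpower_1; lra].
Qed.

Lemma Phi_mono (beta : R) (m m' : nat) : (m <= m')%nat -> Phi beta m <= Phi beta m'.
Proof. intros h. apply rsum_mono; auto. intros k. left. apply wt_inv_pos. Qed.

Lemma Phi_ge_1 (beta : R) (m : nat) : 1 <= Phi beta (S m).
Proof.
  apply Rle_trans with (Phi beta 1); [|apply Phi_mono; lia].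
  unfold Phi. simpl. rewrite wt_0, Rinv_1. lra.
Qed.

Lemma Phi_le (beta : R) (m : nat) : 0 <= beta -> Phi beta m <= INR m.
Proof.
  intros hb. rewrite <- (Rmult_1_r (INR m)), <- rsum_const. apply rsum_le. intros k _.
  rewrite <- Rinv_1. apply Rinv_le_contravar; [lra|]. now apply wt_ge_1.
Qed.

(** The weights increase, so each later block of [m] terms is at most the first. Changing the degree
    by a constant factor therefore costs only a constant. *)
Lemma Phi_mul (beta : R) (K m : nat) : 0 <= beta -> Phi beta (K * m) <= INR K * Phi beta m.
Proof.
  intros hb. induction K; [simpl; rewrite Rmult_0_l; unfold Phi; simpl; lra|].
  rewrite S_INR, Rmult_plus_distr_r, Rmult_1_l. simpl (S K * m)%nat. rewrite Nat.add_comm.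
  unfold Phi at 1. rewrite rsum_app. apply Rplus_le_compat; [exact IHK|].
  apply rsum_le. intros k _. apply Rinv_le_contravar; [apply wt_pos|]. apply wt_mono; auto. lia.
Qed.

Lemma rsum_support (u : nat -> R) (m N : nat) :
  (forall k, 0 <= u k) -> (forall k, (m <= k)%nat -> u k = 0) -> rsum u N <= rsum u m.
Proof.
  intros h0 hz. destruct (Nat.le_ge_cases N m); [now apply rsum_mono|].
  replace N with (m + (N - m))%nat by lia. rewrite rsum_app.
  rewrite (rsum_ext (fun k => u (m + k)%nat) (fun _ => 0)) by (intros; apply hz; lia).
  rewrite rsum_const0. lra.
Qed.

Lemma conv_support (a b : nat -> C) (A B : nat) :
  (forall k, (A < k)%nat -> a k = RtoC 0) -> (forall k, (B < k)%nat -> b k = RtoC 0) ->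
  forall k, (A + B < k)%nat -> conv a b k = RtoC 0.
Proof.
  intros ha hb k hk. rewrite conv_csum. apply csum_zero. intros i hi.
  destruct (Nat.lt_ge_cases A i); [rewrite ha by auto; ring|].
  rewrite hb by lia. ring.
Qed.

(** The minimiser of the extremal problem behind [Phi]. *)
Definition bump (beta : R) (n k : nat) : R :=
  if le_dec k n then / wt beta k / Phi beta (S n) else 0.

Lemma bump_nonneg (beta : R) (n k : nat) : 0 <= bump beta n k.
Proof.
  unfold bump. destruct (le_dec k n); [|lra]. pose proof (wt_inv_pos beta k).
  pose proof (Phi_ge_1 beta n). apply Rdiv_le_0_compat; lra.
Qed.

Lemma bump_le (beta : R) (n k : nat) : bump beta n k <= / wt beta k / Phi beta (S n).
Proof.
  unfold bump. destruct (le_dec k n); [lra|]. pose proof (wt_inv_pos beta k).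
  pose proof (Phi_ge_1 beta n). apply Rdiv_le_0_compat; lra.
Qed.

Lemma bump_total (beta : R) (n : nat) : rsum (bump beta n) (S n) = 1.
Proof.
  pose proof (Phi_ge_1 beta n).
  rewrite (rsum_ext _ (fun k => / Phi beta (S n) * / wt beta k)).
  - rewrite rsum_scal. fold (Phi beta (S n)). apply Rinv_l. lra.
  - intros k hk. unfold bump. destruct (le_dec k n); [|lia]. unfold Rdiv. ring.
Qed.

Lemma bump_sum_le (beta : R) (n N : nat) : rsum (bump beta n) N <= 1.
Proof.
  rewrite <- (bump_total beta n). apply rsum_support; [apply bump_nonneg|].
  intros k hk. unfold bump. destruct (le_dec k n); [lia|auto].
Qed.

Lemma bump_sum_full (beta : R) (n k : nat) : (n <= k)%nat -> rsum (bump beta n) (S k) = 1.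
Proof.
  intros h. apply Rle_antisym; [apply bump_sum_le|].
  rewrite <- (bump_total beta n). apply rsum_mono; [apply bump_nonneg|lia].
Qed.

Lemma l1_bound (beta : R) (e : nat -> C) (K : R) (T n N : nat) : 0 <= beta -> 0 <= K ->
  (forall k, Cmod (e k) <= K * (/ wt beta k / Phi beta (S n))) ->
  (forall k, (T * n < k)%nat -> e k = RtoC 0) ->
  rsum (fun k => Cmod (e k)) N <= K * (INR T + 1).
Proof.
  intros hbeta hK he hs. pose proof (Phi_ge_1 beta n) as hP.
  apply Rle_trans with (rsum (fun k => Cmod (e k)) (S (T * n))).
  { apply rsum_support; [intros; apply Cmod_ge_0|]. intros k hk. rewrite hs by lia. apply Cmod_0. }
  apply Rle_trans with (rsum (fun k => K * / Phi beta (S n) * / wt beta k) (S (T * n))).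
  { apply rsum_le. intros k _. eapply Rle_trans; [apply he|]. right. unfold Rdiv. ring. }
  rewrite rsum_scal. fold (Phi beta (S (T * n))).
  assert (h : Phi beta (S (T * n)) <= (INR T + 1) * Phi beta (S n)).
  { rewrite <- S_INR. eapply Rle_trans; [|now apply Phi_mul]. apply Phi_mono. lia. }
  apply Rle_trans with (K * / Phi beta (S n) * ((INR T + 1) * Phi beta (S n))).
  - apply Rmult_le_compat_l; auto. apply Rmult_le_pos; auto. left. apply Rinv_0_lt_compat. lra.
  - right. field. lra.
Qed.

(* One factor [1 - s z] is inverted up to the error [- u (s z)], where [u] has
   nonnegative coefficients proportional to [/ wt beta k] with total mass [1].
   Errors dominated by a multiple of [u] are stable under convolution. *)
Lemma lin_prod_approx (beta : R) (L : list C) : 0 <= beta <= 1 -> (forall s, In s L -> Cmod s = 1) ->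
  exists K, 0 < K /\ forall n, exists q e,
    (forall k, (length L * n < k)%nat -> q k = RtoC 0) /\
    (forall k, (length L * n < k)%nat -> e k = RtoC 0) /\
    (forall k, conv q (lin_prod L) k = (one_seq k + e k)%C) /\
    (forall k, Cmod (e k) <= K * (/ wt beta k / Phi beta (S n))).
Proof.
  intros hbeta. induction L as [|s L IH]; intros hL.
  - exists 1. split; [lra|]. intros n. exists one_seq, (fun _ => RtoC 0). simpl.
    split; [intros [|k] hk; [lia|auto]|]. split; auto. split.
    + intros k. rewrite conv_one_l. ring.
    + intros k. rewrite Cmod_0. pose proof (wt_inv_pos beta k). pose proof (Phi_ge_1 beta n).
      apply Rmult_le_pos; [lra|]. apply Rdiv_le_0_compat; lra.
  - destruct IH as [K [hK IH]]; [intros; apply hL; simpl; auto|].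
    assert (hs : Cmod s = 1) by (apply hL; simpl; auto).
    set (T := length L) in *. pose proof (pos_INR T) as hT.
    (* The contributions of [e], of [us], and of the two halves of [conv e us]. *)
    exists (K + 1 + 2 * K + 2 * (K * (INR T + 1))). split; [nra|]. intros n.
    destruct (IH n) as [q [e [hq [he [hqe hbnd]]]]].
    set (us := fun k => (RtoC (bump beta n k) * s ^ k)%C).
    (* The quotient of [1 - u (s z)] by [1 - s z]. It is a polynomial because the coefficients of
       [u] have total mass [1]. *)
    set (v := fun k => (RtoC (1 - rsum (bump beta n) (S k)) * s ^ k)%C).
    assert (hv : forall k, conv v (lin (RtoC 1) (- s)%C) k = (one_seq k - us k)%C).
    { intros k. rewrite conv_comm. destruct k.
      - simpl. unfold v, us. simpl. rewrite RtoC_minus, Rplus_0_l. ring.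
      - rewrite conv_lin_S. unfold v, us. simpl one_seq.
        change (rsum (bump beta n) (S (S k))) with (rsum (bump beta n) (S k) + bump beta n (S k)).
        rewrite !RtoC_minus, RtoC_plus. simpl. ring. }
    assert (husC : forall k, Cmod (us k) = bump beta n k).
    { intros k. unfold us. rewrite Cmod_mult, Cmod_pow, hs, pow1, Rmult_1_r, Cmod_R.
      apply Rabs_pos_eq, bump_nonneg. }
    assert (hus : forall k, (n < k)%nat -> us k = RtoC 0).
    { intros k hk. unfold us, bump. destruct (le_dec k n); [lia|ring]. }
    (* The new error is [(1 + e) (1 - us) - 1]. *)
    exists (conv q v), (fun k => (e k - us k - conv e us k)%C).
    assert (hlen : length (s :: L) = S T) by reflexivity. rewrite hlen.
    split; [|split; [|split]].
    + intros k hk. apply (conv_support q v (T * n) n); auto; [|lia].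
      intros j hj. unfold v. rewrite bump_sum_full by lia.
      replace (1 - 1) with 0 by ring. ring.
    + intros k hk. rewrite he, hus by lia. rewrite (conv_support e us (T * n) n); auto; [ring|lia].
    + intros k. simpl lin_prod. rewrite conv_assoc.
      rewrite (conv_ext q q _ (conv (fun j => one_seq j - us j)%C (lin_prod L))); auto.
      2:{ intros j _. rewrite <- conv_assoc. apply conv_ext; auto. }
      rewrite (conv_ext q q _ (conv (lin_prod L) (fun j => one_seq j - us j)%C)) by (auto using conv_comm).
      rewrite <- conv_assoc.
      rewrite (conv_ext _ (fun j => one_seq j + e j)%C _ (fun j => one_seq j + (- (1)) * us j)%C).
      * rewrite conv_add_l, conv_one_l, conv_add_r, conv_one_r.
        rewrite (conv_comm e (fun k => - (1) * us k)%C), conv_scal_l, (conv_comm us). ring.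
      * auto.
      * intros. ring.
    + intros k. pose proof (Phi_ge_1 beta n) as hP. set (F := Phi beta (S n)) in *.
      set (W := / wt beta k / F).
      assert (hW : 0 < W).
      { unfold W. apply Rdiv_lt_0_compat; [apply wt_inv_pos|lra]. }
      assert (hconv : Cmod (conv e us k) <= 2 * K * W + 2 * (K * (INR T + 1)) * W).
      { eapply Rle_trans; [apply (Cmod_conv_le e us (fun i => Cmod (e i)) (bump beta n)); intros; [lra|rewrite husC; lra]|].
        apply Rle_trans with (rsum (fun i => (2 * K * W) * bump beta n (S k - S i)%nat + (2 * W) * Cmod (e i)) (S k)).
        - apply rsum_le. intros i hi. simpl (S k - S i)%nat.
          pose proof (bump_nonneg beta n (k - i)) as hbn. pose proof (Cmod_ge_0 (e i)) as hen.
          (* One of [i] and [k - i] is at least [k / 2]; that factor is bounded pointwise by a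
             multiple of [W], and the other one is summed. *)
          assert (hhalf : forall j, (k <= 2 * j)%nat -> / wt beta j / F <= 2 * W).
          { intros j hj. unfold W, Rdiv. rewrite <- Rmult_assoc.
            apply Rmult_le_compat_r; [left; apply Rinv_0_lt_compat; lra|].
            pose proof (wt_pos beta k). pose proof (wt_pos beta j).
            pose proof (wt_half beta j k hbeta hj) as hw.
            apply (Rmult_le_reg_l (wt beta j)); auto. rewrite Rinv_r by lra.
            apply (Rmult_le_reg_r (wt beta k)); auto.
            replace (wt beta j * (2 * / wt beta k) * wt beta k) with (2 * wt beta j) by (field; lra). lra. }
          destruct (Nat.le_ge_cases k (2 * i)) as [hki|hki].
          + assert (h1 : Cmod (e i) <= 2 * K * W).
            { eapply Rle_trans; [apply hbnd|]. pose proof (hhalf i hki). fold F. nra. }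
            assert (Cmod (e i) * bump beta n (k - i) <= 2 * K * W * bump beta n (k - i)) by (apply Rmult_le_compat_r; auto).
            assert (0 <= 2 * W * Cmod (e i)) by (apply Rmult_le_pos; lra). lra.
          + assert (h1 : bump beta n (k - i) <= 2 * W).
            { eapply Rle_trans; [apply bump_le|]. apply hhalf. lia. }
            assert (Cmod (e i) * bump beta n (k - i) <= Cmod (e i) * (2 * W)) by (apply Rmult_le_compat_l; auto).
            assert (0 <= 2 * K * W * bump beta n (k - i)) by (apply Rmult_le_pos; auto; nra). lra.
        - rewrite rsum_add, !rsum_scal, rsum_rev.
          pose proof (bump_sum_le beta n (S k)) as h1.
          pose proof (l1_bound beta e K T n (S k) ltac:(lra) ltac:(lra) hbnd he) as h2.
          assert (2 * K * W * rsum (bump beta n) (S k) <= 2 * K * W * 1) by (apply Rmult_le_compat_l; auto; nra).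
          assert (2 * W * rsum (fun k => Cmod (e k)) (S k) <= 2 * W * (K * (INR T + 1)))
            by (apply Rmult_le_compat_l; auto; lra). lra. }
      eapply Rle_trans; [apply Cmod_sub_le|].
      pose proof (Cmod_sub_le (e k) (us k)) as h1. rewrite husC in h1.
      pose proof (bump_le beta n k) as h2. pose proof (hbnd k) as h3. fold F W in h2, h3. lra.
Qed.

(** For [k > n] one can insert [(k + 1) / (n + 1) >= 1]. The order [/ INR (S n)] is enough, since
    [Phi beta (S n) <= INR (S n)]. *)
Lemma tail_weighted_geom (x : R) : 0 <= x < 1 ->
  exists M, 0 < M /\ forall n N, rsum (fun k => if le_dec k n then 0 else (INR k + 1) * x ^ k) N <= M / INR (S n).
Proof.
  intros hx. set (z := (x + 1) / 2). assert (hz : x < z < 1) by (unfold z; lra).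
  destruct (quad_mul_geom_le x z ltac:(lra)) as [M [hM h]].
  exists (M * / (1 - z)). split; [apply Rmult_lt_0_compat; auto; apply Rinv_0_lt_compat; lra|].
  intros n N. pose proof (INR_S_ge_1 n) as hn.
  apply Rle_trans with (rsum (fun k => M * / INR (S n) * z ^ k) N).
  - apply rsum_le. intros k _.
    apply (Rmult_le_reg_l (INR (S n))); [lra|].
    replace (INR (S n) * (M * / INR (S n) * z ^ k)) with (M * z ^ k) by (field; lra).
    eapply Rle_trans; [|apply h]. pose proof (pos_INR k). assert (0 <= x ^ k) by (apply pow_le; lra).
    destruct (le_dec k n) as [hk|hk].
    + rewrite Rmult_0_r. apply Rmult_le_pos; auto. apply pow2_ge_0.
    + replace ((INR k + 1) ^ 2 * x ^ k) with ((INR k + 1) * ((INR k + 1) * x ^ k)) by ring.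
      apply Rmult_le_compat_r; [apply Rmult_le_pos; lra|]. rewrite <- S_INR. apply le_INR. lia.
  - rewrite rsum_scal. replace (M * / (1 - z) / INR (S n)) with (M * / INR (S n) * / (1 - z))
      by (unfold Rdiv; ring).
    apply Rmult_le_compat_l; [|apply rsum_geom_le; lra].
    left. apply Rmult_lt_0_compat; auto. apply Rinv_0_lt_compat. lra.
Qed.

Definition trunc (m : nat) (d : nat -> C) (k : nat) : C := if le_dec k m then d k else RtoC 0.

(** The error is minus the product of [kap] with the discarded part of [d]: zero up to index [m],
    and of geometric decay with constants independent of [m]. *)
Lemma trunc_inverse_error (d kap : nat -> C) (y : R) :
  0 < y < 1 -> geo y d -> geo y kap -> (forall k, conv d kap k = one_seq k) ->
  exists z K, 0 < z < 1 /\ 0 < K /\ forall m k,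
    ((k <= m)%nat -> conv (trunc m d) kap k = one_seq k) /\
    Cmod (conv (trunc m d) kap k - one_seq k) <= K * z ^ k.
Proof.
  intros hy [D [hD hd]] [E [hE hk]] hinv. set (z := (y + 1) / 2).
  destruct (lin_mul_geom_le y z ltac:(unfold z; lra)) as [M [hM h]].
  exists z, (D * E * M). split; [unfold z; lra|].
  assert (hDE : 0 < D * E) by now apply Rmult_lt_0_compat.
  split; [now apply Rmult_lt_0_compat|]. intros m k. split.
  - intros hkm. rewrite <- hinv. apply conv_ext; auto. intros j hj. unfold trunc.
    destruct (le_dec j m); [auto|lia].
  - replace (conv (trunc m d) kap k - one_seq k)%C with
      (conv (fun j => trunc m d j + (- (1)) * d j)%C kap k)
      by (rewrite conv_add_l, conv_scal_l, hinv; ring).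
    eapply Rle_trans; [apply (conv_geo_le _ _ D E y k); auto; [lra|]|].
    + intros j. unfold trunc. destruct (le_dec j m).
      * replace (d j + - (1) * d j)%C with (RtoC 0) by ring. rewrite Cmod_0.
        apply Rmult_le_pos; [lra|apply pow_le; lra].
      * replace (0 + - (1) * d j)%C with (- d j)%C by ring. now rewrite Cmod_opp.
    + rewrite (Rmult_assoc (D * E)). apply Rmult_le_compat_l; [lra|apply h].
Qed.

Lemma Cmod_add_sqr_le (x y : C) : Cmod (x + y) ^ 2 <= 2 * Cmod x ^ 2 + 2 * Cmod y ^ 2.
Proof.
  pose proof (Cmod_triangle x y). pose proof (Cmod_ge_0 (x + y)).
  pose proof (pow2_ge_0 (Cmod x - Cmod y)). nra.
Qed.

Theorem approx_upper (beta K0 x : R) (w : nat -> R) (b : nat -> C) :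
  0 <= beta <= 1 -> 0 < K0 -> (forall k, 0 <= w k <= K0 * wt beta k) ->
  0 < x < 1 -> geo x b -> (forall z, Cmod z < 1 -> psum b z <> RtoC 0) ->
  exists K, 0 < K /\ forall n, exists q,
    (forall k, (n < k)%nat -> q k = RtoC 0) /\
    forall N, rsum (fun k => w k * Cmod (conv q b k - one_seq k) ^ 2) N <= K / Phi beta (S n).
Proof.
  intros hbeta hK0 hw hx hb hnz.
  destruct (zero_factorization b x hx hb hnz) as [L [kap [d [y [hL [hy [hkap [hd [hinv hbk]]]]]]]]].
  destruct (lin_prod_approx beta L hbeta hL) as [K1 [hK1 happ]].
  destruct (trunc_inverse_error d kap y hy hd hkap hinv) as [z [K2 [hz [hK2 htr]]]].
  set (T := length L) in *.
  (* In the product of [e] and [t] the index of [t] is at least half of the total, so the decay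
     [z^(k - i)] becomes [s^k]. *)
  set (s := sqrt z).
  assert (hs : 0 < s < 1).
  { unfold s. split; [apply sqrt_lt_R0; lra|]. rewrite <- sqrt_1. apply sqrt_lt_1; lra. }
  assert (hsz : s * s = z) by (apply sqrt_sqrt; lra).
  set (v := (s + 1) / 2).
  destruct (lin_mul_geom_le s v ltac:(unfold v; lra)) as [M [hM hsv]].
  assert (hv : 0 < v < 1) by (unfold v; lra).
  set (K3 := K2 + K1 * K2 * M).
  assert (hK12 : 0 < K1 * K2) by now apply Rmult_lt_0_compat.
  assert (hK3 : 0 < K3) by (unfold K3; pose proof (Rmult_lt_0_compat _ _ hK12 hM); lra).
  destruct (tail_weighted_geom (v * v) ltac:(nra)) as [M2 [hM2 htail]].
  pose proof (pos_INR T) as hT.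
  set (K := 2 * K0 * K1 ^ 2 * (INR T + 1) + 2 * K0 * K3 ^ 2 * M2).
  assert (hK : 0 < K).
  { unfold K.
    assert (0 < 2 * K0 * K1 ^ 2 * (INR T + 1)) by (repeat apply Rmult_lt_0_compat; lra).
    assert (0 < 2 * K0 * K3 ^ 2 * M2) by (repeat apply Rmult_lt_0_compat; lra). lra. }
  assert (hmain : forall n, exists q,
    (forall k, (3 * (T + 1) * n < k)%nat -> q k = RtoC 0) /\
    forall N, rsum (fun k => w k * Cmod (conv q b k - one_seq k) ^ 2) N <= K / Phi beta (S n)).
  { intros n. destruct (happ n) as [q0 [e [hq0 [he [hqe hbnd]]]]].
    (* More than twice the degree [T * n] of [e] when [n > 0], as that halving requires; the total
       degree is then at most [3 * (T + 1) * n]. *)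
    set (m := (2 * (T + 1) * n)%nat).
    set (t := fun k => (conv (trunc m d) kap k - one_seq k)%C).
    assert (ht0 : forall k, (k <= m)%nat -> t k = RtoC 0).
    { intros k hk. unfold t. rewrite (proj1 (htr m k)) by auto. ring. }
    assert (htb : forall k, Cmod (t k) <= K2 * z ^ k) by (intros k; apply htr).
    set (tau := fun k => (t k + conv e t k)%C).
    exists (conv q0 (trunc m d)). split.
    { intros k hk. apply (conv_support _ _ (T * n) m); auto; [|unfold m; nia].
      intros j hj. unfold trunc. destruct (le_dec j m); [lia|auto]. }
    (* The product is [(1 + e) (1 + t)], and [tau] collects everything that contains [t]. *)
    assert (hprod : forall k, (conv (conv q0 (trunc m d)) b k - one_seq k)%C = (e k + tau k)%C).
    { intros k.
      rewrite (conv_ext _ _ b (conv (lin_prod L) kap)) by auto.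
      rewrite conv_assoc.
      rewrite (conv_ext q0 q0 _ (conv (lin_prod L) (conv (trunc m d) kap))); auto.
      2:{ intros j _. rewrite <- !conv_assoc. apply conv_ext; auto. intros. apply conv_comm. }
      rewrite <- conv_assoc.
      rewrite (conv_ext _ (fun j => one_seq j + e j)%C _ (fun j => one_seq j + t j)%C); auto.
      - rewrite conv_add_l, conv_one_l, conv_add_r, conv_one_r. unfold tau. ring.
      - intros j _. unfold t. ring. }
    pose proof (Phi_ge_1 beta n) as hP. set (F := Phi beta (S n)) in *.
    assert (he1 : forall k, Cmod (e k) <= K1).
    { intros k. eapply Rle_trans; [apply hbnd|]. fold F.
      pose proof (wt_ge_1 beta k (proj1 hbeta)).
      assert (h1 : / wt beta k <= 1) by (rewrite <- Rinv_1; apply Rinv_le_contravar; lra).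
      assert (h2 : / F <= 1) by (rewrite <- Rinv_1; apply Rinv_le_contravar; lra).
       assert (0 < / F) by (apply Rinv_0_lt_compat; lra).
      unfold Rdiv. rewrite <- (Rmult_1_r K1) at 2. apply Rmult_le_compat_l; [lra|]. nra. }
    assert (htau0 : forall k, (k <= n)%nat -> tau k = RtoC 0).
    { intros k hk. unfold tau. rewrite ht0 by (unfold m; nia). rewrite conv_comm, conv_zero_l; [ring|].
      intros j hj. apply ht0. unfold m. nia. }
    assert (htau : forall k, Cmod (tau k) <= K3 * v ^ k).
    { intros k. unfold tau. eapply Rle_trans; [apply Cmod_triangle|]. unfold K3.
      rewrite Rmult_plus_distr_r. apply Rplus_le_compat.
      - eapply Rle_trans; [apply htb|]. apply Rmult_le_compat_l; [lra|]. apply pow_incr.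
        unfold v. nra.
      - destruct (le_dec k m) as [hkm|hkm].
        + rewrite conv_comm, conv_zero_l by (intros; apply ht0; lia). rewrite Cmod_0.
          apply Rmult_le_pos; [|apply pow_le; lra]. apply Rmult_le_pos; lra.
        + rewrite conv_csum.
          eapply Rle_trans; [apply (Cmod_csum_le _ (fun _ => K1 * K2 * s ^ k))|].
          * intros i hi. destruct (le_dec i (T * n)) as [hi'|hi'].
            -- rewrite Cmod_mult, Rmult_assoc. apply Rmult_le_compat; auto; try apply Cmod_ge_0.
               eapply Rle_trans; [apply htb|]. apply Rmult_le_compat_l; [lra|].
               rewrite <- hsz, Rpow_mult_distr, <- pow_add.
               replace (k - i + (k - i))%nat with (k + (k - i - i))%nat by (unfold m in hkm; nia).
               rewrite pow_add. pose proof (pow_lt s k (proj1 hs)).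
               pose proof (pow_incr s 1 (k - i - i) ltac:(lra)) as h1. rewrite pow1 in h1. nra.
            -- rewrite he by lia. rewrite Cmult_0_l, Cmod_0. apply Rmult_le_pos; [lra|apply pow_le; lra].
          * rewrite rsum_const, S_INR, (Rmult_assoc _ M).
            replace ((INR k + 1) * (K1 * K2 * s ^ k)) with (K1 * K2 * ((INR k + 1) * s ^ k)) by ring.
            apply Rmult_le_compat_l; [lra|apply hsv]. }
    intros N.
    apply Rle_trans with (rsum (fun k => (2 * K0 * K1 * / F) * Cmod (e k)
       + (2 * K0 * K3 ^ 2) * (if le_dec k n then 0 else (INR k + 1) * (v * v) ^ k)) N).
    - apply rsum_le. intros k _. rewrite hprod.
      destruct (hw k) as [hw0 hw1].
      apply Rle_trans with (w k * (2 * Cmod (e k) ^ 2 + 2 * Cmod (tau k) ^ 2)).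
      { apply Rmult_le_compat_l; auto. apply Cmod_add_sqr_le. }
      rewrite Rmult_plus_distr_l. apply Rplus_le_compat.
      + pose proof (wt_pos beta k) as hwp. pose proof (Cmod_ge_0 (e k)) as he0.
        (* Only one of the two factors [Cmod (e k)] is estimated: this cancels the weight, and
           [l1_bound] sums the other. *)
        apply Rle_trans with (K0 * wt beta k * (2 * (Cmod (e k) * (K1 * (/ wt beta k / F))))).
        * apply Rmult_le_compat; auto.
          -- pose proof (pow2_ge_0 (Cmod (e k))). lra.
          -- pose proof (hbnd k) as h1. fold F in h1.
             assert (Cmod (e k) * Cmod (e k) <= Cmod (e k) * (K1 * (/ wt beta k / F))) by (apply Rmult_le_compat_l; auto).
             lra.
        * right. field. lra.
      + destruct (le_dec k n) as [hkn|hkn].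
        * rewrite htau0 by auto. rewrite Cmod_0. right. ring.
        * pose proof (wt_le_S beta k (proj2 hbeta)) as hS.
          apply Rle_trans with (K0 * (INR k + 1) * (2 * (K3 * v ^ k) ^ 2)).
          --  apply Rmult_le_compat; auto.
             ++ pose proof (pow2_ge_0 (Cmod (tau k))). lra.
             ++ eapply Rle_trans; [apply hw1|]. apply Rmult_le_compat_l; lra.
             ++ apply Rmult_le_compat_l; [lra|]. apply pow_incr. split; [apply Cmod_ge_0|auto].
          -- right. rewrite !Rpow_mult_distr. ring.
    - rewrite rsum_add, !rsum_scal.
      pose proof (l1_bound beta e K1 T n N ltac:(lra) ltac:(lra) hbnd he) as h1.
      pose proof (htail n N) as h2.
      assert (hF : F <= INR (S n)) by (apply Phi_le; lra).
      assert (h3 : M2 / INR (S n) <= M2 / F).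
      { apply Rmult_le_compat_l; [lra|]. apply Rinv_le_contravar; lra. }
      assert (hFi : 0 < / F) by (apply Rinv_0_lt_compat; lra).
      unfold K, Rdiv. rewrite Rmult_plus_distr_r. apply Rplus_le_compat.
      + replace (2 * K0 * K1 ^ 2 * (INR T + 1) * / F) with (2 * K0 * K1 * / F * (K1 * (INR T + 1))) by ring.
        apply Rmult_le_compat_l; auto. repeat apply Rmult_le_pos; lra.
      + rewrite (Rmult_assoc _ M2). apply Rmult_le_compat_l.
        * apply Rmult_le_pos; [lra|apply pow2_ge_0].
        * unfold Rdiv in *. lra. }
  (* Passing from degree [Q * n] to degree [n]: the construction is used at [n / Q], and [Phi_mul]
     pays the factor [Q]. *)
  set (Q := (3 * (T + 1))%nat).
  assert (hQ : 1 <= INR Q) by (unfold Q; apply (le_INR 1); lia).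
  exists (INR Q * K). split; [nra|]. intros n.
  destruct (hmain (n / Q)%nat) as [q [hq hN]]. exists q.
  pose proof (Nat.div_mod n Q ltac:(unfold Q; lia)) as hdm.
  pose proof (Nat.mod_upper_bound n Q ltac:(unfold Q; lia)) as hmod.
  split; [intros k hk; apply hq; fold Q; lia|].
  intros N. eapply Rle_trans; [apply hN|].
  pose proof (Phi_ge_1 beta n). pose proof (Phi_ge_1 beta (n / Q)).
  assert (h : Phi beta (S n) <= INR Q * Phi beta (S (n / Q))).
  { eapply Rle_trans; [|apply Phi_mul; lra]. apply Phi_mono. nia. }
  apply (Rmult_le_reg_r (Phi beta (S n) * Phi beta (S (n / Q)))); [nra|].
  replace (K / Phi beta (S (n / Q)) * (Phi beta (S n) * Phi beta (S (n / Q)))) with (K * Phi beta (S n)) by (field; lra).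
  replace (INR Q * K / Phi beta (S n) * (Phi beta (S n) * Phi beta (S (n / Q))))
    with (K * (INR Q * Phi beta (S (n / Q)))) by (field; lra).
  apply Rmult_le_compat_l; lra.
Qed.

Lemma geo_finite (q : nat -> C) (x : R) (n : nat) : 0 < x ->
  (forall k, (n < k)%nat -> q k = RtoC 0) -> geo x q.
Proof.
  intros hx hq. set (u := fun k => Cmod (q k) * / x ^ k).
  assert (hxk : forall k, 0 < / x ^ k) by (intros; apply Rinv_0_lt_compat, pow_lt; auto).
  assert (hu : forall k, 0 <= u k).
  { intros k. apply Rmult_le_pos; [apply Cmod_ge_0|left; apply hxk]. }
  exists (rsum u (S n) + 1). pose proof (rsum_nonneg u (S n) (fun k _ => hu k)).
  split; [lra|]. intros k. pose proof (pow_lt x k hx).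
  destruct (Nat.lt_ge_cases n k) as [hk|hk].
  - rewrite hq, Cmod_0 by auto. apply Rmult_le_pos; lra.
  - pose proof (rsum_term_le u (S n) k hu ltac:(lia)) as h.
    replace (Cmod (q k)) with (u k * x ^ k) by (unfold u; field; lra).
    apply Rmult_le_compat_r; lra.
Qed.

Theorem approx_lower (beta c1 x : R) (w : nat -> R) (b : nat -> C) (zeta : C) :
  0 <= beta -> 0 < c1 -> (forall k, c1 * wt beta k <= w k) ->
  0 < x < 1 -> geo x b -> (forall z, Cmod z < 1 -> psum b z <> RtoC 0) ->
  Cmod zeta = 1 -> psum b zeta = RtoC 0 ->
  exists c, 0 < c /\ forall n q A, (forall k, (n < k)%nat -> q k = RtoC 0) ->
    (forall N, rsum (fun k => w k * Cmod (conv q b k - one_seq k) ^ 2) N <= A) ->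
    c / Phi beta (S n) <= A.
Proof.
  intros hbeta hc1 hw hx hb hnz hz hz0.
  destruct (formal_inverse b) as [d hd].
  { rewrite <- psum_at_0. apply hnz. rewrite Cmod_0. lra. }
  (* With [x = t^4], coefficients of [q] grow like [t^(- k)] and those of [q * b] up to
     index [n] cost a factor [t^(- 5 n)], beaten by the decay [t^(6 n)] at index [2 n]. *)
  set (t := sqrt (sqrt x)).
  assert (hsx : 0 < sqrt x < 1).
  { split; [apply sqrt_lt_R0; lra|]. rewrite <- sqrt_1. apply sqrt_lt_1; lra. }
  assert (ht : 0 < t < 1).
  { unfold t. split; [apply sqrt_lt_R0; lra|]. rewrite <- sqrt_1. apply sqrt_lt_1; lra. }
  assert (hx4 : x = t ^ 4).
  { replace (t ^ 4) with ((t ^ 2) ^ 2) by ring. unfold t. now rewrite !pow2_sqrt by lra. }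
  assert (hit := Rinv_gt_1 t ht).
  destruct (inverse_subexponential b d x (/ t) hx hb hnz hd hit) as [D [hD hdb]].
  pose proof hb as [B [hB hbb]].
  assert (ht3 : 0 < t ^ 3 < 1).
  { split; [apply pow_lt; lra|]. replace (t ^ 3) with (t * (t * t)) by ring. nra. }
  destruct (lin_mul_geom_le (t ^ 4) (t ^ 3)) as [M0 [hM0 g0]].
  { split; [apply pow_le; lra|]. replace (t ^ 4) with (t * t ^ 3) by ring. nra. }
  set (v := (t + 1) / 2). assert (hv : t < v < 1) by (unfold v; lra).
  destruct (lin_mul_geom_le t v ltac:(lra)) as [M1 [hM1 g1]].
  (* When [A < 1], each coefficient satisfies [c1 * |e k|^2 <= 1], hence [|e k| <= E0]. *)
  set (E0 := 1 + / c1).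
  assert (hic1 : 0 < / c1) by now apply Rinv_0_lt_compat.
  set (Q := (E0 + 1) * D * B * M0).
  assert (hE0 : 1 < E0) by (unfold E0; lra).
  assert (hQ : 0 < Q) by (unfold Q; do 3 (apply Rmult_lt_0_compat; auto); lra).
  set (H := Q * M1 * / (1 - t ^ 3)).
  assert (hit3 : 0 < / (1 - t ^ 3)) by (apply Rinv_0_lt_compat; lra).
  assert (hH : 0 < H) by (unfold H; do 2 (apply Rmult_lt_0_compat; auto)).
  destruct (pow_lt_1_zero v ltac:(rewrite Rabs_pos_eq; lra) (/ (2 * H))) as [n0 hn0];
    [apply Rinv_0_lt_compat; lra|].
  assert (hlarge : forall n q A, (n0 <= n)%nat -> A < 1 -> (forall k, (n < k)%nat -> q k = RtoC 0) ->
    (forall N, rsum (fun k => w k * Cmod (conv q b k - one_seq k) ^ 2) N <= A) ->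
    c1 / 8 / Phi beta (S n) <= A).
  { intros n q A hn hA hq hN. set (e := fun k => (conv q b k - one_seq k)%C).
    change (forall N, rsum (fun k => w k * Cmod (e k) ^ 2) N <= A) in hN.
    assert (hwp : forall k, c1 <= w k).
    { intros k. eapply Rle_trans; [|apply hw]. pose proof (wt_ge_1 beta k hbeta). nra. }
    assert (hterm : forall k, 0 <= w k * Cmod (e k) ^ 2).
    { intros k. apply Rmult_le_pos; [pose proof (hwp k); lra|apply pow2_ge_0]. }
    assert (heb : forall k, Cmod (e k) <= E0).
    { intros k. pose proof (rsum_term_le _ (S k) k hterm ltac:(lia)) as h1. cbv beta in h1.
      specialize (hN (S k)).
      assert (h2 : c1 * Cmod (e k) ^ 2 <= w k * Cmod (e k) ^ 2)
        by (apply Rmult_le_compat_r; [apply pow2_ge_0|auto]).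
      assert (h3 : Cmod (e k) ^ 2 <= / c1).
      { apply (Rmult_le_reg_l c1); auto. rewrite Rinv_r; lra. }
       unfold E0. nra. }
    (* Dividing by [b] recovers [q] as [(1 + e) d]: the smallness of [e] bounds the otherwise
       uncontrolled [q]. *)
    assert (hqb : forall k, Cmod (q k) <= (E0 + 1) * D * ((INR k + 1) * (/ t) ^ k)).
    { intros k. replace (q k) with (conv (fun j => one_seq j + e j)%C d k).
      - apply conv_geo_le; auto; [lra|]. intros j.
        apply Rle_trans with (E0 + 1).
        + eapply Rle_trans; [apply Cmod_triangle|].
          assert (Cmod (one_seq j) <= 1) by (destruct j; simpl; [rewrite Cmod_1|rewrite Cmod_0]; lra).
          pose proof (heb j). lra.
        + pose proof (pow_R1_Rle (/ t) j ltac:(lra)). nra.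
      - rewrite (conv_ext _ (conv q b) d d) by (intros; auto; unfold e; ring).
        rewrite conv_assoc, (conv_ext q q _ one_seq) by (intros; auto; rewrite conv_comm; apply hd).
        apply conv_one_r. }
    pose proof (pos_INR n) as hnp.
    assert (hpow : forall m, 0 < (/ t) ^ m) by (intros; apply pow_lt; lra).
    assert (hED : 0 < (E0 + 1) * D) by (apply Rmult_lt_0_compat; lra).
    (* Rewritten with the ratio [x] of [b], so that [conv_geo_le] applies: for [k <= n],
       [t^(-k) = t^(-5k) x^k]. *)
    assert (hqx : forall k, Cmod (q k) <= (E0 + 1) * D * ((INR n + 1) * (/ t) ^ (5 * n)) * x ^ k).
    { intros k. rewrite (Rmult_assoc ((E0 + 1) * D)), (Rmult_assoc (INR n + 1)).
      assert (0 < x ^ k) by (apply pow_lt; lra). pose proof (hpow (5 * n)%nat).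
      destruct (le_dec k n) as [hk|hk].
      - eapply Rle_trans; [apply hqb|]. apply Rmult_le_compat_l; [lra|]. pose proof (pos_INR k).
        apply Rmult_le_compat; [lra|left; apply hpow|apply le_INR in hk; lra|].
        replace ((/ t) ^ k) with ((/ t) ^ (5 * k) * x ^ k).
        + apply Rmult_le_compat_r; [lra|]. apply Rle_pow; lra || lia.
        + rewrite hx4, <- pow_mult. replace (5 * k)%nat with (k + 4 * k)%nat by lia.
          rewrite pow_add, Rmult_assoc, <- Rpow_mult_distr, Rinv_l, pow1 by lra. ring.
      - rewrite hq, Cmod_0 by lia. apply Rmult_le_pos; [lra|]. apply Rmult_le_pos; nra. }
    set (K := Q * ((INR n + 1) * (/ t) ^ (5 * n))).
    assert (hK : 0 <= K).
    { unfold K. pose proof (hpow (5 * n)%nat). apply Rmult_le_pos; nra. }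
    assert (htail : forall k, (2 * n + 1 <= k)%nat -> Cmod (e k * zeta ^ k) <= K * (t ^ 3) ^ k).
    { intros k hk. rewrite Cmod_mult, Cmod_pow, hz, pow1, Rmult_1_r. unfold e.
      replace (one_seq k) with (RtoC 0) by (destruct k; [lia|reflexivity]).
      replace (conv q b k - 0)%C with (conv q b k) by ring.
      eapply Rle_trans; [eapply (conv_geo_le q b _ B x k); [lra|exact hqx|exact hbb]|].
      rewrite hx4. unfold K, Q. specialize (g0 k). pose proof (hpow (5 * n)%nat).
      replace ((E0 + 1) * D * B * M0 * ((INR n + 1) * (/ t) ^ (5 * n)) * (t ^ 3) ^ k)
        with ((E0 + 1) * D * ((INR n + 1) * (/ t) ^ (5 * n)) * B * (M0 * (t ^ 3) ^ k)) by ring.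
      apply Rmult_le_compat_l; auto. repeat apply Rmult_le_pos; lra. }
    assert (hsum : is_cseries (fun k => e k * zeta ^ k)%C (- (1))%C).
    { apply (is_cseries_ext (fun k => conv q b k * zeta ^ k + (- (1)) * (one_seq k * zeta ^ k))%C).
      - intros k. unfold e. ring.
      - assert (h : is_cseries (fun k => conv q b k * zeta ^ k + (- (1)) * (one_seq k * zeta ^ k))%C
            (psum q zeta * psum b zeta + - (1) * 1)%C).
        + apply is_cseries_add; [|apply is_cseries_scal, is_cseries_one_seq].
          apply (psum_conv q b x); auto; [lra|apply (geo_finite q x n); auto; lra|rewrite hz; lra].
        + rewrite hz0 in h. replace (psum q zeta * 0 + - (1) * 1)%C with (- (1))%C in h by ring.
          exact h. }
    pose proof (is_cseries_geom_tail _ _ K (t ^ 3) (2 * n + 1) ltac:(lra) hK htail hsum) as htl.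
    assert (hK2 : K * (t ^ 3) ^ (2 * n + 1) / (1 - t ^ 3) <= / 2).
    { apply Rle_trans with (H * v ^ n).
      - unfold K, H, Rdiv.
        replace (Q * M1 * / (1 - t ^ 3) * v ^ n) with (Q * (M1 * v ^ n) * / (1 - t ^ 3)) by ring.
        apply Rmult_le_compat_r; [lra|]. rewrite (Rmult_assoc Q). apply Rmult_le_compat_l; [lra|].
        eapply Rle_trans; [|apply g1]. rewrite Rmult_assoc. apply Rmult_le_compat_l; [lra|].
        rewrite <- pow_mult. replace (3 * (2 * n + 1))%nat with (5 * n + (n + 3))%nat by lia.
        rewrite pow_add, <- Rmult_assoc, <- Rpow_mult_distr, Rinv_l, pow1, Rmult_1_l, pow_add by lra.
        pose proof (pow_lt t n (proj1 ht)). nra.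
      - specialize (hn0 n hn). rewrite Rabs_pos_eq in hn0 by (apply pow_le; lra).
        apply (Rmult_lt_compat_l H) in hn0; auto.
        replace (H * / (2 * H)) with (/ 2) in hn0 by (field; lra). now left. }
    assert (hhalf : / 2 <= rsum (fun k => Cmod (e k)) (2 * n + 1)).
    { apply Rle_trans with (Cmod (csum (fun k => e k * zeta ^ k)%C (2 * n + 1))).
      - pose proof (Cmod_sub_ge (- (1))%C (csum (fun k => e k * zeta ^ k)%C (2 * n + 1))) as h1.
        rewrite Cmod_opp, Cmod_1 in h1. lra.
      - apply Cmod_csum_le. intros k _. rewrite Cmod_mult, Cmod_pow, hz, pow1. lra. }
    pose proof (rsum_cauchy_schwarz (fun k => sqrt (/ w k)) (fun k => sqrt (w k) * Cmod (e k)) (2 * n + 1)) as hcs.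
    assert (hwk : forall k, 0 < w k) by (intros k; pose proof (hwp k); lra).
    assert (hwi : forall k, 0 <= / w k) by (intros k; left; now apply Rinv_0_lt_compat).
    rewrite (rsum_ext (fun k => sqrt (/ w k) * (sqrt (w k) * Cmod (e k))) (fun k => Cmod (e k))) in hcs.
    2:{ intros k _. pose proof (hwk k).
        rewrite <- Rmult_assoc, <- sqrt_mult_alt, Rinv_l, sqrt_1 by (auto; lra). ring. }
    rewrite (rsum_ext (fun k => sqrt (/ w k) ^ 2) (fun k => / w k)) in hcs by (intros; now apply pow2_sqrt).
    rewrite (rsum_ext (fun k => (sqrt (w k) * Cmod (e k)) ^ 2) (fun k => w k * Cmod (e k) ^ 2)) in hcs.
    2:{ intros k _. rewrite Rpow_mult_distr, pow2_sqrt; auto. left. auto. }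
    specialize (hN (2 * n + 1)%nat).
    assert (hwsum : rsum (fun k => / w k) (2 * n + 1) <= / c1 * (2 * Phi beta (S n))).
    { apply Rle_trans with (rsum (fun k => / c1 * / wt beta k) (2 * n + 1)).
      - apply rsum_le. intros k _. pose proof (wt_pos beta k). rewrite <- Rinv_mult.
        apply Rinv_le_contravar; [now apply Rmult_lt_0_compat|auto].
      - rewrite rsum_scal. apply Rmult_le_compat_l; [lra|]. fold (Phi beta (2 * n + 1)).
        apply Rle_trans with (Phi beta (2 * S n)); [apply Phi_mono; lia|].
        pose proof (Phi_mul beta 2 (S n) hbeta) as h1. simpl (INR 2) in h1. lra. }
    pose proof (Phi_ge_1 beta n) as hP. set (F := Phi beta (S n)) in *.
    (* The square of [hhalf]; together with the factor [2] in [hwsum] this is the source of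
       [c1 / 8]. *)
    assert (h4 : / 4 <= / c1 * (2 * F) * A).
    { apply Rle_trans with (rsum (fun k => Cmod (e k)) (2 * n + 1) ^ 2); [nra|].
      eapply Rle_trans; [apply hcs|].
      apply Rmult_le_compat; auto; apply rsum_nonneg; intros; [apply hwi|apply hterm]. }
    apply (Rmult_le_reg_r (/ c1 * (2 * F))); [apply Rmult_lt_0_compat; lra|].
    replace (c1 / 8 / F * (/ c1 * (2 * F))) with (/ 4) by (field; lra). lra. }
  pose proof (Phi_ge_1 beta n0) as hP0.
  set (c := c1 / 8 / Phi beta (S n0)).
  assert (hc : 0 < c) by (unfold c; repeat apply Rdiv_lt_0_compat; lra).
  exists (Rmin 1 c). split; [apply Rmin_glb_lt; lra|]. intros n q A hq hN.
  pose proof (Phi_ge_1 beta n) as hP. assert (hm1 := Rmin_l 1 c). assert (hm2 := Rmin_r 1 c).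
  assert (hPi : 0 < / Phi beta (S n) <= 1).
  { split; [apply Rinv_0_lt_compat; lra|]. rewrite <- Rinv_1. apply Rinv_le_contravar; lra. }
  unfold Rdiv. destruct (Rlt_dec A 1) as [hA|hA]; [|nra].
  (* Below [n0] the polynomial [q] is regarded as one of degree at most [n0]; the case [A >= 1] was
     trivial, as [Phi] is at least [1]. *)
  specialize (hlarge (Nat.max n n0) q A ltac:(lia) hA ltac:(intros; apply hq; lia) hN).
  eapply Rle_trans; [|apply hlarge].
  apply Rle_trans with (c * / Phi beta (S n)); [apply Rmult_le_compat_r; lra|].
  unfold c, Rdiv. rewrite (Rmult_assoc (c1 * / 8)). apply Rmult_le_compat_l; [lra|].
  rewrite <- Rinv_mult.
  destruct (Nat.max_dec n n0) as [->| ->]; apply Rinv_le_contravar; nra.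
Qed.

(** * Weights and double series *)

(** From [ln (1 + 1/x) >= 1 / (x + 1)] and [exp t >= 1 + t]. This bound on increments of powers
    replaces comparison with an integral in the estimates of [Phi]. *)
Lemma Rpower_S_ge (s : R) (j : nat) : 0 <= s ->
  Rpower (INR (S j)) s * (1 + s / INR (S (S j))) <= Rpower (INR (S (S j))) s.
Proof.
  intros hs. rewrite (S_INR (S j)). set (x := INR (S j)).
  assert (hx : 1 <= x) by apply INR_S_ge_1.
  assert (hln : / (x + 1) <= ln (x + 1) - ln x).
  { assert (h : ln (x / (x + 1)) <= x / (x + 1) - 1).
    { assert (hp : 0 < x / (x + 1)) by (apply Rdiv_lt_0_compat; lra).
      pose proof (exp_ineq1_le (ln (x / (x + 1)))) as he. rewrite exp_ln in he by auto. lra. }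
    rewrite ln_div in h by lra.
    replace (x / (x + 1) - 1) with (- / (x + 1)) in h by (field; lra). lra. }
  unfold Rpower. replace (s * ln (x + 1)) with (s * ln x + s * (ln (x + 1) - ln x)) by ring.
  rewrite exp_plus. apply Rmult_le_compat_l; [left; apply exp_pos|].
  pose proof (exp_ineq1_le (s * (ln (x + 1) - ln x))).
  assert (s * / (x + 1) <= s * (ln (x + 1) - ln x)) by now apply Rmult_le_compat_l.
  unfold Rdiv. lra.
Qed.

Lemma Rpower_sub_one (x s : R) : 0 < x -> Rpower x (s - 1) = Rpower x s / x.
Proof.
  intros hx. unfold Rminus. rewrite Rpower_plus, Rpower_Ropp, Rpower_1 by auto. reflexivity.
Qed.

Lemma wt_inv (beta : R) (k : nat) : / wt beta k = Rpower (INR (S k)) (- beta).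
Proof. unfold wt. symmetry. apply Rpower_Ropp. Qed.

Lemma Phi_S (beta : R) (m : nat) : Phi beta (S m) = Phi beta m + / wt beta m.
Proof. reflexivity. Qed.

(** Each new term is at most [2 / (1 - beta)] times the increment of the power; the [2] bounds the
    ratio of consecutive powers. *)
Lemma Phi_le_power (beta : R) (n : nat) : 0 <= beta < 1 ->
  Phi beta (S n) <= (1 + 2 / (1 - beta)) * Rpower (INR (S n)) (1 - beta).
Proof.
  intros hb. set (s := 1 - beta). assert (hs : 0 < s <= 1) by (unfold s; lra).
  assert (his : 0 < 2 / s) by (apply Rdiv_lt_0_compat; lra).
  induction n.
  - rewrite Phi_S, wt_0. unfold Phi. simpl rsum. simpl INR.
    unfold Rpower. rewrite ln_1, Rmult_0_r, exp_0. lra.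
  - rewrite Phi_S, wt_inv. replace (- beta) with (s - 1) by (unfold s; ring).
    set (x := INR (S n)) in *. pose proof (INR_S_ge_1 n) as hx. fold x in hx.
    assert (hy : INR (S (S n)) = x + 1) by (apply S_INR).
    pose proof (Rpower_S_ge s n ltac:(lra)) as h. rewrite hy in *. fold x in h.
    rewrite Rpower_sub_one by lra.
    set (X := Rpower x s) in *. set (Y := Rpower (x + 1) s) in *.
    assert (hXY : Y <= 2 * X).
    { apply Rle_trans with (Rpower (2 * x) s); [apply Rle_Rpower_l; lra|].
      rewrite <- Rpower_mult_distr by lra. apply Rmult_le_compat_r; [left; apply exp_pos|].
      apply Rle_trans with (Rpower 2 1); [apply Rle_Rpower; lra|rewrite Rpower_1; lra]. }
    assert (hX : 0 < X) by apply exp_pos.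
    assert (h2 : Y / (x + 1) <= 2 / s * (Y - X)).
    { apply Rle_trans with (2 / s * (X * (s / (x + 1)))).
      - replace (2 / s * (X * (s / (x + 1)))) with (2 * X / (x + 1)) by (field; lra).
        apply Rmult_le_compat_r; auto. left. apply Rinv_0_lt_compat. lra.
      - apply Rmult_le_compat_l; lra. }
    assert (X <= Y).
    { assert (0 <= X * (s / (x + 1))).
      { apply Rmult_le_pos; [lra|]. apply Rdiv_le_0_compat; lra. } lra. }
    nra.
Qed.

Lemma Phi_ge_power (beta : R) (n : nat) : 0 <= beta ->
  Rpower (INR (S n)) (1 - beta) <= Phi beta (S n).
Proof.
  intros hb. apply Rle_trans with (rsum (fun _ => / wt beta n) (S n)).
  - rewrite rsum_const, wt_inv. unfold Rminus.
    pose proof (INR_S_ge_1 n). rewrite Rpower_plus, Rpower_1 by lra. lra.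
  - apply rsum_le. intros k hk. apply Rinv_le_contravar; [apply wt_pos|].
    apply wt_mono; auto. lia.
Qed.

(** At [beta = 1] the two sums coincide; that case is separate because [2 / (1 - beta)] blows up
    there. *)
Lemma phi_equiv_Phi (beta : R) : 0 <= beta <= 1 ->
  exists K, 0 < K /\ forall n, phi beta (n + 1) <= Phi beta (S n) <= K * phi beta (n + 1).
Proof.
  intros hb. unfold phi. destruct (Req_EM_T beta 1) as [->|hne].
  - exists 1. split; [lra|]. intros n. rewrite Nat.add_1_r.
    assert (h : sum_n_m (fun j => / INR j) 1 (S n) = Phi 1 (S n)).
    { induction n.
      - rewrite sum_n_n, Phi_S, wt_0. unfold Phi. simpl. lra.
      - rewrite sum_n_Sm by lia. rewrite IHn, (Phi_S 1 (S n)), wt_inv.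
        change (@plus R_AbelianMonoid) with Rplus. f_equal.
        rewrite Rpower_Ropp, Rpower_1; auto. pose proof (INR_S_ge_1 (S n)). lra. }
    rewrite h. lra.
  - exists (1 + 2 / (1 - beta)). assert (0 < 2 / (1 - beta)) by (apply Rdiv_lt_0_compat; lra).
    split; [lra|]. intros n. rewrite Nat.add_1_r.
    split; [apply Phi_ge_power; lra|apply Phi_le_power; lra].
Qed.

(** Terms are dominated by the telescoping differences of [- x^(-s) / s], with [s = beta - 1]. *)
Lemma Phi_bounded (beta : R) : 1 < beta -> exists K, 0 < K /\ forall n, Phi beta n <= K.
Proof.
  intros hb. set (s := beta - 1). assert (hs : 0 < s) by (unfold s; lra).
  assert (his : 0 < / s) by now apply Rinv_0_lt_compat.
  exists (1 + / s). split; [lra|].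
  assert (h : forall n, Phi beta (S n) <= 1 + / s * (1 - Rpower (INR (S n)) (- s))).
  { induction n.
    - rewrite Phi_S, wt_0. unfold Phi. simpl rsum. simpl INR.
      unfold Rpower. rewrite ln_1, Rmult_0_r, exp_0. lra.
    - rewrite Phi_S, wt_inv. replace (- beta) with (- s - 1) by (unfold s; ring).
      set (x := INR (S n)) in *. pose proof (INR_S_ge_1 n) as hx. fold x in hx.
      assert (hy : INR (S (S n)) = x + 1) by (apply S_INR).
      pose proof (Rpower_S_ge s n ltac:(lra)) as hp. rewrite hy in *. fold x in hp.
      rewrite Rpower_sub_one by lra. rewrite !Rpower_Ropp in *.
      set (X := Rpower x s) in *. set (Y := Rpower (x + 1) s) in *.
      assert (hX : 0 < X) by apply exp_pos. assert (hY : 0 < Y) by apply exp_pos.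
      assert (hstep : / Y / (x + 1) <= / s * (/ X - / Y)).
      { apply (Rmult_le_reg_r (s * X * Y)); [repeat apply Rmult_lt_0_compat; auto|].
        replace (/ Y / (x + 1) * (s * X * Y)) with (X * (s / (x + 1))) by (field; lra).
        replace (/ s * (/ X - / Y) * (s * X * Y)) with (Y - X) by (field; lra). lra. }
      lra. }
  intros [|n]; [unfold Phi; simpl; lra|]. eapply Rle_trans; [apply h|].
  assert (0 < Rpower (INR (S n)) (- s)) by apply exp_pos. nra.
Qed.

Lemma Phi_unbounded (beta A : R) : 0 <= beta <= 1 -> exists n, A < Phi beta (S n).
Proof.
  intros hb.
  assert (h : forall n, ln (INR (S n)) <= Phi beta n).
  { induction n.
    - simpl. rewrite ln_1. unfold Phi. simpl. lra.
    - rewrite Phi_S. pose proof (wt_le_S beta n ltac:(lra)) as hw. rewrite <- S_INR in hw.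
      pose proof (INR_S_ge_1 n) as hx. rewrite (S_INR (S n)). set (x := INR (S n)) in *.
      assert (hi : / x <= / wt beta n) by (apply Rinv_le_contravar; [apply wt_pos|auto]).
      assert (hl : ln ((x + 1) / x) <= / x).
      { assert (hp : 0 < (x + 1) / x) by (apply Rdiv_lt_0_compat; lra).
        pose proof (exp_ineq1_le (ln ((x + 1) / x))) as he. rewrite exp_ln in he by auto.
        replace ((x + 1) / x) with (1 + / x) in * by (field; lra). lra. }
      rewrite ln_div in hl by lra. lra. }
  destruct (INR_unbounded (exp A)) as [n hn]. exists n.
  eapply Rlt_le_trans; [|apply h]. apply exp_lt_inv. rewrite exp_ln.
  - apply Rlt_trans with (INR n); auto. apply lt_INR. lia.
  - pose proof (INR_S_ge_1 (S n)). lra.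
Qed.

(** A Wallis product; [central_eq] identifies it with [4^k (k!)^2 / (2k+1)!]. *)
Fixpoint central (k : nat) : R :=
  match k with 0%nat => 1 | S j => central j * ((2 * INR j + 2) / (2 * INR j + 3)) end.

Lemma central_eq (k : nat) :
  central k = 4 ^ k * (INR (fact k) * INR (fact k) / INR (fact (1 + k + k))).
Proof.
  induction k; [simpl; field|]. simpl central. rewrite IHk.
  replace (1 + S k + S k)%nat with (S (S (1 + k + k))) by lia.
  rewrite !fact_simpl, !mult_INR. rewrite !S_INR, !plus_INR. simpl (INR 1).
  pose proof (INR_fact_lt_0 (1 + k + k)). pose proof (pos_INR k). simpl pow. field. lra.
Qed.

(** The square times [k + 1] decreases and the square times [2 k + 1] increases, both from [1]. This
    gives the order [(k + 1)^(-1/2)] without Stirling's formula. *)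
Lemma central_bounds (k : nat) :
  0 < central k /\ central k ^ 2 * INR (S k) <= 1 <= central k ^ 2 * (2 * INR k + 1).
Proof.
  induction k; [simpl; lra|]. destruct IHk as [h0 [h1 h2]]. simpl central.
  rewrite (S_INR (S k)), S_INR in *. pose proof (pos_INR k) as hk.
  set (x := INR k) in *. set (c := central k) in *.
  split; [apply Rmult_lt_0_compat; auto; apply Rdiv_lt_0_compat; lra|].
  assert (hd : 0 < (2 * x + 3) ^ 2) by (apply pow_lt; lra).
  split.
  - apply (Rmult_le_reg_r ((2 * x + 3) ^ 2)); auto.
    replace ((c * ((2 * x + 2) / (2 * x + 3))) ^ 2 * (x + 1 + 1) * (2 * x + 3) ^ 2)
      with (c ^ 2 * (x + 1) * (4 * (x + 1) * (x + 2))) by (field; lra).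
    apply Rle_trans with (1 * (4 * (x + 1) * (x + 2))); [apply Rmult_le_compat_r; nra|nra].
  - replace (2 * (x + 1) + 1) with (2 * x + 3) by ring.
    apply (Rmult_le_reg_r (2 * x + 3)); [lra|].
    replace ((c * ((2 * x + 2) / (2 * x + 3))) ^ 2 * (2 * x + 3) * (2 * x + 3))
      with (c ^ 2 * (4 * (x + 1) ^ 2)) by (field; lra).
    apply (Rmult_le_reg_r (2 * x + 1)); [lra|].
    replace (c ^ 2 * (4 * (x + 1) ^ 2) * (2 * x + 1)) with (c ^ 2 * (2 * x + 1) * (4 * (x + 1) ^ 2)) by ring.
    apply Rle_trans with (1 * (4 * (x + 1) ^ 2)); [nra|apply Rmult_le_compat_r; nra].
Qed.

(** The squared norm of [(2 z1 z2)^k]. *)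
Definition diag_weight (alpha : R) (k : nat) : R := 4 ^ k * D_weight alpha k k.

(** The weight is [(2 (k + 1))^alpha * central k]; [central k] lowers the exponent by [1/2], and
    [2^alpha] is the constant. *)
Lemma diag_weight_bounds (alpha : R) (k : nat) :
  Rpower 2 alpha / 2 * wt (alpha - 1 / 2) k <= diag_weight alpha k
    <= Rpower 2 alpha * wt (alpha - 1 / 2) k.
Proof.
  unfold diag_weight, D_weight. set (P := Rpower 2 alpha).
  assert (hP : 0 < P) by apply exp_pos.
  replace (4 ^ k * (_ * _)) with (Rpower (INR (2 + k + k)) alpha * central k) by (rewrite central_eq; ring).
  replace (2 + k + k)%nat with (2 * S k)%nat by lia. rewrite INR_double.
  pose proof (INR_S_ge_1 k) as hx. rewrite <- Rpower_mult_distr by lra. fold P.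
  assert (hsplit : Rpower (INR (S k)) alpha = wt (alpha - 1 / 2) k * sqrt (INR (S k))).
  { unfold wt. rewrite <- Rpower_sqrt, <- Rpower_plus by lra. f_equal. field. }
  rewrite hsplit. set (W := wt (alpha - 1 / 2) k). assert (hW : 0 < W) by apply exp_pos.
  destruct (central_bounds k) as [h0 [h1 h2]]. rewrite S_INR in h1.
   rewrite S_INR in *.
  set (r := sqrt (INR k + 1)). assert (hr : r * r = INR k + 1) by (apply sqrt_sqrt; lra).
  assert (hr0 : 0 < r) by (apply sqrt_lt_R0; lra).
  assert (hcr : / 2 <= r * central k <= 1).
  { assert (ht : 0 < r * central k) by now apply Rmult_lt_0_compat.
    split; nra. }
  replace (P * (W * r) * central k) with (P * W * (r * central k)) by ring.
  assert (0 < P * W) by now apply Rmult_lt_0_compat. nra.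
Qed.

(** * Series and double series of nonnegative terms *)

Lemma is_rseries_partial_le (u : nat -> R) (l : R) (n : nat) :
  (forall k, 0 <= u k) -> is_series u l -> rsum u n <= l.
Proof.
  rewrite is_rseries_iff. intros h0 h. apply Rnot_lt_le. intros hlt.
  destruct (h (rsum u n - l) ltac:(lra)) as [N hN]. specialize (hN (N + n)%nat ltac:(lia)).
  pose proof (rsum_mono u n (N + n) h0 ltac:(lia)). apply Rabs_def2 in hN. lra.
Qed.

Lemma is_rseries_bounded (u : nat -> R) (M : R) :
  (forall k, 0 <= u k) -> (forall n, rsum u n <= M) ->
  exists l, is_series u l /\ l <= M.
Proof.
  intros h0 hM.
  destruct (completeness (fun x => exists n, x = rsum u n)) as [l [hub hlub]].
  - exists M. intros x [n ->]. auto.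
  - exists 0, 0%nat. reflexivity.
  - exists l. split; [|apply hlub; intros x [n ->]; auto].
    apply is_rseries_iff. intros eps heps.
    assert (hN : exists N, l - eps < rsum u N).
    { apply NNPP. intros hn. assert (l <= l - eps); [|lra]. apply hlub. intros x [n ->].
      apply Rnot_lt_le. intros h. apply hn. eauto. }
    destruct hN as [N hN]. exists N. intros n hn.
    pose proof (rsum_mono u N n h0 hn). pose proof (hub _ (ex_intro _ n eq_refl)).
    apply Rabs_def1; lra.
Qed.

(** Iterated series of nonnegative terms are handled through uniform bounds on these, which need no
    convergence and no exchange of limits. *)
Definition rect_sum (u : nat -> nat -> R) (m n : nat) : R :=
  rsum (fun k => rsum (u k) n) m.

Lemma rect_sum_mono (u : nat -> nat -> R) (m m' n n' : nat) :
  (forall k l, 0 <= u k l) -> (m <= m')%nat -> (n <= n')%nat ->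
  rect_sum u m n <= rect_sum u m' n'.
Proof.
  intros h0 hm hn. apply Rle_trans with (rect_sum u m n').
  - apply rsum_le. intros k _. apply rsum_mono; auto.
  - apply rsum_mono; auto. intros k. apply rsum_nonneg. auto.
Qed.

Lemma double_series_rect_le (u : nat -> nat -> R) (s : R) (m n : nat) :
  (forall k l, 0 <= u k l) -> is_double_series (V := R_NormedModule) u s -> rect_sum u m n <= s.
Proof.
  intros h0 [b [hb hs]].
  assert (hle : forall k n, rsum (u k) n <= b k) by (intros; apply is_rseries_partial_le; auto).
  apply Rle_trans with (rsum b m).
  - apply rsum_le. auto.
  - apply is_rseries_partial_le; auto. intros k. specialize (hle k 0%nat). simpl in hle. lra.
Qed.

Lemma rect_sum_rows (u : nat -> nat -> R) (b : nat -> R) (m : nat) (eps : R) :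
  (forall k l, 0 <= u k l) -> (forall k, is_series (u k) (b k)) -> 0 < eps ->
  exists n, rsum b m - eps < rect_sum u m n.
Proof.
  intros h0 hb heps. revert eps heps. unfold rect_sum. induction m; intros eps heps.
  - exists 0%nat. simpl. lra.
  - destruct (IHm (eps / 2) ltac:(lra)) as [n hn].
    destruct (proj1 (is_rseries_iff _ _) (hb m) (eps / 2) ltac:(lra)) as [n' hn'].
    exists (n + n')%nat. specialize (hn' (n + n')%nat ltac:(lia)). apply Rabs_def2 in hn'.
    pose proof (rect_sum_mono u m m n (n + n') h0 ltac:(lia) ltac:(lia)) as hmono.
    unfold rect_sum in hmono. simpl. lra.
Qed.

Lemma double_series_bounded (u : nat -> nat -> R) (M : R) :
  (forall k l, 0 <= u k l) -> (forall m n, rect_sum u m n <= M) ->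
  exists s, is_double_series (V := R_NormedModule) u s /\ 0 <= s <= M.
Proof.
  intros h0 hM.
  assert (hrow : forall k, exists l, is_series (u k) l).
  { intros k. destruct (is_rseries_bounded (u k) M) as [l [hl _]]; eauto. intros n.
    eapply Rle_trans; [|apply (hM (S k) n)].
    apply (rsum_term_le (fun k => rsum (u k) n) (S k) k); [|lia].
    intros j. apply rsum_nonneg. auto. }
  set (b := fun k => proj1_sig (constructive_indefinite_description _ (hrow k))).
  assert (hb : forall k, is_series (u k) (b k)).
  { intros k. exact (proj2_sig (constructive_indefinite_description _ (hrow k))). }
  assert (hb0 : forall k, 0 <= b k).
  { intros k. apply (is_rseries_partial_le (u k) (b k) 0); auto. }
  destruct (is_rseries_bounded b M hb0) as [s [hs hsM]].
  - intros m. apply Rnot_lt_le. intros hlt.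
    destruct (rect_sum_rows u b m (rsum b m - M) h0 hb ltac:(lra)) as [n hn].
    specialize (hM m n). lra.
  - exists s. split; [exists b; auto|]. split; auto.
    exact (is_rseries_partial_le b s 0 hb0 hs).
Qed.

Lemma double_series_approx (u : nat -> nat -> R) (s eps : R) :
  (forall k l, 0 <= u k l) -> is_double_series (V := R_NormedModule) u s -> 0 < eps ->
  exists m n, s - eps < rect_sum u m n.
Proof.
  intros h0 [b [hb hs]] heps.
  destruct (proj1 (is_rseries_iff _ _) hs (eps / 2) ltac:(lra)) as [m hm].
  specialize (hm m (le_n m)). apply Rabs_def2 in hm.
  destruct (rect_sum_rows u b m (eps / 2) h0 hb ltac:(lra)) as [n hn].
  exists m, n. lra.
Qed.

(** * Taylor coefficients in two variables *)

Lemma power_series_zero (c : nat -> C) (rho : R) : 0 < rho ->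
  (forall z, Cmod z < rho -> is_cseries (fun k => c k * z ^ k)%C (RtoC 0)) ->
  forall k, c k = RtoC 0.
Proof.
  intros hrho h k. apply Cmod_eq_0. apply Rle_antisym; [|apply Cmod_ge_0].
  pose proof (cauchy_estimate (fun _ => RtoC 0) c rho 2 1 0 hrho ltac:(lra)
    (fun w _ => lq_const _ w) h) as hk.
  eapply Rle_trans; [apply hk; intros; rewrite Cmod_0; lra|]. lra.
Qed.

Lemma in_ball2_small (z1 z2 : C) : Cmod z1 < / 2 -> Cmod z2 < / 2 -> in_ball2 z1 z2.
Proof.
  unfold in_ball2. intros h1 h2. pose proof (Cmod_ge_0 z1). pose proof (Cmod_ge_0 z2). nra.
Qed.

(** [is_D_norm] only asserts that some coefficients exist; lower bounds on norms need to know which.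
    One-variable uniqueness is applied in [z1] for fixed [z2], then in [z2]. *)
Lemma has_taylor2_unique (F : C -> C -> C) (a a' : nat -> nat -> C) :
  has_taylor2 F a -> has_taylor2 F a' -> forall k l, a k l = a' k l.
Proof.
  intros h h'.
  assert (hrow : forall a0, has_taylor2 F a0 -> forall y, Cmod y < / 2 -> exists r,
    (forall k, is_cseries (fun l => a0 k l * y ^ l)%C (r k)) /\
    forall z, Cmod z < / 2 -> is_cseries (fun k => r k * z ^ k)%C (F z y)).
  { intros a0 ha y hy.
    assert (hr : forall k, exists r, is_cseries (fun l => a0 k l * y ^ l)%C r).
    (* A nonzero first variable, so that row [k] can be divided by [z0 ^ k]. *)
    { intros k. set (z0 := RtoC (/ 4)).
      assert (hz0 : z0 <> RtoC 0) by (unfold z0; intros e; apply RtoC_inj in e; lra).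
      destruct (ha z0 y) as [_ [b [hb _]]].
      { apply in_ball2_small; auto. unfold z0. rewrite Cmod_R, Rabs_pos_eq; lra. }
      exists (/ z0 ^ k * b k)%C.
      apply (is_cseries_ext (fun l => / z0 ^ k * (a0 k l * (z0 ^ k * y ^ l)))%C).
      - intros l. field. now apply Cpow_nz.
      - apply is_cseries_scal, (hb k). }
    set (r := fun k => proj1_sig (constructive_indefinite_description _ (hr k))).
    assert (hrk : forall k, is_cseries (fun l => a0 k l * y ^ l)%C (r k)).
    { intros k. exact (proj2_sig (constructive_indefinite_description _ (hr k))). }
    exists r. split; auto. intros z hz.
    destruct (ha z y (in_ball2_small z y hz hy)) as [_ [b [hb hs]]].
    apply (is_cseries_ext b); auto. intros k.
    apply (is_cseries_unique _ _ _ (hb k)).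
    replace (r k * z ^ k)%C with (z ^ k * r k)%C by ring.
    apply (is_cseries_ext (fun l => z ^ k * (a0 k l * y ^ l))%C); [intros; ring|].
    now apply is_cseries_scal. }
  assert (hsub : forall u v (l : C), is_cseries u l -> is_cseries v l ->
     is_cseries (fun k => u k + (- (1)) * v k)%C (RtoC 0)).
  { intros u v l hu hv. replace (RtoC 0) with (l + - (1) * l)%C by ring.
    apply is_cseries_add; auto. now apply is_cseries_scal. }
  intros k l.
  assert (hz : (a k l + - (1) * a' k l)%C = RtoC 0).
  { apply (power_series_zero (fun l => a k l + - (1) * a' k l)%C (/ 2)); [lra|]. intros y hy.
    destruct (hrow a h y hy) as [r [hr hF]]. destruct (hrow a' h' y hy) as [r' [hr' hF']].
    assert (hrr : (r k + - (1) * r' k)%C = RtoC 0).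
    { apply (power_series_zero (fun k => r k + - (1) * r' k)%C (/ 2)); [lra|]. intros z hz.
      apply (is_cseries_ext (fun k => r k * z ^ k + - (1) * (r' k * z ^ k))%C); [intros; ring|].
      eauto. }
    rewrite <- hrr.
    apply (is_cseries_ext (fun l => a k l * y ^ l + - (1) * (a' k l * y ^ l))%C); [intros; ring|].
    apply is_cseries_add; auto. now apply is_cseries_scal. }
  replace (a k l) with (a k l + - (1) * a' k l + a' k l)%C by ring. rewrite hz. ring.
Qed.

Definition abs_bounded (a : nat -> nat -> C) (z1 z2 : C) : Prop :=
  exists M, forall m n, rect_sum (fun k l => Cmod (a k l * (z1 ^ k * z2 ^ l))%C) m n <= M.

Lemma has_taylor2_intro (F : C -> C -> C) (a : nat -> nat -> C) :
  (forall z1 z2, in_ball2 z1 z2 -> abs_bounded a z1 z2 /\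
     exists b, (forall k, is_cseries (fun l => a k l * (z1 ^ k * z2 ^ l))%C (b k)) /\
               is_cseries b (F z1 z2)) ->
  has_taylor2 F a.
Proof.
  intros h z1 z2 hz. destruct (h z1 z2 hz) as [[M hM] hb]. split; [|exact hb].
  destruct (double_series_bounded (fun k l => Cmod (a k l * (z1 ^ k * z2 ^ l))%C) M
    (fun k l => Cmod_ge_0 _) hM) as [s [hs _]]. now exists s.
Qed.

Lemma has_taylor2_elim (F : C -> C -> C) (a : nat -> nat -> C) (z1 z2 : C) :
  has_taylor2 F a -> in_ball2 z1 z2 -> abs_bounded a z1 z2 /\
     exists b, (forall k, is_cseries (fun l => a k l * (z1 ^ k * z2 ^ l))%C (b k)) /\
               is_cseries b (F z1 z2).
Proof.
  intros h hz. destruct (h z1 z2 hz) as [[s hs] hb]. split; [|exact hb].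
  exists s. intros m n. apply double_series_rect_le; auto. intros. apply Cmod_ge_0.
Qed.

Lemma has_taylor2_ext (F G : C -> C -> C) (a b : nat -> nat -> C) :
  (forall z1 z2, in_ball2 z1 z2 -> F z1 z2 = G z1 z2) -> (forall k l, a k l = b k l) ->
  has_taylor2 F a -> has_taylor2 G b.
Proof.
  intros hFG hab h. apply has_taylor2_intro. intros z1 z2 hz.
  destruct (has_taylor2_elim F a z1 z2 h hz) as [[M hM] [c [hc hs]]]. split.
  - exists M. intros m n. eapply Rle_trans; [|apply (hM m n)]. right. unfold rect_sum.
    apply rsum_ext. intros k _. apply rsum_ext. intros l _. now rewrite hab.
  - exists c. rewrite <- hFG by auto. split; auto. intros k.
    apply (is_cseries_ext (fun l => a k l * (z1 ^ k * z2 ^ l))%C); auto.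
    intros l. now rewrite hab.
Qed.

Lemma rect_sum_add (u v : nat -> nat -> R) (m n : nat) :
  rect_sum (fun k l => u k l + v k l) m n = rect_sum u m n + rect_sum v m n.
Proof.
  unfold rect_sum. rewrite <- rsum_add. apply rsum_ext. intros. apply rsum_add.
Qed.

Lemma rect_sum_scal (c : R) (u : nat -> nat -> R) (m n : nat) :
  rect_sum (fun k l => c * u k l) m n = c * rect_sum u m n.
Proof.
  unfold rect_sum. rewrite <- rsum_scal. apply rsum_ext. intros. apply rsum_scal.
Qed.

Lemma rect_sum_le (u v : nat -> nat -> R) (m n : nat) :
  (forall k l, u k l <= v k l) -> rect_sum u m n <= rect_sum v m n.
Proof. intros h. apply rsum_le. intros. now apply rsum_le. Qed.

Lemma has_taylor2_add (F G : C -> C -> C) (a b : nat -> nat -> C) :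
  has_taylor2 F a -> has_taylor2 G b ->
  has_taylor2 (fun z1 z2 => F z1 z2 + G z1 z2)%C (fun k l => a k l + b k l)%C.
Proof.
  intros hF hG. apply has_taylor2_intro. intros z1 z2 hz.
  destruct (has_taylor2_elim F a z1 z2 hF hz) as [[M hM] [c [hc hs]]].
  destruct (has_taylor2_elim G b z1 z2 hG hz) as [[M' hM'] [c' [hc' hs']]]. split.
  - exists (M + M'). intros m n.
    eapply Rle_trans; [|apply (Rplus_le_compat _ _ _ _ (hM m n) (hM' m n))].
    rewrite <- rect_sum_add. apply rect_sum_le. intros k l.
    rewrite Cmult_plus_distr_r. apply Cmod_triangle.
  - exists (fun k => c k + c' k)%C. split; [|now apply is_cseries_add]. intros k.
    apply (is_cseries_ext (fun l => a k l * (z1 ^ k * z2 ^ l) + b k l * (z1 ^ k * z2 ^ l))%C).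
    + intros. ring.
    + now apply is_cseries_add.
Qed.

Lemma has_taylor2_scal (s : C) (F : C -> C -> C) (a : nat -> nat -> C) :
  has_taylor2 F a -> has_taylor2 (fun z1 z2 => s * F z1 z2)%C (fun k l => s * a k l)%C.
Proof.
  intros hF. apply has_taylor2_intro. intros z1 z2 hz.
  destruct (has_taylor2_elim F a z1 z2 hF hz) as [[M hM] [c [hc hs]]]. split.
  - exists (Cmod s * M). intros m n.
    apply Rle_trans with (Cmod s * rect_sum (fun k l => Cmod (a k l * (z1 ^ k * z2 ^ l))%C) m n).
    + rewrite <- rect_sum_scal. apply rect_sum_le. intros k l.
      rewrite <- Cmod_mult. right. f_equal. ring.
    + apply Rmult_le_compat_l; [apply Cmod_ge_0|auto].
  - exists (fun k => s * c k)%C. split; [|now apply is_cseries_scal]. intros k.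
    apply (is_cseries_ext (fun l => s * (a k l * (z1 ^ k * z2 ^ l)))%C); [intros; ring|].
    now apply is_cseries_scal.
Qed.

Definition shift1 (a : nat -> nat -> C) (k l : nat) : C :=
  match k with 0%nat => RtoC 0 | S j => a j l end.

Definition shift2 (a : nat -> nat -> C) (k l : nat) : C :=
  match l with 0%nat => RtoC 0 | S j => a k j end.

Lemma is_cseries_cons (u : nat -> C) (l : C) :
  is_cseries u l -> is_cseries (fun k => match k with 0%nat => RtoC 0 | S j => u j end) l.
Proof.
  rewrite !is_cseries_iff. intros h eps heps. destruct (h eps heps) as [N hN].
  exists (S N). intros [|n] hn; [lia|]. rewrite csum_head, Cplus_0_l. apply hN. lia.
Qed.

Lemma is_cseries_zero (u : nat -> C) : (forall k, u k = RtoC 0) -> is_cseries u (RtoC 0).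
Proof. intros h. apply (is_cseries_finite u 0). auto. Qed.

Lemma rect_sum_shift1 (u v : nat -> nat -> R) (m n : nat) :
  (forall k l, 0 <= v k l) ->
  (forall l, u 0%nat l = 0) -> (forall k l, u (S k) l <= v k l) -> rect_sum u m n <= rect_sum v m n.
Proof.
  intros h0 hz hS. destruct m; [unfold rect_sum; simpl; lra|]. unfold rect_sum at 1.
  rewrite rsum_head, (rsum_ext (u 0%nat) (fun _ => 0)) by auto. rewrite rsum_const0, Rplus_0_l.
  apply Rle_trans with (rect_sum v m n); [|apply rect_sum_mono; auto].
  apply rsum_le. intros k _. now apply rsum_le.
Qed.

Lemma rect_sum_shift2 (u v : nat -> nat -> R) (m n : nat) :
  (forall k l, 0 <= v k l) ->
  (forall k, u k 0%nat = 0) -> (forall k l, u k (S l) <= v k l) -> rect_sum u m n <= rect_sum v m n.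
Proof.
  intros h0 hz hS. apply rsum_le. intros k _. destruct n; [simpl; lra|].
  rewrite rsum_head, hz, Rplus_0_l.
  apply Rle_trans with (rsum (v k) n); [now apply rsum_le|apply rsum_mono; auto].
Qed.

Lemma has_taylor2_shift1 (F : C -> C -> C) (a : nat -> nat -> C) :
  has_taylor2 F a -> has_taylor2 (fun z1 z2 => z1 * F z1 z2)%C (shift1 a).
Proof.
  intros hF. apply has_taylor2_intro. intros z1 z2 hz.
  destruct (has_taylor2_elim F a z1 z2 hF hz) as [[M hM] [c [hc hs]]]. split.
  - exists (Cmod z1 * M). intros m n.
    apply Rle_trans with (Cmod z1 * rect_sum (fun k l => Cmod (a k l * (z1 ^ k * z2 ^ l))%C) m n).
    + rewrite <- rect_sum_scal. apply rect_sum_shift1.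
      * intros. apply Rmult_le_pos; apply Cmod_ge_0.
      * intros. simpl. rewrite Cmult_0_l. apply Cmod_0.
      * intros k l. rewrite <- Cmod_mult. simpl. right. f_equal. ring.
    + apply Rmult_le_compat_l; [apply Cmod_ge_0|auto].
  - exists (fun k => match k with 0%nat => RtoC 0 | S j => (z1 * c j)%C end). split.
    + intros [|k]; simpl.
      * apply is_cseries_zero. intros. ring.
      * apply (is_cseries_ext (fun l => z1 * (a k l * (z1 ^ k * z2 ^ l)))%C); [intros; ring|].
        now apply is_cseries_scal.
    + apply is_cseries_cons. now apply is_cseries_scal.
Qed.

Lemma has_taylor2_shift2 (F : C -> C -> C) (a : nat -> nat -> C) :
  has_taylor2 F a -> has_taylor2 (fun z1 z2 => z2 * F z1 z2)%C (shift2 a).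
Proof.
  intros hF. apply has_taylor2_intro. intros z1 z2 hz.
  destruct (has_taylor2_elim F a z1 z2 hF hz) as [[M hM] [c [hc hs]]]. split.
  - exists (Cmod z2 * M). intros m n.
    apply Rle_trans with (Cmod z2 * rect_sum (fun k l => Cmod (a k l * (z1 ^ k * z2 ^ l))%C) m n).
    + rewrite <- rect_sum_scal. apply rect_sum_shift2.
      * intros. apply Rmult_le_pos; apply Cmod_ge_0.
      * intros. simpl. rewrite Cmult_0_l. apply Cmod_0.
      * intros k l. rewrite <- Cmod_mult. simpl. right. f_equal. ring.
    + apply Rmult_le_compat_l; [apply Cmod_ge_0|auto].
  - exists (fun k => z2 * c k)%C. split; [|now apply is_cseries_scal]. intros k.
    apply (is_cseries_ext (fun l => match l with 0%nat => RtoC 0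
        | S j => (z2 * (a k j * (z1 ^ k * z2 ^ j)))%C end)).
    + intros [|l]; simpl; ring.
    + apply is_cseries_cons. now apply is_cseries_scal.
Qed.

Definition diag (e : nat -> C) (k l : nat) : C := if Nat.eq_dec k l then e k else RtoC 0.

Lemma is_cseries_single (u : nat -> C) (k : nat) :
  (forall j, j <> k -> u j = RtoC 0) -> is_cseries u (u k).
Proof.
  intros h. rewrite <- (csum_single u (S k) k); [|lia|intros; auto].
  apply is_cseries_finite. intros. apply h. lia.
Qed.

Lemma Cmod_mult_in_ball2 (z1 z2 : C) : in_ball2 z1 z2 -> 2 * Cmod (z1 * z2) < 1.
Proof.
  unfold in_ball2. rewrite Cmod_mult. intros h. pose proof (pow2_ge_0 (Cmod z1 - Cmod z2)). nra.
Qed.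

Lemma rsum_diag_row_le (u : nat -> R) (k n : nat) : 0 <= u k ->
  rsum (fun l => if Nat.eq_dec k l then u k else 0) n <= u k.
Proof.
  intros h. enough (rsum (fun l => if Nat.eq_dec k l then u k else 0) n
    = if le_dec n k then 0 else u k) by (destruct (le_dec n k); lra).
  induction n; simpl; [auto|]. rewrite IHn.
  destruct (Nat.eq_dec k n), (le_dec n k), (le_dec (S n) k); try lia; lra.
Qed.

(** On the ball [|z1 z2| < 1/2], so growth of ratio [2] is just enough. *)
Lemma has_taylor2_diag (F : C -> C -> C) (e : nat -> C) :
  geo 2 e -> (forall z1 z2, in_ball2 z1 z2 -> F z1 z2 = psum e (z1 * z2)%C) ->
  has_taylor2 F (diag e).
Proof.
  intros he hF. apply has_taylor2_intro. intros z1 z2 hz.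
  pose proof (Cmod_mult_in_ball2 z1 z2 hz) as hlt.
  pose proof (psum_correct 2 e (z1 * z2)%C ltac:(lra) he hlt) as hs.
  destruct he as [K [hK he]].
  assert (hx : 0 <= 2 * Cmod (z1 * z2) < 1) by (pose proof (Cmod_ge_0 (z1 * z2)); lra).
  split.
  - exists (K * / (1 - 2 * Cmod (z1 * z2))). intros m n.
    apply Rle_trans with (rsum (fun k => K * (2 * Cmod (z1 * z2)) ^ k) m).
    + apply rsum_le. intros k _.
      rewrite (rsum_ext _ (fun l => if Nat.eq_dec k l then Cmod (e k * (z1 * z2) ^ k) else 0)).
      * eapply Rle_trans; [apply (rsum_diag_row_le (fun k => Cmod (e k * (z1 * z2) ^ k)))|].
        -- apply Cmod_ge_0.
        -- now apply geo_term_le.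
      * intros l _. unfold diag. destruct (Nat.eq_dec k l) as [<-|]; [now rewrite Cpow_mult_l|].
        rewrite Cmult_0_l. apply Cmod_0.
    + rewrite rsum_scal. apply Rmult_le_compat_l; [lra|]. now apply rsum_geom_le.
  - exists (fun k => e k * (z1 * z2) ^ k)%C. rewrite hF by auto. split; auto. intros k.
    replace (e k * (z1 * z2) ^ k)%C with (diag e k k * (z1 ^ k * z2 ^ k))%C.
    + apply (is_cseries_single (fun l => diag e k l * (z1 ^ k * z2 ^ l))%C). intros j hj. unfold diag.
      destruct (Nat.eq_dec k j); [congruence|ring].
    + unfold diag. destruct (Nat.eq_dec k k); [|congruence]. now rewrite Cpow_mult_l.
Qed.

(* A polynomial in two variables, as a list of monomials (coefficient, exponents). *)
Definition poly := list (C * nat * nat).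

Fixpoint peval (p : poly) (z1 z2 : C) : C :=
  match p with
  | nil => RtoC 0
  | (c, i, j) :: q => (c * (z1 ^ i * z2 ^ j) + peval q z1 z2)%C
  end.

(** Coefficients of [p F] when [F] has coefficients [a]. Iterated unit shifts reduce expansions and
    norm bounds to multiplication by one variable. *)
Fixpoint pcoef (p : poly) (a : nat -> nat -> C) (k l : nat) : C :=
  match p with
  | nil => RtoC 0
  | (c, i, j) :: q =>
      (c * Nat.iter i shift1 (Nat.iter j shift2 a) k l + pcoef q a k l)%C
  end.

Definition pdegree_le (d : nat) (p : poly) : Prop :=
  forall c i j, In (c, i, j) p -> (i + j <= d)%nat.

Lemma has_taylor2_poly (p : poly) (F : C -> C -> C) (a : nat -> nat -> C) :
  has_taylor2 F a -> has_taylor2 (fun z1 z2 => peval p z1 z2 * F z1 z2)%C (pcoef p a).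
Proof.
  intros hF. induction p as [|[[c i] j] p IH]; simpl.
  - apply (has_taylor2_ext (fun z1 z2 => 0 * F z1 z2)%C _ (fun k l => 0 * a k l)%C).
    + intros. ring.
    + intros. ring.
    + now apply has_taylor2_scal.
  - assert (hj : has_taylor2 (fun z1 z2 => z2 ^ j * F z1 z2)%C (Nat.iter j shift2 a)).
    { induction j; simpl.
      - apply (has_taylor2_ext F _ a); auto. intros. ring.
      - apply (has_taylor2_ext (fun z1 z2 => z2 * (z2 ^ j * F z1 z2))%C _ (shift2 (Nat.iter j shift2 a)));
          auto; [intros; ring|]. now apply (has_taylor2_shift2 (fun z1 z2 => z2 ^ j * F z1 z2)%C). }
    assert (hi : has_taylor2 (fun z1 z2 => z1 ^ i * (z2 ^ j * F z1 z2))%C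
       (Nat.iter i shift1 (Nat.iter j shift2 a))).
    { induction i; simpl.
      - apply (has_taylor2_ext (fun z1 z2 => z2 ^ j * F z1 z2)%C _ (Nat.iter j shift2 a)); auto.
        intros. ring.
      - apply (has_taylor2_ext (fun z1 z2 => z1 * (z1 ^ i * (z2 ^ j * F z1 z2)))%C _
           (shift1 (Nat.iter i shift1 (Nat.iter j shift2 a)))); auto; [intros; ring|].
        now apply (has_taylor2_shift1 (fun z1 z2 => z1 ^ i * (z2 ^ j * F z1 z2))%C). }
    apply (has_taylor2_ext (fun z1 z2 => c * (z1 ^ i * (z2 ^ j * F z1 z2)) + peval p z1 z2 * F z1 z2)%C _
      (fun k l => c * Nat.iter i shift1 (Nat.iter j shift2 a) k l + pcoef p a k l)%C); auto.
    + intros. ring.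
    + apply (has_taylor2_add (fun z1 z2 => c * (z1 ^ i * (z2 ^ j * F z1 z2)))%C); auto.
      now apply (has_taylor2_scal c (fun z1 z2 => z1 ^ i * (z2 ^ j * F z1 z2))%C).
Qed.

Lemma peval_app (p q : poly) (z1 z2 : C) :
  peval (p ++ q) z1 z2 = (peval p z1 z2 + peval q z1 z2)%C.
Proof. induction p as [|[[c i] j] p IH]; simpl; [ring|]. rewrite IH. ring. Qed.

Fixpoint pmul (p q : poly) : poly :=
  match p with
  | nil => nil
  | (c, i, j) :: p' =>
      map (fun m => match m with (c', i', j') => ((c * c')%C, (i + i')%nat, (j + j')%nat) end) q
        ++ pmul p' q
  end.

Lemma peval_mul (p q : poly) (z1 z2 : C) :
  peval (pmul p q) z1 z2 = (peval p z1 z2 * peval q z1 z2)%C.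
Proof.
  induction p as [|[[c i] j] p IH]; simpl; [ring|]. rewrite peval_app, IH.
  rewrite Cmult_plus_distr_r. f_equal. clear IH.
  induction q as [|[[c' i'] j'] q IHq]; simpl; [ring|]. rewrite IHq, !Cpow_add_r. ring.
Qed.

Lemma sum_tri_csum (d : nat) (u : nat -> nat -> C) :
  sum_tri d u = csum (fun k => csum (u k) (S (d - k))) (S d).
Proof.
  unfold sum_tri. rewrite sum_n_csum. apply csum_ext. intros. apply sum_n_csum.
Qed.

Lemma sum_tri_ext (d : nat) (u v : nat -> nat -> C) :
  (forall k l, u k l = v k l) -> sum_tri d u = sum_tri d v.
Proof.
  intros h. rewrite !sum_tri_csum. apply csum_ext. intros. apply csum_ext. auto.
Qed.

(** [X] is free so that one statement serves [poly2], with [X = 1], and [in_shift_span], with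
    [X = F z1 z2]. *)
Lemma sum_tri_poly (d : nat) (c : nat -> nat -> C) :
  exists p, pdegree_le d p /\ forall z1 z2 X,
    sum_tri d (fun k l => c k l * (z1 ^ k * z2 ^ l * X))%C = (peval p z1 z2 * X)%C.
Proof.
  assert (hrow : forall k n, exists p, (forall c0 i j, In (c0, i, j) p -> i = k /\ (j < n)%nat) /\
    forall z1 z2 X, csum (fun l => c k l * (z1 ^ k * z2 ^ l * X))%C n = (peval p z1 z2 * X)%C).
  { intros k n. induction n as [|n [p [hp he]]].
    - exists nil. split; [intros c0 i j []|]. intros. simpl. ring.
    - exists ((c k n, k, n) :: p). split.
      + intros c0 i j [h|h]; [injection h; intros; subst; lia|]. destruct (hp _ _ _ h). lia.
      + intros. simpl. rewrite he. ring. }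
  assert (hall : forall m, exists p, (forall c0 i j, In (c0, i, j) p -> (i < m)%nat /\ (j <= d - i)%nat) /\
    forall z1 z2 X, csum (fun k => csum (fun l => c k l * (z1 ^ k * z2 ^ l * X))%C (S (d - k))) m
       = (peval p z1 z2 * X)%C).
  { induction m as [|m [p [hp he]]].
    - exists nil. split; [intros c0 i j []|]. intros. simpl. ring.
    - destruct (hrow m (S (d - m))) as [p' [hp' he']]. exists (p' ++ p). split.
      + intros c0 i j h. apply in_app_or in h. destruct h as [h|h].
        * destruct (hp' _ _ _ h). subst. lia.
        * destruct (hp _ _ _ h). lia.
      + intros. change (csum ?u (S m)) with (csum u m + u m)%C. cbv beta.
        rewrite he, he', peval_app. ring. }
  destruct (hall (S d)) as [p [hp he]]. exists p. split.
  - intros c0 i j h. destruct (hp _ _ _ h). lia.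
  - intros. rewrite sum_tri_csum. apply he.
Qed.

Lemma poly_sum_tri (d : nat) (p : poly) : pdegree_le d p ->
  exists c, forall z1 z2 X,
    sum_tri d (fun k l => c k l * (z1 ^ k * z2 ^ l * X))%C = (peval p z1 z2 * X)%C.
Proof.
  induction p as [|[[c0 i] j] p IH]; intros hp.
  - exists (fun _ _ => RtoC 0). intros. rewrite sum_tri_csum. simpl peval.
    rewrite csum_zero; [ring|]. intros. apply csum_zero. intros. ring.
  - destruct IH as [c hc]; [intros c1 i1 j1 h; apply (hp c1); simpl; auto|].
    assert (hij : (i + j <= d)%nat) by (apply (hp c0); simpl; auto).
    exists (fun k l => c k l + (if Nat.eq_dec k i then if Nat.eq_dec l j then c0 else RtoC 0 else RtoC 0))%C.
    intros z1 z2 X. simpl peval.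
    transitivity (sum_tri d (fun k l => c k l * (z1 ^ k * z2 ^ l * X))%C
      + sum_tri d (fun k l => (if Nat.eq_dec k i then if Nat.eq_dec l j then c0 else RtoC 0 else RtoC 0)
           * (z1 ^ k * z2 ^ l * X))%C)%C.
    + rewrite !sum_tri_csum, <- csum_add. apply csum_ext. intros k _.
      rewrite <- csum_add. apply csum_ext. intros. ring.
    + rewrite hc, sum_tri_csum, (csum_single _ (S d) i), (csum_single _ (S (d - i)) j); try lia.
      * destruct (Nat.eq_dec i i), (Nat.eq_dec j j); try congruence. ring.
      * intros l _ hl. destruct (Nat.eq_dec i i), (Nat.eq_dec l j); try congruence; ring.
      * intros k _ hk. apply csum_zero. intros l _. destruct (Nat.eq_dec k i); [congruence|ring].
Qed.

Lemma pdegree_exists (p : poly) : exists d, pdegree_le d p.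
Proof.
  induction p as [|[[c i] j] p [d hd]]; [exists 0%nat; intros c i j []|].
  exists (i + j + d)%nat. intros c' i' j' [h|h].
  - injection h; intros; subst. lia.
  - specialize (hd _ _ _ h). lia.
Qed.

Fixpoint pdiag (p : poly) (m : nat) : C :=
  match p with
  | nil => RtoC 0
  | (c, i, j) :: q =>
      ((if Nat.eq_dec i j then if Nat.eq_dec m i then c else RtoC 0 else RtoC 0) + pdiag q m)%C
  end.

(** The diagonal monomial [(z1 z2)^k] has degree [2 k]: total degree [2 n] becomes degree [n] in one
    variable. *)
Lemma pdiag_support (n : nat) (p : poly) : pdegree_le (2 * n) p ->
  forall k, (n < k)%nat -> pdiag p k = RtoC 0.
Proof.
  induction p as [|[[c i] j] p IH]; intros hp k hk; [reflexivity|]. simpl.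
  rewrite IH; auto; [|intros c1 i1 j1 h; apply (hp c1); simpl; auto].
  assert (hij : (i + j <= 2 * n)%nat) by (apply (hp c); simpl; auto).
  destruct (Nat.eq_dec i j), (Nat.eq_dec k i); try lia; ring.
Qed.

Lemma shift1_iter (i : nat) (a : nat -> nat -> C) (k l : nat) :
  Nat.iter i shift1 a k l = if le_dec i k then a (k - i)%nat l else RtoC 0.
Proof.
  revert k. induction i; intros k; simpl.
  - now rewrite Nat.sub_0_r.
  - destruct k; simpl; [reflexivity|]. rewrite IHi.
    destruct (le_dec i k), (le_dec (S i) (S k)); auto; lia.
Qed.

Lemma shift2_iter (j : nat) (a : nat -> nat -> C) (k l : nat) :
  Nat.iter j shift2 a k l = if le_dec j l then a k (l - j)%nat else RtoC 0.
Proof.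
  revert l. induction j; intros l; simpl.
  - now rewrite Nat.sub_0_r.
  - destruct l; simpl; [reflexivity|]. rewrite IHj.
    destruct (le_dec j l), (le_dec (S j) (S l)); auto; lia.
Qed.

(** A monomial [z1^i z2^j] moves the diagonal by [i - j], so only those with [i = j] contribute. *)
Lemma pcoef_diag (p : poly) (a : nat -> C) (k : nat) :
  pcoef p (diag a) k k = conv (pdiag p) a k.
Proof.
  induction p as [|[[c i] j] p IH]; simpl.
  - rewrite conv_zero_l; auto.
  - rewrite (conv_add_l (fun m => if Nat.eq_dec i j then if Nat.eq_dec m i then c else RtoC 0 else RtoC 0)), IH.
    f_equal. rewrite shift1_iter, conv_csum.
    destruct (Nat.eq_dec i j) as [<-|hij].
    + destruct (le_dec i k) as [hik|hik].
      * rewrite shift2_iter. destruct (le_dec i k); [|lia].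
        rewrite (csum_single _ (S k) i); [|lia|].
        -- unfold diag. destruct (Nat.eq_dec i i), (Nat.eq_dec (k - i) (k - i)); congruence.
        -- intros m _ hm. destruct (Nat.eq_dec m i); [congruence|ring].
      * rewrite csum_zero; [ring|]. intros m hm. destruct (Nat.eq_dec m i); [lia|ring].
    + rewrite csum_zero by (intros; ring).
      destruct (le_dec i k); [|ring]. rewrite shift2_iter. destruct (le_dec j k); [|ring].
      unfold diag. destruct (Nat.eq_dec (k - i) (k - j)); [lia|ring].
Qed.

(** * Squared norms of coefficient arrays *)

Definition norm2_le (alpha : R) (a : nat -> nat -> C) (M : R) : Prop :=
  forall m n, rect_sum (fun k l => D_weight alpha k l * Cmod (a k l) ^ 2) m n <= M.

Lemma D_weight_pos (alpha : R) (k l : nat) : 0 < D_weight alpha k l.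
Proof.
  unfold D_weight. apply Rmult_lt_0_compat; [apply exp_pos|].
  apply Rdiv_lt_0_compat; [apply Rmult_lt_0_compat|]; apply INR_fact_lt_0.
Qed.

Lemma D_term_nonneg (alpha : R) (a : nat -> nat -> C) (k l : nat) :
  0 <= D_weight alpha k l * Cmod (a k l) ^ 2.
Proof. apply Rmult_le_pos; [left; apply D_weight_pos|apply pow2_ge_0]. Qed.

Lemma is_D_norm_intro (alpha : R) (F : C -> C -> C) (a : nat -> nat -> C) (M : R) :
  has_taylor2 F a -> norm2_le alpha a M -> exists N, is_D_norm alpha F N /\ N ^ 2 <= M.
Proof.
  intros hF hM.
  destruct (double_series_bounded _ M (D_term_nonneg alpha a) hM) as [s [hs hsM]].
  exists (sqrt s). rewrite pow2_sqrt by lra. split; [|lra]. split; [apply sqrt_pos|].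
  exists a. rewrite pow2_sqrt by lra. auto.
Qed.

Lemma is_D_norm_coef (alpha : R) (F : C -> C -> C) (a : nat -> nat -> C) (N : R) :
  has_taylor2 F a -> is_D_norm alpha F N ->
  0 <= N /\ is_double_series (V := R_NormedModule) (fun k l => D_weight alpha k l * Cmod (a k l) ^ 2) (N ^ 2).
Proof.
  intros hF [hN [a' [hF' [b [hb hs]]]]]. split; auto. exists b. split; auto. intros k.
  apply (is_series_ext (fun l => D_weight alpha k l * Cmod (a' k l) ^ 2)); auto. intros l.
  now rewrite (has_taylor2_unique F a a' hF hF').
Qed.

Lemma norm2_le_add (alpha : R) (a b : nat -> nat -> C) (M N : R) :
  norm2_le alpha a M -> norm2_le alpha b N -> norm2_le alpha (fun k l => a k l + b k l)%C (2 * M + 2 * N).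
Proof.
  intros ha hb m n.
  apply Rle_trans with (2 * rect_sum (fun k l => D_weight alpha k l * Cmod (a k l) ^ 2) m n
    + 2 * rect_sum (fun k l => D_weight alpha k l * Cmod (b k l) ^ 2) m n).
  - rewrite <- !rect_sum_scal, <- rect_sum_add. apply rect_sum_le. intros k l.
    pose proof (Cmod_add_sqr_le (a k l) (b k l)). pose proof (D_weight_pos alpha k l). nra.
  - specialize (ha m n). specialize (hb m n). lra.
Qed.

Lemma norm2_le_scal (alpha : R) (s : C) (a : nat -> nat -> C) (M : R) :
  norm2_le alpha a M -> norm2_le alpha (fun k l => s * a k l)%C (Cmod s ^ 2 * M).
Proof.
  intros h m n.
  apply Rle_trans with (Cmod s ^ 2 * rect_sum (fun k l => D_weight alpha k l * Cmod (a k l) ^ 2) m n).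
  - rewrite <- rect_sum_scal. apply rect_sum_le. intros. rewrite Cmod_mult. right. ring.
  - apply Rmult_le_compat_l; [apply pow2_ge_0|apply h].
Qed.

Lemma Rpower_S_le (alpha : R) (n : nat) :
  Rpower (INR (S (S n))) alpha <= Rpower 2 (Rabs alpha) * Rpower (INR (S n)) alpha.
Proof.
  pose proof (INR_S_ge_1 n) as hx. rewrite (S_INR (S n)). set (x := INR (S n)) in *.
  assert (h2 : 1 <= Rpower 2 (Rabs alpha)).
  { apply Rle_trans with (Rpower 2 0); [rewrite Rpower_O; lra|]. apply Rle_Rpower; [lra|apply Rabs_pos]. }
  destruct (Rle_dec 0 alpha) as [ha|ha].
  - rewrite Rabs_pos_eq by auto. rewrite Rpower_mult_distr by lra. apply Rle_Rpower_l; lra.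
  - apply Rle_trans with (1 * Rpower x alpha).
    + rewrite Rmult_1_l. replace alpha with (- - alpha) by ring. rewrite !(Rpower_Ropp _ (- alpha)).
      apply Rinv_le_contravar; [apply exp_pos|]. apply Rle_Rpower_l; lra.
    + apply Rmult_le_compat_r; [left; apply exp_pos|auto].
Qed.

Lemma D_weight_sym (alpha : R) (k l : nat) : D_weight alpha k l = D_weight alpha l k.
Proof.
  unfold D_weight. replace (2 + l + k)%nat with (2 + k + l)%nat by lia.
  replace (1 + l + k)%nat with (1 + k + l)%nat by lia. f_equal. unfold Rdiv. ring.
Qed.

(** The quotient of factorials changes by [(k + 1) / (k + l + 2) <= 1], and the power by at most
    [2^|alpha|]; so multiplication by a variable is bounded. *)
Lemma D_weight_shift (alpha : R) (k l : nat) :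
  D_weight alpha (S k) l <= Rpower 2 (Rabs alpha) * D_weight alpha k l.
Proof.
  unfold D_weight. pose proof (Rpower_S_le alpha (1 + k + l)) as h.
  change (2 + S k + l)%nat with (S (S (1 + k + l))). change (2 + k + l)%nat with (S (1 + k + l)).
  change (1 + S k + l)%nat with (S (1 + k + l)).
  rewrite <- Rmult_assoc. apply Rmult_le_compat; auto.
  - left. apply exp_pos.
  - apply Rdiv_le_0_compat; [apply Rmult_le_pos; left; apply INR_fact_lt_0|apply INR_fact_lt_0].
  - rewrite (fact_simpl k), (fact_simpl (1 + k + l)), !mult_INR.
    pose proof (INR_fact_lt_0 k). pose proof (INR_fact_lt_0 l). pose proof (INR_fact_lt_0 (1 + k + l)).
     pose proof (INR_S_ge_1 (1 + k + l)).
    assert (hle : INR (S k) / INR (S (1 + k + l)) <= 1).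
    { apply (Rmult_le_reg_r (INR (S (1 + k + l)))); [lra|]. unfold Rdiv.
      rewrite Rmult_assoc, Rinv_l, Rmult_1_l, Rmult_1_r by lra. apply le_INR. lia. }
    set (P := INR (fact k) * INR (fact l) / INR (fact (1 + k + l))).
    assert (hP : 0 < P) by (unfold P; apply Rdiv_lt_0_compat; auto; now apply Rmult_lt_0_compat).
    replace (INR (S k) * INR (fact k) * INR (fact l) / (INR (S (1 + k + l)) * INR (fact (1 + k + l))))
      with (INR (S k) / INR (S (1 + k + l)) * P) by (unfold P; field; lra).
    nra.
Qed.

Lemma norm2_le_shift1 (alpha : R) (a : nat -> nat -> C) (M : R) :
  norm2_le alpha a M -> norm2_le alpha (shift1 a) (Rpower 2 (Rabs alpha) * M).
Proof.
  intros h m n. pose proof (exp_pos (Rabs alpha * ln 2)) as hp. fold (Rpower 2 (Rabs alpha)) in hp.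
  apply Rle_trans with (Rpower 2 (Rabs alpha)
     * rect_sum (fun k l => D_weight alpha k l * Cmod (a k l) ^ 2) m n).
  - rewrite <- rect_sum_scal. apply rect_sum_shift1.
    + intros. apply Rmult_le_pos; [lra|apply D_term_nonneg].
    + intros. simpl shift1. rewrite Cmod_0. ring.
    + intros k l. simpl shift1. rewrite <- Rmult_assoc.
      apply Rmult_le_compat_r; [apply pow2_ge_0|apply D_weight_shift].
  - apply Rmult_le_compat_l; [lra|apply h].
Qed.

Lemma norm2_le_shift2 (alpha : R) (a : nat -> nat -> C) (M : R) :
  norm2_le alpha a M -> norm2_le alpha (shift2 a) (Rpower 2 (Rabs alpha) * M).
Proof.
  intros h m n. pose proof (exp_pos (Rabs alpha * ln 2)) as hp. fold (Rpower 2 (Rabs alpha)) in hp.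
  apply Rle_trans with (Rpower 2 (Rabs alpha)
     * rect_sum (fun k l => D_weight alpha k l * Cmod (a k l) ^ 2) m n).
  - rewrite <- rect_sum_scal. apply rect_sum_shift2.
    + intros. apply Rmult_le_pos; [lra|apply D_term_nonneg].
    + intros. simpl shift2. rewrite Cmod_0. ring.
    + intros k l. simpl shift2. rewrite <- Rmult_assoc.
      apply Rmult_le_compat_r; [apply pow2_ge_0|].
      rewrite D_weight_sym, (D_weight_sym alpha k l). apply D_weight_shift.
  - apply Rmult_le_compat_l; [lra|apply h].
Qed.

Lemma norm2_le_poly (alpha : R) (p : poly) :
  exists K, 0 <= K /\ forall a M, norm2_le alpha a M -> norm2_le alpha (pcoef p a) (K * M).
Proof.
  induction p as [|[[c i] j] p [K [hK IH]]].
  - exists 0. split; [lra|]. intros a M _ m n. simpl. rewrite Rmult_0_l.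
    right. unfold rect_sum. rewrite (rsum_ext _ (fun _ => 0)); [apply rsum_const0|].
    intros. rewrite (rsum_ext _ (fun _ => 0)); [apply rsum_const0|]. intros. rewrite Cmod_0. ring.
  - set (B := Rpower 2 (Rabs alpha)). assert (hB : 0 < B) by apply exp_pos.
    exists (2 * (Cmod c ^ 2 * (B ^ i * B ^ j)) + 2 * K). split.
    { pose proof (pow_lt B i hB). pose proof (pow_lt B j hB).
      assert (0 <= Cmod c ^ 2 * (B ^ i * B ^ j)) by (apply Rmult_le_pos; auto; nra). lra. }
    intros a M h. simpl pcoef.
    replace ((2 * (Cmod c ^ 2 * (B ^ i * B ^ j)) + 2 * K) * M)
      with (2 * (Cmod c ^ 2 * (B ^ i * (B ^ j * M))) + 2 * (K * M)) by ring.
    apply (norm2_le_add alpha (fun k l => c * Nat.iter i shift1 (Nat.iter j shift2 a) k l)%C); auto.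
    apply norm2_le_scal.
    assert (hj : norm2_le alpha (Nat.iter j shift2 a) (B ^ j * M)).
    { clear - h. induction j; simpl; [now rewrite Rmult_1_l|].
      rewrite Rmult_assoc. now apply norm2_le_shift2. }
    clear - hj. induction i; simpl; [now rewrite Rmult_1_l|].
    rewrite Rmult_assoc. now apply norm2_le_shift1.
Qed.

Lemma norm2_le_diag (alpha : R) (e : nat -> C) (M : R) :
  (forall n, rsum (fun k => D_weight alpha k k * Cmod (e k) ^ 2) n <= M) ->
  norm2_le alpha (diag e) M.
Proof.
  intros h m n. eapply Rle_trans; [|apply (h m)]. apply rsum_le. intros k _.
  rewrite (rsum_ext _ (fun l => if Nat.eq_dec k l then D_weight alpha k k * Cmod (e k) ^ 2 else 0)).
  - apply (rsum_diag_row_le (fun k => D_weight alpha k k * Cmod (e k) ^ 2)).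
    apply (D_term_nonneg alpha (fun k _ => e k)).
  - intros l _. unfold diag. destruct (Nat.eq_dec k l) as [<-|]; auto. rewrite Cmod_0. ring.
Qed.

Lemma norm2_le_diag_part (alpha : R) (a : nat -> nat -> C) (M : R) (n : nat) :
  norm2_le alpha a M -> rsum (fun k => D_weight alpha k k * Cmod (a k k) ^ 2) n <= M.
Proof.
  intros h. eapply Rle_trans; [|apply (h n n)]. apply rsum_le. intros k hk.
  apply (rsum_term_le (fun l => D_weight alpha k l * Cmod (a k l) ^ 2) n k); auto.
  intros. apply D_term_nonneg.
Qed.

(** * Reduction to one variable *)

Lemma pow_n_Cpow (z : C) (k : nat) : @pow_n C_Ring z k = (z ^ k)%C.
Proof. induction k; simpl; [reflexivity|]. now rewrite IHk. Qed.

Lemma analytic_on_disk_lq (r : R) (g : C -> C) (w : C) :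
  analytic_on_disk r g -> Cmod w < r -> lq g w.
Proof.
  intros hg hw. destruct (hg w hw) as [b [rho [hrho hb]]].
  apply (lq_power_series b g w w rho).
  - intros z hz. apply (is_cseries_ext (fun k => @pow_n C_Ring (z - w)%C k * b k)%C).
    + intros k. rewrite pow_n_Cpow. ring.
    + exact (hb z hz).
  - replace (w - w)%C with (RtoC 0) by ring. now rewrite Cmod_0.
Qed.

Lemma psum_dilate (e : nat -> C) (x : R) (t w : C) : 0 <= x -> geo x e -> x * Cmod (t * w) < 1 ->
  psum (fun k => t ^ k * e k)%C w = psum e (t * w)%C.
Proof.
  intros hx he hw. apply psum_unique.
  apply (is_cseries_ext (fun k => e k * (t * w) ^ k)%C).
  - intros k. rewrite Cpow_mult_l. ring.
  - now apply (psum_correct x).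
Qed.

Lemma Cmod_2 : Cmod (RtoC 2) = 2.
Proof. rewrite Cmod_R. apply Rabs_pos_eq. lra. Qed.

Lemma geo_dilate2 (e : nat -> C) (x : R) : 0 <= x <= 1 -> geo x e -> geo 2 (fun k => RtoC 2 ^ k * e k)%C.
Proof.
  intros hx [K [hK h]]. exists K. split; auto. intros k.
  rewrite Cmod_mult, Cmod_pow, Cmod_2.
  pose proof (h k). pose proof (pow_lt 2 k ltac:(lra)).
  assert (h1 : x ^ k <= 1) by (rewrite <- (pow1 k); apply pow_incr; lra).
  rewrite Rmult_comm. apply Rmult_le_compat_r; [lra|]. nra.
Qed.

(** With [s = 1 / sqrt 2], [s^2 = 1/2] makes the restriction at [s w] equal to the profile at [w],
    so the disk of radius [s] becomes the unit disk. Analytic continuation past it turns into a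
    ratio [x < 1]. *)
Lemma diagonal_profile (alpha : R) (f : C -> C -> C) :
  in_J alpha f -> NZAC (1 / sqrt 2) (restr f) ->
  exists b x zeta, 0 < x < 1 /\ geo x b /\ (forall z, Cmod z < 1 -> psum b z <> RtoC 0) /\
    Cmod zeta = 1 /\ psum b zeta = RtoC 0 /\
    (forall z1 z2, in_ball2 z1 z2 -> f z1 z2 = psum b (2 * (z1 * z2))%C).
Proof.
  intros [_ [a ha]] [_ [hnz [r [G [hr [hG [hGf [z0 [hz0 hGz0]]]]]]]]].
  set (s := 1 / sqrt 2) in *.
  assert (hs2 : s * s = / 2).
  { unfold s. replace (1 / sqrt 2 * (1 / sqrt 2)) with (/ (sqrt 2 * sqrt 2)).
    - rewrite sqrt_sqrt; lra.
    - field. apply Rgt_not_eq, sqrt_lt_R0. lra. }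
  assert (hs : 0 < s < 1).
  { assert (0 < s) by (unfold s; apply Rdiv_lt_0_compat; [lra|apply sqrt_lt_R0; lra]). nra. }
  assert (hlq : forall w, Cmod w < r -> lq G w) by (intros; now apply (analytic_on_disk_lq r)).
  set (c := fun k => (a k * RtoC s ^ k)%C).
  assert (hc : forall z, Cmod z < s -> is_cseries (fun k => c k * z ^ k)%C (restr f z)).
  { intros z hz. apply (is_cseries_ext (fun k => a k * (z * RtoC s) ^ k)%C).
    - intros k. unfold c. rewrite Cpow_mult_l. ring.
    - apply ha. unfold in_ball2. fold s. rewrite (Cmod_R s), Rabs_pos_eq by lra.
      pose proof (Cmod_ge_0 z). nra. }
  assert (hcG : forall z, Cmod z < s -> is_cseries (fun k => c k * z ^ k)%C (G z)).
  { intros z hz. rewrite hGf by auto. now apply hc. }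
  set (r1 := (s + r) / 2).
  assert (hgc : geo (/ r1) c) by (apply (geo_of_lq G c s r r1); auto; unfold r1; lra).
  (* That is [a k] times [2^(-k)]: one power of [s] from the restriction, one from rescaling the
     disk. *)
  set (b := fun k => (RtoC s ^ k * c k)%C).
  set (x := s / r1).
  assert (hx : 0 < x < 1).
  { unfold x. split; [apply Rdiv_lt_0_compat; unfold r1; lra|].
    apply (Rmult_lt_reg_r r1); [unfold r1; lra|]. unfold Rdiv.
    rewrite Rmult_assoc, Rinv_l; unfold r1; lra. }
  assert (hb : geo x b).
  { destruct hgc as [K [hK hgc]]. exists K. split; auto. intros k. unfold b, x, Rdiv.
    rewrite Cmod_mult, Cmod_pow, Cmod_R, Rabs_pos_eq, Rpow_mult_distr by lra.
    pose proof (pow_lt s k (proj1 hs)). specialize (hgc k).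
    replace (K * (s ^ k * (/ r1) ^ k)) with (s ^ k * (K * (/ r1) ^ k)) by ring.
    apply Rmult_le_compat_l; lra. }
  assert (hsz : forall z, Cmod (s * z) = s * Cmod z).
  { intros z. rewrite Cmod_mult, Cmod_R, Rabs_pos_eq; lra. }
  assert (hszlt : forall z, Cmod z < 1 -> Cmod (s * z) < s).
  { intros z hz. rewrite hsz. rewrite <- (Rmult_1_r s) at 2. apply Rmult_lt_compat_l; lra. }
  assert (hbG : forall z, Cmod z < 1 -> psum b z = G (s * z)%C).
  { intros z hz. apply psum_unique. apply (is_cseries_ext (fun k => c k * (s * z) ^ k)%C).
    - intros k. unfold b. rewrite Cpow_mult_l. ring.
    - now apply hcG, hszlt. }
  assert (hsnz : RtoC s <> RtoC 0) by (intros e; apply RtoC_inj in e; lra).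
  set (zeta := (z0 / RtoC s)%C).
  assert (hzeta : Cmod zeta = 1).
  { unfold zeta. rewrite Cmod_div, Cmod_R, Rabs_pos_eq, hz0 by (auto; lra). field. lra. }
  assert (hszeta : (s * zeta)%C = z0) by (unfold zeta; field; auto).
  exists b, x, zeta. split; auto. split; auto. split; [|split; auto; split].
  - intros z hz. rewrite hbG, hGf by auto. apply hnz. auto.
  (* [psum b] and [G] have been compared only inside the open disk, so the boundary zero is reached
     radially, by Lipschitz continuity of both. *)
  - apply Cmod_small_eq_0. intros eps heps.
    destruct (lq_lipschitz (psum b) zeta) as [d1 [M1 [hd1 [hM1 h1]]]].
    { apply (lq_psum b x); auto; [lra|rewrite hzeta; lra]. }
    destruct (lq_lipschitz G z0) as [d2 [M2 [hd2 [hM2 h2]]]]; [apply hlq; lra|].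
    set (e := Rmin (Rmin d1 d2) (Rmin 1 (eps / (M1 + M2))) / 2).
    assert (he : 0 < e /\ e < d1 /\ e < d2 /\ e < 1 /\ e < eps / (M1 + M2)).
    { assert (0 < eps / (M1 + M2)) by (apply Rdiv_lt_0_compat; lra).
      assert (0 < Rmin (Rmin d1 d2) (Rmin 1 (eps / (M1 + M2)))) by (repeat apply Rmin_glb_lt; lra).
      assert (k1 := Rmin_l (Rmin d1 d2) (Rmin 1 (eps / (M1 + M2)))).
      assert (k2 := Rmin_r (Rmin d1 d2) (Rmin 1 (eps / (M1 + M2)))).
      assert (k3 := Rmin_l d1 d2). assert (k4 := Rmin_r d1 d2).
      assert (k5 := Rmin_l 1 (eps / (M1 + M2))). assert (k6 := Rmin_r 1 (eps / (M1 + M2))).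
      unfold e. lra. }
    set (u := (RtoC (1 - e) * zeta)%C).
    assert (hu : Cmod u < 1).
    { unfold u. rewrite Cmod_mult, hzeta, Cmod_R, Rabs_pos_eq; lra. }
    assert (hd : Cmod (u - zeta) = e).
    { unfold u. rewrite RtoC_minus. replace ((1 - e) * zeta - zeta)%C with (- (e * zeta))%C by ring.
      rewrite Cmod_opp, Cmod_mult, hzeta, Cmod_R, Rabs_pos_eq; lra. }
    assert (hd' : Cmod (s * u - z0) = s * e).
    { rewrite <- hszeta, <- hd, <- hsz. f_equal. ring. }
    specialize (h1 u ltac:(lra)). specialize (h2 (s * u)%C ltac:(rewrite hd'; nra)).
    rewrite hbG in h1 by auto. rewrite hd in h1. rewrite hd', hGz0 in h2.
    replace (psum b zeta) with ((G (s * u) - 0) - (G (s * u) - psum b zeta))%C by ring.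
    eapply Rle_lt_trans; [apply Cmod_sub_le|].
    assert (hlt : (M1 + M2) * e < eps).
    { apply Rlt_le_trans with ((M1 + M2) * (eps / (M1 + M2))); [apply Rmult_lt_compat_l; lra|].
      right. field. lra. }
    assert (M2 * (s * e) <= M2 * e) by (apply Rmult_le_compat_l; nra). lra.
  - intros z1 z2 hz. symmetry. apply psum_unique.
    apply (is_cseries_ext (fun k => a k * (z1 * z2) ^ k)%C); [|now apply ha].
    intros k. unfold b, c.
    replace (RtoC s ^ k * (a k * RtoC s ^ k) * (2 * (z1 * z2)) ^ k)%C
      with (a k * ((RtoC s ^ k * RtoC s ^ k) * (2 * (z1 * z2)) ^ k))%C by ring.
    rewrite <- !Cpow_mult_l.
    replace (s * s * (2 * (z1 * z2)))%C with (RtoC (s * s * 2) * (z1 * z2))%C by (rewrite !RtoC_mult; ring).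
    rewrite hs2. replace (/ 2 * 2) with 1 by field. now rewrite Cmult_1_l.
Qed.

Lemma has_taylor2_one : has_taylor2 (fun _ _ => RtoC 1) (diag one_seq).
Proof.
  apply has_taylor2_diag; [apply geo_one_seq; lra|]. intros z1 z2 _.
  symmetry. apply psum_unique, is_cseries_one_seq.
Qed.

Lemma norm2_one (alpha : R) : norm2_le alpha (diag one_seq) (D_weight alpha 0 0).
Proof.
  apply norm2_le_diag. intros n.
  apply Rle_trans with (rsum (fun k => D_weight alpha k k * Cmod (one_seq k) ^ 2) 1).
  - apply rsum_support.
    + intros. apply (D_term_nonneg alpha (fun k _ => one_seq k)).
    + intros [|k] hk; [lia|]. simpl one_seq. rewrite Cmod_0. ring.
  - simpl. rewrite Cmod_1. lra.
Qed.

Lemma has_taylor2_profile (f : C -> C -> C) (b : nat -> C) (x : R) :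
  0 < x < 1 -> geo x b ->
  (forall z1 z2, in_ball2 z1 z2 -> f z1 z2 = psum b (2 * (z1 * z2))%C) ->
  has_taylor2 f (diag (fun k => RtoC 2 ^ k * b k)%C).
Proof.
  intros hx hb hf. apply has_taylor2_diag; [apply (geo_dilate2 b x); auto; lra|].
  intros z1 z2 hz. rewrite hf by auto. symmetry. apply (psum_dilate b x); auto; [lra|].
  rewrite (Cmod_mult 2), Cmod_2. pose proof (Cmod_mult_in_ball2 z1 z2 hz).
   nra.
Qed.

Fixpoint diag_poly (q : nat -> C) (n : nat) : poly :=
  match n with
  | 0%nat => nil
  | S m => ((RtoC 2 ^ m * q m)%C, m, m) :: diag_poly q m
  end.

Lemma diag_poly_eval (q : nat -> C) (n : nat) (z1 z2 : C) :
  peval (diag_poly q n) z1 z2 = csum (fun k => q k * (2 * (z1 * z2)) ^ k)%C n.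
Proof.
  induction n; simpl; [reflexivity|]. rewrite IHn, !Cpow_mult_l. ring.
Qed.

Lemma diag_poly_degree (q : nat -> C) (n : nat) : pdegree_le (2 * n) (diag_poly q (S n)).
Proof.
  intros c i j h. enough (i < S n /\ j < S n)%nat by lia. revert h.
  generalize (S n). intros m. induction m; simpl; [intros []|].
  intros [h|h]; [injection h; intros; subst; lia|]. specialize (IHm h). lia.
Qed.

Lemma diag_weight_term (alpha : R) (e : nat -> C) (k : nat) :
  D_weight alpha k k * Cmod (RtoC 2 ^ k * e k) ^ 2 = diag_weight alpha k * Cmod (e k) ^ 2.
Proof.
  rewrite Cmod_mult, Cmod_pow, Cmod_2, Rpow_mult_distr, <- pow_mult, Nat.mul_comm, pow_mult.
  unfold diag_weight. replace (2 ^ 2) with 4 by ring. ring.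
Qed.

(** [beta] may exceed [alpha - 1/2]: larger weights only strengthen the estimate, which covers
    [alpha < 1/2] as well. *)
Lemma optimal_upper (alpha beta x : R) (f : C -> C -> C) (b : nat -> C) :
  0 <= beta <= 1 -> alpha - 1 / 2 <= beta ->
  0 < x < 1 -> geo x b -> (forall z, Cmod z < 1 -> psum b z <> RtoC 0) ->
  (forall z1 z2, in_ball2 z1 z2 -> f z1 z2 = psum b (2 * (z1 * z2))%C) ->
  exists K, 0 < K /\ forall n, exists p e, pdegree_le (2 * n) p /\
    has_taylor2 (fun z1 z2 => peval p z1 z2 * f z1 z2 - 1)%C e /\
    norm2_le alpha e (K / Phi beta (S n)).
Proof.
  intros hbeta hab hx hb hnz hf.
  set (K0 := Rpower 2 alpha). assert (hK0 : 0 < K0) by apply exp_pos.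
  destruct (approx_upper beta K0 x (diag_weight alpha) b hbeta hK0) as [K [hK happ]]; auto.
  { intros k. destruct (diag_weight_bounds alpha k) as [h1 h2]. fold K0 in h1, h2.
    pose proof (wt_pos (alpha - 1 / 2) k). split.
    - apply Rle_trans with (K0 / 2 * wt (alpha - 1 / 2) k); auto.
      apply Rmult_le_pos; lra.
    - eapply Rle_trans; [apply h2|]. apply Rmult_le_compat_l; [lra|].
      apply Rle_Rpower; auto. apply INR_S_ge_1. }
  exists K. split; auto. intros n. destruct (happ n) as [q [hq hN]].
  set (e := fun k => (conv q b k - one_seq k)%C) in *.
  exists (diag_poly q (S n)), (diag (fun k => RtoC 2 ^ k * e k)%C).
  split; [apply diag_poly_degree|].
  set (y := (x + 1) / 2).
  assert (hy : x < y < 1) by (unfold y; lra).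
  assert (hgq : geo x q) by (apply (geo_finite q x n); auto; lra).
  assert (hge : geo y e).
  { destruct (geo_conv q b x y ltac:(lra) hgq hb) as [A [hA h1]].
    destruct (geo_one_seq y ltac:(lra)) as [B [hB h2]].
    exists (A + B). split; [lra|]. intros k. eapply Rle_trans; [apply Cmod_sub_le|].
    rewrite Rmult_plus_distr_r. apply Rplus_le_compat; auto. }
  split.
  - apply has_taylor2_diag; [apply (geo_dilate2 e y); auto; lra|]. intros z1 z2 hz.
    set (w := (2 * (z1 * z2))%C).
    assert (hw : Cmod w < 1).
    { unfold w. rewrite Cmod_mult, Cmod_2. now apply Cmod_mult_in_ball2. }
    rewrite (psum_dilate e y) by (auto; fold w; nra). fold w. symmetry. apply psum_unique.
    rewrite diag_poly_eval, hf by auto. fold w.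
    assert (hqw : psum q w = csum (fun k => q k * w ^ k)%C (S n)).
    { apply psum_unique, is_cseries_finite. intros k hk. rewrite hq by lia. ring. }
    rewrite <- hqw.
    apply (is_cseries_ext (fun k => conv q b k * w ^ k + (- (1)) * (one_seq k * w ^ k))%C).
    + intros k. unfold e. ring.
    + replace (psum q w * psum b w - 1)%C with (psum q w * psum b w + - (1) * 1)%C by ring.
      apply is_cseries_add.
      * apply (psum_conv q b x); auto; [lra|nra].
      * apply is_cseries_scal, is_cseries_one_seq.
  - apply norm2_le_diag. intros N. eapply Rle_trans; [|apply (hN N)]. right.
    apply rsum_ext. intros k _. apply diag_weight_term.
Qed.

Lemma optimal_lower (alpha x : R) (f : C -> C -> C) (b : nat -> C) (zeta : C) :
  1 / 2 <= alpha ->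
  0 < x < 1 -> geo x b -> (forall z, Cmod z < 1 -> psum b z <> RtoC 0) ->
  Cmod zeta = 1 -> psum b zeta = RtoC 0 ->
  (forall z1 z2, in_ball2 z1 z2 -> f z1 z2 = psum b (2 * (z1 * z2))%C) ->
  exists c, 0 < c /\ forall n p N, pdegree_le (2 * n) p ->
    is_D_norm alpha (fun z1 z2 => peval p z1 z2 * f z1 z2 - 1)%C N ->
    c / Phi (alpha - 1 / 2) (S n) <= N ^ 2.
Proof.
  intros ha hx hb hnz hz hz0 hf.
  assert (hP : 0 < Rpower 2 alpha) by apply exp_pos.
  destruct (approx_lower (alpha - 1 / 2) (Rpower 2 alpha / 2) x (diag_weight alpha) b zeta)
    as [c [hc hlow]]; auto; try lra.
  { intros k. apply diag_weight_bounds. }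
  exists c. split; auto. intros n p N hp hN.
  set (a := fun k => (RtoC 2 ^ k * b k)%C).
  assert (ht : has_taylor2 (fun z1 z2 => peval p z1 z2 * f z1 z2 - 1)%C
    (fun k l => pcoef p (diag a) k l + - (1) * diag one_seq k l)%C).
  { apply (has_taylor2_ext (fun z1 z2 => peval p z1 z2 * f z1 z2 + - (1) * 1)%C _
      (fun k l => pcoef p (diag a) k l + - (1) * diag one_seq k l)%C); auto.
    - intros. ring.
    - apply (has_taylor2_add (fun z1 z2 => peval p z1 z2 * f z1 z2)%C (fun _ _ => - (1) * 1)%C).
      + apply has_taylor2_poly. now apply (has_taylor2_profile f b x).
      + apply (has_taylor2_scal (- (1))%C (fun _ _ => RtoC 1)), has_taylor2_one. }
  destruct (is_D_norm_coef alpha _ _ N ht hN) as [_ hds].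
  (* The diagonal part of [p], rewritten in the variable [2 z1 z2]. *)
  set (q := fun k => ((/ RtoC 2) ^ k * pdiag p k)%C).
  assert (h2 : RtoC 2 <> RtoC 0) by (intros e; apply RtoC_inj in e; lra).
  assert (hpq : forall k, pdiag p k = (q k * RtoC 2 ^ k)%C).
  { intros k. unfold q. rewrite Cpow_inv_l by auto. field. now apply Cpow_nz. }
  apply (hlow n q).
  - intros k hk. unfold q. rewrite (pdiag_support n p hp k hk). ring.
  - intros m.
    eapply Rle_trans; [|apply (norm2_le_diag_part alpha
      (fun k l => pcoef p (diag a) k l + - (1) * diag one_seq k l)%C (N ^ 2) m)].
    + right. apply rsum_ext. intros k _.
      pose proof (diag_weight_term alpha (fun j => conv q b j - one_seq j)%C k) as h.
      cbv beta in h. rewrite <- h. do 3 f_equal.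
      rewrite pcoef_diag. unfold diag. destruct (Nat.eq_dec k k); [|lia].
      rewrite (conv_ext (pdiag p) (fun j => q j * RtoC 2 ^ j)%C a (fun j => b j * RtoC 2 ^ j)%C)
        by (intros; auto; unfold a; ring).
      rewrite conv_pow. destruct k; simpl; ring.
    + intros i j. apply double_series_rect_le; auto. apply D_term_nonneg.
Qed.

Lemma is_D_norm_ext (alpha : R) (F G : C -> C -> C) (N : R) :
  (forall z1 z2, F z1 z2 = G z1 z2) -> is_D_norm alpha F N -> is_D_norm alpha G N.
Proof.
  intros h [hN [a [ha hs]]]. split; auto. exists a. split; auto.
  apply (has_taylor2_ext F G a a); auto.
Qed.

(** The witness for [B] also shows that the infimum is finite, so that [real] does not return its
    default value. *)
Lemma dist1_sqr_bounds (alpha : R) (F : C -> C -> C) (n : nat) (A B : R) :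
  (forall p N, pdegree_le (2 * n) p ->
    is_D_norm alpha (fun z1 z2 => peval p z1 z2 * F z1 z2 - 1)%C N -> A <= N ^ 2) ->
  (exists p N, pdegree_le (2 * n) p /\
    is_D_norm alpha (fun z1 z2 => peval p z1 z2 * F z1 z2 - 1)%C N /\ N ^ 2 <= B) ->
  A <= dist1 alpha F n ^ 2 <= B.
Proof.
  intros hA [p [N [hp [hN hB]]]]. unfold dist1. set (S := fun _ => _).
  assert (hS : forall M, S M -> 0 <= M /\ A <= M ^ 2).
  { intros M [c hc]. split; [apply hc|].
    destruct (sum_tri_poly (2 * n) c) as [p' [hp' he]]. apply (hA p'); auto.
    apply (is_D_norm_ext alpha (fun z1 z2 => poly2 (2 * n) c z1 z2 * F z1 z2 - 1)%C); auto.
    intros z1 z2. f_equal. f_equal. rewrite <- (Cmult_1_r (peval p' z1 z2)), <- he.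
    unfold poly2. apply sum_tri_ext. intros. ring. }
  assert (hSN : S N).
  { destruct (poly_sum_tri (2 * n) p hp) as [c hc]. exists c.
    apply (is_D_norm_ext alpha (fun z1 z2 => peval p z1 z2 * F z1 z2 - 1)%C); auto.
    intros z1 z2. f_equal. f_equal. rewrite <- (Cmult_1_r (peval p z1 z2)), <- hc.
    unfold poly2. apply sum_tri_ext. intros. ring. }
  destruct (Glb_Rbar_correct S) as [hlb hglb].
  pose proof (hlb N hSN) as h1.
  assert (h2 : Rbar_le (Finite (sqrt A)) (Glb_Rbar S)).
  { apply hglb. intros M hM. simpl. destruct (hS M hM) as [hM0 hMA].
    rewrite <- (sqrt_pow2 M) by auto. now apply sqrt_le_1_alt. }
  destruct (Glb_Rbar S) as [d| |]; simpl real; simpl in h1, h2; try contradiction.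
  pose proof (sqrt_pos A). split.
  - destruct (Rle_dec 0 A) as [h0|h0].
    + rewrite <- (pow2_sqrt A) by auto. apply pow_incr. lra.
    + pose proof (pow2_ge_0 d). lra.
  - apply Rle_trans with (N ^ 2); auto. apply pow_incr. lra.
Qed.

(** * Density of polynomials and cyclicity *)

Fixpoint prow (a : nat -> nat -> C) (k n : nat) : poly :=
  match n with 0%nat => nil | S l => (a k l, k, l) :: prow a k l end.

Fixpoint prect (a : nat -> nat -> C) (m n : nat) : poly :=
  match m with 0%nat => nil | S k => prow a k n ++ prect a k n end.

Lemma pcoef_app (p q : poly) (a : nat -> nat -> C) (k l : nat) :
  pcoef (p ++ q) a k l = (pcoef p a k l + pcoef q a k l)%C.
Proof. induction p as [|[[c i] j] p IH]; simpl; [ring|]. rewrite IH. ring. Qed.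

Lemma monomial_coef (i j k l : nat) :
  Nat.iter i shift1 (Nat.iter j shift2 (diag one_seq)) k l
  = if Nat.eq_dec k i then if Nat.eq_dec l j then RtoC 1 else RtoC 0 else RtoC 0.
Proof.
  rewrite shift1_iter. destruct (le_dec i k); [|destruct (Nat.eq_dec k i); [lia|auto]].
  rewrite shift2_iter. destruct (le_dec j l).
  - unfold diag. destruct (Nat.eq_dec (k - i) (l - j)).
    + destruct (k - i)%nat eqn:hk; simpl;
      destruct (Nat.eq_dec k i), (Nat.eq_dec l j); try lia; auto.
    + destruct (Nat.eq_dec k i), (Nat.eq_dec l j); try lia; auto.
  - destruct (Nat.eq_dec k i), (Nat.eq_dec l j); try lia; auto.
Qed.

Lemma prow_coef (a : nat -> nat -> C) (i n k l : nat) :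
  pcoef (prow a i n) (diag one_seq) k l
  = if Nat.eq_dec k i then if lt_dec l n then a k l else RtoC 0 else RtoC 0.
Proof.
  induction n; simpl.
  - destruct (Nat.eq_dec k i); auto.
  - rewrite IHn, monomial_coef.
    destruct (Nat.eq_dec k i) as [->|]; [|ring].
    destruct (Nat.eq_dec l n) as [->|].
    + destruct (lt_dec n n), (lt_dec n (S n)); try lia. ring.
    + destruct (lt_dec l n), (lt_dec l (S n)); try lia; ring.
Qed.

Lemma prect_coef (a : nat -> nat -> C) (m n k l : nat) :
  pcoef (prect a m n) (diag one_seq) k l
  = if lt_dec k m then if lt_dec l n then a k l else RtoC 0 else RtoC 0.
Proof.
  induction m; simpl; [reflexivity|]. rewrite pcoef_app, IHm, prow_coef.
  destruct (Nat.eq_dec k m), (lt_dec k m), (lt_dec k (S m)), (lt_dec l n); try lia; ring.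
Qed.

(** The kept part already exceeds [s - eta] and kept and discarded parts together stay below [s], on
    every rectangle. *)
Lemma norm2_truncation (alpha s eta : R) (a : nat -> nat -> C) :
  is_double_series (V := R_NormedModule) (fun k l => D_weight alpha k l * Cmod (a k l) ^ 2) s ->
  0 < eta ->
  exists m n, norm2_le alpha
    (fun k l => pcoef (prect a m n) (diag one_seq) k l + - (1) * a k l)%C eta.
Proof.
  intros hs heta. set (u := fun k l => D_weight alpha k l * Cmod (a k l) ^ 2) in *.
  assert (hu : forall k l, 0 <= u k l) by (intros; apply D_term_nonneg).
  destruct (double_series_approx u s eta hu hs heta) as [m [n hmn]].
  exists m, n. intros m' n'.
  set (v := fun k l => if lt_dec k m then if lt_dec l n then u k l else 0 else 0).
  set (t := fun k l => D_weight alpha k l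
     * Cmod (pcoef (prect a m n) (diag one_seq) k l + - (1) * a k l) ^ 2).
  assert (ht : forall k l, 0 <= t k l).
  { intros. apply Rmult_le_pos; [left; apply D_weight_pos|apply pow2_ge_0]. }
  assert (hv : forall k l, 0 <= v k l).
  { intros k l. unfold v. destruct (lt_dec k m), (lt_dec l n); auto; lra. }
  assert (hsplit : forall k l, u k l = t k l + v k l).
  { intros k l. unfold t, v. rewrite prect_coef.
    destruct (lt_dec k m), (lt_dec l n).
    1: replace (a k l + - (1) * a k l)%C with (RtoC 0) by ring; rewrite Cmod_0; ring.
    all: replace (0 + - (1) * a k l)%C with (- a k l)%C by ring; rewrite Cmod_opp; unfold u; ring. }
  change (rect_sum t m' n' <= eta).
  apply Rle_trans with (rect_sum t (m + m') (n + n')); [apply rect_sum_mono; auto; lia|].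
  assert (h1 : rect_sum t (m + m') (n + n') + rect_sum v (m + m') (n + n') <= s).
  { rewrite <- rect_sum_add.
    eapply Rle_trans; [|apply (double_series_rect_le u s (m + m') (n + n') hu hs)].
    apply rect_sum_le. intros. rewrite hsplit. lra. }
  assert (h2 : rect_sum u m n <= rect_sum v (m + m') (n + n')).
  { apply Rle_trans with (rect_sum v m n); [|apply rect_sum_mono; auto; lia].
    right. apply rsum_ext. intros k hk. apply rsum_ext. intros l hl. unfold v.
    destruct (lt_dec k m), (lt_dec l n); try lia; auto. }
  lra.
Qed.

Lemma poly_in_shift_span (F : C -> C -> C) (p : poly) :
  in_shift_span F (fun z1 z2 => peval p z1 z2 * F z1 z2)%C.
Proof.
  destruct (pdegree_exists p) as [d hd]. destruct (poly_sum_tri d p hd) as [c hc].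
  exists d, c. intros z1 z2. symmetry. apply hc.
Qed.

(** [P p f - G = P (p f - 1) + (P - G)]. The polynomial [P] is fixed first, so multiplication by it
    has a fixed bound when [p] is chosen. *)
Lemma cyclic_of_upper (alpha beta x : R) (f : C -> C -> C) (b : nat -> C) :
  0 <= beta <= 1 -> alpha - 1 / 2 <= beta ->
  0 < x < 1 -> geo x b -> (forall z, Cmod z < 1 -> psum b z <> RtoC 0) ->
  (forall z1 z2, in_ball2 z1 z2 -> f z1 z2 = psum b (2 * (z1 * z2))%C) ->
  cyclic alpha f.
Proof.
  intros hbeta hab hx hb hnz hf.
  destruct (optimal_upper alpha beta x f b hbeta hab hx hb hnz hf) as [K [hK hup]].
  intros G [NG [_ [a [ha hs]]]] eps heps.
  (* Two errors of this size, each doubled by [norm2_le_add], leave [eps ^ 2 / 2]. *)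
  assert (heta : 0 < eps ^ 2 / 8) by (apply Rdiv_lt_0_compat; [apply pow_lt|]; lra).
  destruct (norm2_truncation alpha _ (eps ^ 2 / 8) a hs heta) as [m [n htr]].
  set (P := prect a m n) in *.
  destruct (norm2_le_poly alpha P) as [KP [hKP hP]].
  destruct (Phi_unbounded beta (KP * K * (8 / eps ^ 2)) hbeta) as [N hN].
  destruct (hup N) as [p [e [_ [hte hne]]]].
  pose proof (Phi_ge_1 beta N) as hPhi.
  assert (hsmall : KP * (K / Phi beta (S N)) <= eps ^ 2 / 8).
  { apply (Rmult_le_reg_r (Phi beta (S N) * (8 / eps ^ 2))).
    - apply Rmult_lt_0_compat; [lra|]. apply Rdiv_lt_0_compat; [lra|now apply pow_lt].
    - replace (KP * (K / Phi beta (S N)) * (Phi beta (S N) * (8 / eps ^ 2)))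
        with (KP * K * (8 / eps ^ 2)) by (field; lra).
      replace (eps ^ 2 / 8 * (Phi beta (S N) * (8 / eps ^ 2))) with (Phi beta (S N)) by (field; lra).
      lra. }
  destruct (is_D_norm_intro alpha
    (fun z1 z2 => peval (pmul P p) z1 z2 * f z1 z2 - G z1 z2)%C
    (fun k l => pcoef P e k l + (pcoef P (diag one_seq) k l + - (1) * a k l))%C
    (2 * (KP * (K / Phi beta (S N))) + 2 * (eps ^ 2 / 8))) as [N' [hN' hle]].
  - apply (has_taylor2_ext (fun z1 z2 => peval P z1 z2 * (peval p z1 z2 * f z1 z2 - 1)
       + (peval P z1 z2 * 1 + - (1) * G z1 z2))%C _
      (fun k l => pcoef P e k l + (pcoef P (diag one_seq) k l + - (1) * a k l))%C); auto.
    + intros. rewrite peval_mul. ring.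
    + apply (has_taylor2_add (fun z1 z2 => peval P z1 z2 * (peval p z1 z2 * f z1 z2 - 1))%C
        (fun z1 z2 => peval P z1 z2 * 1 + - (1) * G z1 z2)%C).
      * now apply (has_taylor2_poly P (fun z1 z2 => peval p z1 z2 * f z1 z2 - 1)%C).
      * apply (has_taylor2_add (fun z1 z2 => peval P z1 z2 * 1)%C (fun z1 z2 => - (1) * G z1 z2)%C).
        -- apply (has_taylor2_poly P (fun _ _ => RtoC 1)), has_taylor2_one.
        -- now apply has_taylor2_scal.
  - apply norm2_le_add; auto.
  - exists (fun z1 z2 => peval (pmul P p) z1 z2 * f z1 z2)%C, N'.
    split; [apply poly_in_shift_span|]. split; auto.
    destruct hN' as [h0 _].  nra.
Qed.

Lemma not_cyclic_of_lower (alpha c B : R) (f : C -> C -> C) :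
  0 < c -> (forall n, Phi (alpha - 1 / 2) n <= B) ->
  (forall n p N, pdegree_le (2 * n) p ->
    is_D_norm alpha (fun z1 z2 => peval p z1 z2 * f z1 z2 - 1)%C N ->
    c / Phi (alpha - 1 / 2) (S n) <= N ^ 2) ->
  ~ cyclic alpha f.
Proof.
  intros hc hB hlow hcyc.
  destruct (is_D_norm_intro alpha _ _ _ has_taylor2_one (norm2_one alpha)) as [N1 [hN1 _]].
  assert (hBp : 0 < B).
  { pose proof (hB 1%nat). pose proof (Phi_ge_1 (alpha - 1 / 2) 0). lra. }
  assert (hcB : 0 < c / B) by now apply Rdiv_lt_0_compat.
  destruct (hcyc (fun _ _ => RtoC 1) (ex_intro _ N1 hN1) (sqrt (c / B)) (sqrt_lt_R0 _ hcB))
    as [H [N [[d [coef hH]] [hN hlt]]]].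
  destruct (sum_tri_poly d coef) as [p [hp he]].
  (* Degree [d] is at most [2 * d], so the bound is used at [n = d]; boundedness of [Phi] makes it
     independent of [d]. *)
  assert (hlb : c / Phi (alpha - 1 / 2) (S d) <= N ^ 2).
  { apply (hlow d p).
    - intros c0 i j h. specialize (hp _ _ _ h). lia.
    - apply (is_D_norm_ext alpha (fun z1 z2 => H z1 z2 - 1)%C); auto.
      intros z1 z2. rewrite hH, he. reflexivity. }
  assert (hPhi : c / B <= c / Phi (alpha - 1 / 2) (S d)).
  { apply Rmult_le_compat_l; [lra|]. pose proof (Phi_ge_1 (alpha - 1 / 2) d).
    apply Rinv_le_contravar; [lra|apply hB]. }
  destruct hN as [hN0 _].
  assert (N ^ 2 < c / B).
  { rewrite <- (pow2_sqrt (c / B)) by lra. simpl. rewrite !Rmult_1_r.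
    apply Rmult_le_0_lt_compat; auto. }
  lra.
Qed.

Theorem theorem3p1 (alpha : R) (f : C -> C -> C)
    (hf : in_J alpha f) (hR : NZAC (1 / sqrt 2) (restr f)) :
  (cyclic alpha f <-> (alpha <= 3 / 2)%R) /\
  ((1 / 2 <= alpha <= 3 / 2)%R ->
   asymp (fun n => (dist1 alpha f n ^ 2)%R)
         (fun n => (1 / phi (alpha - 1 / 2) (n + 1))%R)).
Proof.
  destruct (diagonal_profile alpha f hf hR) as [b [x [zeta [hx [hb [hnz [hz [hz0 hfb]]]]]]]].
  split; [split|].
  - intros hcyc. apply Rnot_lt_le. intros ha.
    destruct (optimal_lower alpha x f b zeta ltac:(lra) hx hb hnz hz hz0 hfb) as [c [hc hlow]].
    destruct (Phi_bounded (alpha - 1 / 2) ltac:(lra)) as [B [_ hB]].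
    exact (not_cyclic_of_lower alpha c B f hc hB hlow hcyc).
  - intros ha. apply (cyclic_of_upper alpha (Rmax 0 (alpha - 1 / 2)) x f b); auto.
    + split; [apply Rmax_l|apply Rmax_lub; lra].
    + apply Rmax_r.
  - intros ha.
    assert (hbeta : 0 <= alpha - 1 / 2 <= 1) by lra.
    destruct (optimal_lower alpha x f b zeta ltac:(lra) hx hb hnz hz hz0 hfb) as [c [hc hlow]].
    destruct (optimal_upper alpha (alpha - 1 / 2) x f b hbeta ltac:(lra) hx hb hnz hfb) as [K [hK hup]].
    destruct (phi_equiv_Phi (alpha - 1 / 2) hbeta) as [Q [hQ hphi]].
    (* The lower constant pays [Phi <= Q * phi]; the upper one is unchanged, since [phi <= Phi]. *)
    exists (c / Q), K. split; [now apply Rdiv_lt_0_compat|]. split; auto. intros n.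
    destruct (hphi n) as [h1 h2]. pose proof (Phi_ge_1 (alpha - 1 / 2) n) as hP.
    set (A := phi (alpha - 1 / 2) (n + 1)) in *. set (F := Phi (alpha - 1 / 2) (S n)) in *.
    assert (hA : 0 < A) by nra.
    destruct (dist1_sqr_bounds alpha f n (c / F) (K / F)) as [hl hu].
    + intros p N hp hN. now apply (hlow n p N).
    + destruct (hup n) as [p [e [hp [hte hne]]]].
      destruct (is_D_norm_intro alpha _ e _ hte hne) as [N [hN hNle]]. exists p, N. auto.
    + split.
      * eapply Rle_trans; [|apply hl].
        replace (c / Q * (1 / A)) with (c * / (Q * A)) by (field; lra).
        apply Rmult_le_compat_l; [lra|]. apply Rinv_le_contravar; lra.
      * eapply Rle_trans; [apply hu|]. replace (K * (1 / A)) with (K * / A) by (field; lra).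
        apply Rmult_le_compat_l; [lra|]. now apply Rinv_le_contravar.
Qed.
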